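(* The categories of shuffle bialgebras, unshuffle bialgebras and infinitesimal bialgebras are isomorphic over $Vect^+$: they are pairwise equivalent, and the equivalences can be realized by natural isomorphisms of underlying graded vector spaces (that is, the equivalences commute with the forgetful functors to $Vect^+$ up to natural isomorphism; concretely, an object of any of the three categories, viewed as an object of $Vect^+$, can be naturally equipped with the other two bialgebra structures). They are all equipped with a natural action of the algebra of graded permutations $\mathbf S$.
   Context: $K$ is a field of arbitrary characteristic. $Vect$ is the category of graded vector spaces $V=\bigoplus_{n\ge0}V_n$ with $V_0=0$ and degree $0$ linear maps; $Vect^+$ is the category of graded vector spaces with $V_0=K$ and degree $0$ linear maps that are the identity on $K$. $\epsilon$ is the projection to $V_0=K$. All structures below are in $Vect^+$ (graded connected); Hopf algebra and bialgebra are then the same. $T(V)=\bigoplus_{n\ge0}V^{\otimes n}\in Vect^+$ for $V\in Vect$; words $v_1\cdots v_n$ denote tensors; $|v|$ is the degree of a homogeneous $v$. Shuffle bialgebra: a commutative Hopf algebra with product $\star$ and coproduct $\Delta$ such that $\star=\prec+\succ$ on $\mathrm{Ker}\,\epsilon$ with $x\prec y=y\succ x$, $(x\prec y)\prec z=x\prec(y\prec z+y\succ z)$, extended by $x\prec1=x$, $1\prec x=0$ for $x\in \mathrm{Ker}\,\epsilon$, and, writing $\Delta(x)=x\otimes1+1\otimes x+x'\otimes x''$, for $x,y\in \mathrm{Ker}\,\epsilon$: $$\Delta(x\prec y)=x\prec y\otimes1+1\otimes x\prec y+x\otimes y+x\prec y'\otimes y''+x'\prec y\otimes x''+x'\otimes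 x''\star y+x'\prec y'\otimes x''\star y''.$$ Morphisms are degree $0$ Hopf algebra morphisms $f$ with $f(x\prec y)=f(x)\prec f(y)$ and $f(x\succ y)=f(x)\succ f(y)$ on $\mathrm{Ker}\,\epsilon$. Unshuffle bialgebra: a bialgebra $(B,\cdot,\delta)$ with associative product $\cdot$ and coassociative cocommutative coproduct $\delta$, equipped with $\delta_\prec,\delta_\succ:\mathrm{Ker}\,\epsilon\to B\otimes B$ such that on $\mathrm{Ker}\,\epsilon$: $\delta=\delta_\prec+\delta_\succ$, $\delta_\prec=\tau\circ\delta_\succ$ ($\tau(x\otimes y)=y\otimes x$), $(\delta_\prec\otimes Id)\circ\delta_\prec=(Id\otimes\delta)\circ\delta_\prec$, $(\epsilon\otimes Id)\circ\delta_\prec=0$, $(Id\otimes\epsilon)\circ\delta_\prec=Id$, and, with $\delta_\prec(x)=x_1^\prec\otimes x_2^\prec$ and $\delta(y)=y_1\otimes y_2$, $\delta_\prec(x\cdot y)=x_1^\prec\cdot y_1\otimes x_2^\prec\cdot y_2$ for $x,y\in \mathrm{Ker}\,\epsilon$. Morphisms are degree $0$ bialgebra morphisms $f$ with $\delta_\prec\circ f=(f\otimes f)\circ\delta_\prec$ and $\delta_\succ\circ f=(f\otimes f)\circ\delta_\succ$. Infinitesimal bialgebra: an associative unital algebra with product $\cdot$ and a coassociative counital coalgebra with coproduct $\Delta(x)=x_1\otimes x_2$ such that $\Delta(x\cdot y)=x\cdot y_1\otimes y_2+x_1\otimes x_2\cdot y-x\otimes y$. Morphisms are degree $0$ linear maps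 that are both algebra and coalgebra morphisms. Graded permutations: $\mathfrak S=\coprod_{k\ge0}\mathfrak S_k\times Hom([k],\mathbb N_{>0})$, with $\mathfrak S_k$ the symmetric group on $[k]=\{1,\dots,k\}$ and $Hom([k],\mathbb N_{>0})$ the set of maps; $\mathbf S$ is the vector space with basis $\mathfrak S$, an (a priori nonunital) associative algebra under $(\sigma,d)\circ(\tau,e)=(\tau\circ\sigma,d)$ if $\sigma,\tau\in\mathfrak S_k$ for the same $k$ and $d=e\circ\sigma$, and $0$ otherwise. It acts on $T(V)$, for every $V\in Vect$, by letting $(\sigma,d)$, $\sigma\in\mathfrak S_k$, act as the endomorphism $\Phi_{(\sigma,d)}$ sending a word $v_1\cdots v_l$ in homogeneous elements to $v_{\sigma(1)}\cdots v_{\sigma(l)}$ if $k=l$ and $|v_{\sigma(i)}|=d(i)$ for all $i$, and to $0$ otherwise. Schur-Weyl category and natural action: a Schur-Weyl category is a category $\mathcal C$ with a forgetful functor $F:\mathcal C\to Vect^+$, a functor $P:\mathcal C\to Vect$, and natural isomorphisms $I(C):T(P(C))\cong F(C)$ for $C\in\mathcal C$. Transporting the action of $\mathbf S$ on $T(P(C))$ along $I(C)$ gives an action of $\mathbf S$ on every $F(C)$, natural in $C$. The three categories in question are Schur-Weyl categories, with $P(B)=Prim(B)=\{x\mid\Delta(x)=x\otimes1+1\otimes x\}$ for shuffle and infinitesimal bialgebras, and $P(B)=Prim_\prec(B)=\{b\in \mathrm{Ker}\,\epsilon\mid\delta_\prec(b)=b\otimes1\}$ for unshuffle bialgebras; the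 natural action in the claim is the one so obtained. *)

(* Defs.v *)
From HB Require Import structures.
From mathcomp Require Import all_fingroup all_boot all_order all_algebra.
From mathcomp Require Import boolp.

Set Implicit Arguments.
Unset Strict Implicit.
Unset Printing Implicit Defensive.

Import GRing.Theory.
Local Open Scope ring_scope.
Local Open Scope quotient_scope.

(* A formal linear combination of elements of [X] is a list of pairs
   (coefficient, generator).  [pres R] is the K-vector space generated by [X]
   subject to the relations [R]: tensor products, tensor algebras and free
   vector spaces are all instances. *)

Section Presentation.
Variables (K : fieldType) (X : choiceType).

Definition lscale (a : K) (s : seq (K * X)) := [seq (a * p.1, p.2) | p <- s].

Variable R : seq (K * X) -> seq (K * X) -> Prop.

Inductive lceq : seq (K * X) -> seq (K * X) -> Prop :=
| lceq_refl s : lceq s s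
| lceq_sym s t : lceq s t -> lceq t s
| lceq_trans s t r : lceq s t -> lceq t r -> lceq s r
| lceq_cat s s' t t' : lceq s s' -> lceq t t' -> lceq (s ++ t) (s' ++ t')
| lceq_catC s t : lceq (s ++ t) (t ++ s)
| lceq_merge a b x : lceq [:: (a, x); (b, x)] [:: (a + b, x)]
| lceq_zero x : lceq [:: (0, x)] [::]
| lceq_rel a s t : R s t -> lceq (lscale a s) (lscale a t).

Definition lceqb s t := `[< lceq s t >].

Lemma lceqb_refl : reflexive lceqb.
Proof. by move=> s; apply/asboolP; apply: lceq_refl. Qed.

Lemma lceqb_sym : symmetric lceqb.
Proof. by move=> s t; apply/asboolP/asboolP; apply: lceq_sym. Qed.

Lemma lceqb_trans : transitive lceqb.
Proof.
by move=> s t r /asboolP h /asboolP h'; apply/asboolP; apply: lceq_trans h h'.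
Qed.

Canonical lceqb_equiv := EquivRel lceqb lceqb_refl lceqb_sym lceqb_trans.

Definition pres := {eq_quot lceqb}.
HB.instance Definition _ := EqQuotient.on pres.
HB.instance Definition _ := Choice.on pres.

Definition pclass (s : seq (K * X)) : pres := \pi_pres s.

Lemma pclassP s t : pclass s = pclass t <-> lceq s t.
Proof. by split=> [/eqquotP/asboolP|h] //; apply/eqquotP/asboolP. Qed.

Lemma preprK u : pclass (repr u) = u. Proof. exact: reprK. Qed.

Lemma lceq_repr s : lceq (repr (pclass s)) s.
Proof. by apply/pclassP; rewrite preprK. Qed.

Lemma lscale_cat a s t : lscale a (s ++ t) = lscale a s ++ lscale a t.
Proof. exact: map_cat. Qed.

Lemma lscaleA a b s : lscale a (lscale b s) = lscale (a * b) s.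
Proof. by rewrite /lscale -map_comp; apply: eq_map => p /=; rewrite mulrA. Qed.

Lemma lceq_scale a s t : lceq s t -> lceq (lscale a s) (lscale a t).
Proof.
elim=> {s t} [s|s t _|s t r _ h _|s s' t t' _ h _ h'|s t|b c x|x|b s t h].
- exact: lceq_refl.
- exact: lceq_sym.
- exact: lceq_trans.
- by rewrite !lscale_cat; apply: lceq_cat.
- by rewrite !lscale_cat; apply: lceq_catC.
- by rewrite /= mulrDr; apply: lceq_merge.
- by rewrite /= mulr0; apply: lceq_zero.
- by rewrite !lscaleA; apply: lceq_rel.
Qed.

Lemma lceq_scaleD a b s : lceq (lscale (a + b) s) (lscale a s ++ lscale b s).
Proof.
elim: s => [|[c x] s ih] /=; first exact: lceq_refl.
rewrite -cat1s -[_ :: (_ ++ _)]cat1s.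
apply: (@lceq_trans _ ([:: (a * c, x); (b * c, x)] ++
                       (lscale a s ++ lscale b s))).
  apply: lceq_cat => //; rewrite mulrDl; apply: lceq_sym; exact: lceq_merge.
rewrite -[[:: _; _]]cat1s -catA; apply: lceq_cat; first exact: lceq_refl.
rewrite -[_ :: lscale b s]cat1s !catA; apply: lceq_cat; last exact: lceq_refl.
exact: lceq_catC.
Qed.

Lemma lceq_scale0 s : lceq (lscale 0 s) [::].
Proof.
elim: s => [|[c x] s ih] /=; first exact: lceq_refl.
rewrite -cat1s -[X in lceq _ X]cats0 mul0r.
by apply: lceq_cat => //; exact: lceq_zero.
Qed.

Definition padd (u v : pres) : pres := pclass (repr u ++ repr v).
Definition pscale (a : K) (u : pres) : pres := pclass (lscale a (repr u)).
Definition pzero : pres := pclass [::].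
Definition popp (u : pres) : pres := pscale (-1) u.

Lemma padd_class s t : padd (pclass s) (pclass t) = pclass (s ++ t).
Proof. by apply/pclassP; apply: lceq_cat; apply: lceq_repr. Qed.

Lemma pscale_class a s : pscale a (pclass s) = pclass (lscale a s).
Proof. by apply/pclassP; apply: lceq_scale; apply: lceq_repr. Qed.

Lemma paddA : associative padd.
Proof.
by move=> u v w; rewrite -(preprK u) -(preprK v) -(preprK w) !padd_class catA.
Qed.

Lemma paddC : commutative padd.
Proof. by move=> u v; apply/pclassP; apply: lceq_catC. Qed.

Lemma padd0 : left_id pzero padd.
Proof. by move=> u; rewrite -(preprK u) padd_class. Qed.

Lemma paddN : left_inverse pzero popp padd.
Proof.
move=> u; rewrite -(preprK u) /popp pscale_class padd_class; apply/pclassP.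
have {2}-> : repr u = lscale 1 (repr u).
  by rewrite /lscale -[LHS]map_id; apply: eq_map => -[a x] /=; rewrite mul1r.
apply: lceq_trans (lceq_scale0 (repr u)).
by rewrite -(addNr 1); apply: lceq_sym; apply: lceq_scaleD.
Qed.

HB.instance Definition _ := GRing.isZmodule.Build pres paddA paddC padd0 paddN.

Lemma pscaleA a b v : pscale a (pscale b v) = pscale (a * b) v.
Proof. by rewrite -(preprK v) !pscale_class lscaleA. Qed.

Lemma pscale1 : left_id 1 pscale.
Proof.
move=> v; rewrite -(preprK v) pscale_class; congr pclass.
by rewrite /lscale -[RHS]map_id; apply: eq_map => -[a x] /=; rewrite mul1r.
Qed.

Lemma pscaleDr : right_distributive pscale +%R.
Proof.
move=> a u v; rewrite -(preprK u) -(preprK v).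
by rewrite [_ + _]padd_class !pscale_class lscale_cat [RHS]padd_class.
Qed.

Lemma pscaleDl v : {morph pscale^~ v : a b / a + b}.
Proof.
move=> a b; rewrite -(preprK v) !pscale_class [RHS]padd_class.
by apply/pclassP; apply: lceq_scaleD.
Qed.

HB.instance Definition _ :=
  GRing.Zmodule_isLmodule.Build K pres pscaleA pscale1 pscaleDr pscaleDl.

Definition pgen (x : X) : pres := pclass [:: (1, x)].

Section Lift.
Variables (W : lmodType K) (f : X -> W).

Definition lceval (s : seq (K * X)) : W := \sum_(p <- s) p.1 *: f p.2.

(* The linear map [pres -> W] extending [f]; it is only meaningful when [f] is
   compatible with the relations, see [plift_class]. *)
Definition plift (u : pres) : W := lceval (repr u).

Definition pcompat := forall s t, R s t -> lceval s = lceval t.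

Lemma lceval_cat s t : lceval (s ++ t) = lceval s + lceval t.
Proof. exact: big_cat. Qed.

Lemma lceval_scale a s : lceval (lscale a s) = a *: lceval s.
Proof.
rewrite /lceval big_map scaler_sumr; apply: eq_bigr => p _ /=.
by rewrite scalerA.
Qed.

Hypothesis fR : pcompat.

Lemma lceval_eq s t : lceq s t -> lceval s = lceval t.
Proof.
elim=> {s t} [s|s t _|s t r _ -> _|s s' t t' _ h _ h'|s t|b c x|x|b s t h] //.
- by rewrite !lceval_cat h h'.
- by rewrite !lceval_cat addrC.
- by rewrite /lceval !big_cons !big_nil /= !addr0 scalerDl.
- by rewrite /lceval !big_cons !big_nil /= !addr0 scale0r.
- by rewrite !lceval_scale (fR h).
Qed.

Lemma plift_class s : plift (pclass s) = lceval s.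
Proof. exact/lceval_eq/lceq_repr. Qed.

Lemma plift_gen x : plift (pgen x) = f x.
Proof. by rewrite plift_class /lceval big_seq1 scale1r. Qed.

Lemma plift_linear : linear plift.
Proof.
move=> a u v; rewrite -(preprK u) -(preprK v).
rewrite [_ *: _]pscale_class [_ + _]padd_class !plift_class.
by rewrite lceval_cat lceval_scale.
Qed.

End Lift.

Lemma pclass_sum s : pclass s = \sum_(p <- s) p.1 *: pgen p.2.
Proof.
elim: s => [|[a x] s ih]; first by rewrite big_nil.
rewrite big_cons -ih /= [_ *: _]pscale_class [RHS]padd_class /=.
by rewrite mulr1.
Qed.

Lemma pres_ind (P : pres -> Prop) :
  P 0 -> (forall a x u, P u -> P (a *: pgen x + u)) -> forall u, P u.
Proof.
move=> P0 PD u; rewrite -(preprK u) pclass_sum; elim: (repr u) => [|p s ih].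
  by rewrite big_nil.
by rewrite big_cons; apply: PD.
Qed.

Lemma pres_ext (W : lmodType K) (f g : pres -> W) :
  linear f -> linear g -> (forall x, f (pgen x) = g (pgen x)) -> f =1 g.
Proof.
move=> lf lg fg; apply: pres_ind => [|a x u h]; last by rewrite lf lg fg h.
have := lf (-1) 0 0; have := lg (-1) 0 0.
by rewrite scaler0 addr0 !scaleN1r !addNr => -> ->.
Qed.

End Presentation.

Arguments pclass {K X R} s.
Arguments pgen {K X R} x.
Arguments pzero {K X R}.

Section Linear.
Variables (K : fieldType) (U V W : lmodType K) (f : U -> V).
Hypothesis fL : linear f.

Lemma lin0 : f 0 = 0.
Proof. by have := fL (-1) 0 0; rewrite scaler0 addr0 scaleN1r addNr. Qed.

Lemma linD x y : f (x + y) = f x + f y.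
Proof. by have := fL 1 x y; rewrite !scale1r. Qed.

Lemma linZ a x : f (a *: x) = a *: f x.
Proof. by have := fL a x 0; rewrite !addr0 lin0 addr0. Qed.

Lemma lin_sum I (r : seq I) (P : pred I) F :
  f (\sum_(i <- r | P i) F i) = \sum_(i <- r | P i) f (F i).
Proof. by apply: (big_morph f linD lin0). Qed.

Lemma lin_comp (g : V -> W) : linear g -> linear (g \o f).
Proof. by move=> gL a x y /=; rewrite fL gL. Qed.

End Linear.

Lemma lin_id (K : fieldType) (U : lmodType K) : linear (@id U).
Proof. by []. Qed.

Lemma lin_big (K : fieldType) (U V : lmodType K) I (r : seq I) (P : pred I)
    (F : I -> U -> V) :
  (forall i, linear (F i)) -> linear (fun x => \sum_(i <- r | P i) F i x).
Proof.
move=> FL a x y; rewrite scaler_sumr -big_split.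
by apply: eq_bigr => i _; rewrite FL.
Qed.

Definition bilin (K : fieldType) (U V W : lmodType K) (b : U -> V -> W) :=
  (forall v, linear (b^~ v)) /\ (forall u, linear (b u)).

Section Tensor.
Variables (K : fieldType) (U V : lmodType K).

Inductive tens_rel : seq (K * (U * V)) -> seq (K * (U * V)) -> Prop :=
| tens_rell a u u' v :
    tens_rel [:: (1, (a *: u + u', v))] [:: (a, (u, v)); (1, (u', v))]
| tens_relr a u v v' :
    tens_rel [:: (1, (u, a *: v + v'))] [:: (a, (u, v)); (1, (u, v'))].

Definition tens : lmodType K := pres tens_rel.

Definition tpure (u : U) (v : V) : tens := pgen (u, v).

(* Sweedler summation: [tsum t (fun u v => b u v)] is the sum of the
   [b t_1 t_2] for [t = t_1 ⊗ t_2]. *)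
Definition tsum {W : lmodType K} (t : tens) (b : U -> V -> W) : W :=
  plift (fun p => b p.1 p.2) t.

Lemma tens_compat (W : lmodType K) (b : U -> V -> W) :
  bilin b -> pcompat tens_rel (fun p => b p.1 p.2).
Proof.
move=> [bl br] s t [a u u' v|a u v v'];
  by rewrite /lceval !big_cons !big_nil /= !addr0 !scale1r ?bl ?br.
Qed.

Lemma tsum_pure (W : lmodType K) (b : U -> V -> W) u v :
  bilin b -> tsum (tpure u v) b = b u v.
Proof. by move=> /tens_compat bc; rewrite /tsum plift_gen. Qed.

Lemma tsum_linear (W : lmodType K) (b : U -> V -> W) :
  bilin b -> linear (fun t => tsum t b).
Proof. by move=> /tens_compat bc; apply: plift_linear. Qed.

Lemma tpure_bilin : bilin tpure.
Proof.
split=> [v a u u'|u a v v'].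
  have /pclassP := lceq_rel 1 (tens_rell a u u' v).
  by rewrite /= !mulr1 mul1r !pclass_sum !big_cons !big_nil /= !addr0 !scale1r.
have /pclassP := lceq_rel 1 (tens_relr a u v v').
by rewrite /= !mulr1 mul1r !pclass_sum !big_cons !big_nil /= !addr0 !scale1r.
Qed.

Lemma tens_ind (P : tens -> Prop) :
  P 0 -> (forall u v t, P t -> P (tpure u v + t)) -> forall t, P t.
Proof.
move=> P0 PD; apply: pres_ind => // a [u v] t /PD h.
by have := h (a *: u) v; rewrite (linZ (tpure_bilin.1 v)).
Qed.

Lemma tens_ext (W : lmodType K) (f g : tens -> W) : linear f -> linear g ->
  (forall u v, f (tpure u v) = g (tpure u v)) -> f =1 g.
Proof. by move=> fL gL fg; apply: pres_ext => // -[u v]; apply: fg. Qed.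

End Tensor.

Notation "u ⊗ v" := (tpure u v) (at level 40, left associativity).

Section TensorMaps.
Variable K : fieldType.
Implicit Types U V W : lmodType K.

Definition tmap U V U' V' (f : U -> U') (g : V -> V') (t : tens U V) :
  tens U' V' := tsum t (fun u v => f u ⊗ g v).

Definition tswap U V (t : tens U V) : tens V U := tsum t (fun u v => v ⊗ u).

Definition tassoc U V W (t : tens (tens U V) W) : tens U (tens V W) :=
  tsum t (fun s w => tsum s (fun u v => u ⊗ (v ⊗ w))).

(* The product (a ⊗ b)(c ⊗ d) = ac ⊗ bd on U ⊗ V. *)
Definition tmul U V (m : U -> U -> U) (m' : V -> V -> V) (s t : tens U V) :
  tens U V := tsum s (fun a b => tsum t (fun c d => m a c ⊗ m' b d)).

Lemma tmap_bilin U V U' V' (f : U -> U') (g : V -> V') :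
  linear f -> linear g -> bilin (fun u v => f u ⊗ g v).
Proof.
by move=> fL gL; split=> [v a u u'|u a v v'];
  rewrite ?fL ?gL ?(tpure_bilin _ _).1 ?(tpure_bilin _ _).2.
Qed.

Lemma tmap_pure U V U' V' (f : U -> U') (g : V -> V') u v :
  linear f -> linear g -> tmap f g (u ⊗ v) = f u ⊗ g v.
Proof. by move=> fL gL; rewrite /tmap tsum_pure //; apply: tmap_bilin. Qed.

Lemma tmap_linear U V U' V' (f : U -> U') (g : V -> V') :
  linear f -> linear g -> linear (tmap f g).
Proof. by move=> fL gL; apply: tsum_linear; apply: tmap_bilin. Qed.

Lemma tmap_id U V (t : tens U V) : tmap id id t = t.
Proof.
move: t; apply: tens_ext => [||u v]; last by rewrite tmap_pure //; exact: lin_id.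
  by apply: tmap_linear; exact: lin_id.
exact: lin_id.
Qed.

Lemma tmap_comp U V U' V' U'' V'' (f : U -> U') (g : V -> V') (f' : U' -> U'')
    (g' : V' -> V'') (t : tens U V) :
  linear f -> linear g -> linear f' -> linear g' ->
  tmap (f' \o f) (g' \o g) t = tmap f' g' (tmap f g t).
Proof.
move=> fL gL fL' gL'; have fcL := lin_comp fL fL'; have gcL := lin_comp gL gL'.
move: t; apply: tens_ext => [||u v]; last by rewrite !tmap_pure.
  exact: tmap_linear.
exact: (lin_comp (tmap_linear fL gL) (tmap_linear fL' gL')). 
Qed.

End TensorMaps.

(* A direct sum decomposition V = ⊕_n V_n, given by its projections
   [gpr n : V -> V]; the component V_n is the image of [gpr n]. *)
Record graded (K : fieldType) := Graded {
  gcar :> lmodType K;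
  gpr : nat -> gcar -> gcar;
  gpr_linear : forall n, linear (gpr n);
  gprK : forall m n x, gpr m (gpr n x) = if m == n then gpr n x else 0;
  gpr_sum : forall x, exists N, x = \sum_(n < N) gpr n x }.

Arguments gpr {K g} n x.

Definition homog (K : fieldType) (V : graded K) (n : nat) (x : V) :=
  gpr n x = x.

(* V_0 = 0 *)
Record vect (K : fieldType) := Vect {
  vgr :> graded K;
  vgr0 : forall x : vgr, gpr 0 x = 0 }.

(* V_0 = K, identified through [a |-> a *: vone] *)
Record vectp (K : fieldType) := Vectp {
  vpgr :> graded K;
  vone : vpgr;
  veps : vpgr -> K;
  veps_scalar : scalar veps;
  veps_one : veps vone = 1;
  gpr0_eps : forall x : vpgr, gpr 0 x = veps x *: vone }.

Arguments vone {K v}.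
Arguments veps {K v} x.

Definition kereps (K : fieldType) (V : vectp K) (x : V) := veps x = 0.

Record ghom (K : fieldType) (V W : graded K) := GHom {
  gfun :> V -> W;
  gfun_linear : linear gfun;
  gfun_gpr : forall n x, gfun (gpr n x) = gpr n (gfun x) }.

Record vphom (K : fieldType) (V W : vectp K) := VPHom {
  vpfun :> ghom V W;
  vpfun1 : vpfun vone = vone }.

Lemma ghom_eq (K : fieldType) (V W : graded K) (f g : ghom V W) :
  f =1 g -> f = g.
Proof.
case: f g => [f fl fg] [g gl gg] /= /funext e; rewrite e in fl fg *.
by congr GHom; apply: Prop_irrelevance.
Qed.

Lemma vphom_eq (K : fieldType) (V W : vectp K) (f g : vphom V W) :
  f =1 g -> f = g.
Proof.
case: f g => [f f1] [g g1] /= /ghom_eq e; rewrite e in f1 *.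
by congr VPHom; apply: Prop_irrelevance.
Qed.

Section GHom.
Variable K : fieldType.

Definition gid (V : graded K) : ghom V V :=
  @GHom K V V id (@lin_id K V) (fun _ _ => erefl).

Definition gcomp (U V W : graded K) (g : ghom V W) (f : ghom U V) : ghom U W.
Proof.
apply: (@GHom _ _ _ (g \o f)).
  by move=> a x y /=; rewrite !gfun_linear.
by move=> n x /=; rewrite !gfun_gpr.
Defined.

Definition vpid (V : vectp K) : vphom V V := @VPHom K V V (gid V) erefl.

Definition vpcomp (U V W : vectp K) (g : vphom V W) (f : vphom U V) :
  vphom U W.
Proof. by apply: (@VPHom _ _ _ (gcomp g f)); rewrite /= !vpfun1. Defined.

End GHom.

Record subgr (K : fieldType) (V : graded K) := SubGr {
  sgmem : V -> Prop;
  sg0 : sgmem 0;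
  sgL : forall a x y, sgmem x -> sgmem y -> sgmem (a *: x + y);
  sg_gpr : forall n x, sgmem x -> sgmem (gpr n x) }.

Section SubGraded.
Variables (K : fieldType) (V : graded K) (S : subgr V).

Definition sgpred : {pred V} := fun x => `[< sgmem S x >].

Lemma sgpred_closed : submod_closed sgpred.
Proof.
split=> [|a x y /asboolP Sx /asboolP Sy]; apply/asboolP; first exact: sg0.
exact: sgL.
Qed.

HB.instance Definition _ := GRing.isSubmodClosed.Build K V sgpred sgpred_closed.

Record sgtype := SgType { sgval : V; _ : sgval \in sgpred }.
HB.instance Definition _ := [isSub for sgval].
HB.instance Definition _ := [Choice of sgtype by <:].
HB.instance Definition _ := [SubChoice_isSubLmodule of sgtype by <:].

Lemma sgvalP (x : sgtype) : sgmem S (sgval x).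
Proof. by case: x => x /= /asboolP. Qed.

Definition sgmk (x : V) (Sx : sgmem S x) : sgtype := SgType (asboolT Sx).

Lemma sgval_inj : injective sgval. Proof. exact: val_inj. Qed.

Lemma sgval_linear : linear sgval.
Proof. by []. Qed.

Definition sggpr n (x : sgtype) : sgtype := sgmk (sg_gpr n (sgvalP x)).

Lemma sggpr_linear n : linear (sggpr n).
Proof.
move=> a x y; apply: sgval_inj.
exact: gpr_linear.
Qed.

Lemma sggprK m n x : sggpr m (sggpr n x) = if m == n then sggpr n x else 0.
Proof.
apply: sgval_inj; rewrite /= gprK; by case: ifP.
Qed.

Lemma sggpr_sum x : exists N, x = \sum_(n < N) sggpr n x.
Proof.
have [N xN] := gpr_sum (sgval x); exists N; apply: sgval_inj.
by rewrite (lin_sum sgval_linear).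
Qed.

Definition sggraded : graded K := Graded sggpr_linear sggprK sggpr_sum.

Definition sgvect (S0 : forall x, sgmem S x -> gpr 0 x = 0) : vect K.
Proof.
apply: (@Vect _ sggraded) => x; apply: sgval_inj.
by rewrite /= S0 ?(lin0 sgval_linear) //; apply: sgvalP.
Defined.

End SubGraded.

Definition sghom (K : fieldType) (V W : graded K) (S : subgr V) (T : subgr W)
  (f : ghom V W) (fST : forall x, sgmem S x -> sgmem T (f x)) :
  ghom (sggraded S) (sggraded T).
Proof.
apply: (@GHom K (sggraded S) (sggraded T)
  (fun x => sgmk (fST _ (sgvalP x)))).
  move=> a x y; apply: sgval_inj.
  exact: gfun_linear.
by move=> n x; apply: sgval_inj; rewrite /= gfun_gpr.
Defined.

(* The projection of V ⊗ W onto ⊕_{p + q = n} V_p ⊗ W_q *)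
Definition tgr (K : fieldType) (V W : graded K) (n : nat) (t : tens V W) :
    tens V W :=
  tsum t (fun v w => \sum_(p < n.+1) gpr p v ⊗ gpr (n - p) w).

Lemma tgr_pure (K : fieldType) (V W : graded K) n (v : V) (w : W) :
  tgr n (v ⊗ w) = \sum_(p < n.+1) gpr p v ⊗ gpr (n - p) w.
Proof.
rewrite /tgr tsum_pure //; split=> [y|x]; apply: lin_big => p a u u'.
  by rewrite gpr_linear (tpure_bilin _ _).1.
by rewrite gpr_linear (tpure_bilin _ _).2.
Qed.

Lemma tgr_linear (K : fieldType) (V W : graded K) n :
  linear (@tgr K V W n).
Proof.
apply: tsum_linear; split=> [y|x]; apply: lin_big => p a u u'.
  by rewrite gpr_linear (tpure_bilin _ _).1.
by rewrite gpr_linear (tpure_bilin _ _).2.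
Qed.

Section TensorAlgebra.
Variables (K : fieldType).

Section Words.
Variable V : lmodType K.

Inductive word_rel : seq (K * seq V) -> seq (K * seq V) -> Prop :=
| word_relI s a u v t :
    word_rel [:: (1, s ++ (a *: u + v) :: t)]
             [:: (a, s ++ u :: t); (1, s ++ v :: t)].

(* Multilinear combinations of words: T(V) = ⊕_l V^{⊗l} *)
Definition tensalg : lmodType K := pres word_rel.

(* The tensor v_1 ⊗ ... ⊗ v_l *)
Definition word (w : seq V) : tensalg := pgen w.

Definition multilin (W : lmodType K) (f : seq V -> W) :=
  forall s a u v t,
    f (s ++ (a *: u + v) :: t) = a *: f (s ++ u :: t) + f (s ++ v :: t).

Lemma word_compat (W : lmodType K) (f : seq V -> W) :
  multilin f -> pcompat word_rel f.
Proof.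
move=> fM _ _ [s a u v t].
by rewrite /lceval !big_cons !big_nil /= !addr0 !scale1r fM.
Qed.

Lemma word_multilin : multilin word.
Proof.
move=> s a u v t; have /pclassP := lceq_rel 1 (word_relI s a u v t).
by rewrite /= !mulr1 mul1r !pclass_sum !big_cons !big_nil /= !addr0 !scale1r.
Qed.

Definition tcons (v : V) (t : tensalg) : tensalg :=
  plift (fun w => word (v :: w)) t.

Lemma tcons_compat v : pcompat word_rel (fun w => word (v :: w)).
Proof. by apply: word_compat => s a x y t; rewrite -cat_cons word_multilin. Qed.

Lemma tcons_word v w : tcons v (word w) = word (v :: w).
Proof. by rewrite /tcons plift_gen //; apply: tcons_compat. Qed.

Lemma tconsr v : linear (tcons v).
Proof. by apply: plift_linear; apply: tcons_compat. Qed.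

Lemma tensalg_ext (W : lmodType K) (f g : tensalg -> W) :
  linear f -> linear g -> (forall w, f (word w) = g (word w)) -> f =1 g.
Proof. exact: pres_ext. Qed.

Lemma tconsl t : linear (tcons^~ t).
Proof.
move=> a u v; move: t; apply: tensalg_ext; first exact: tconsr.
  move=> b s t; rewrite !tconsr !scalerDr !scalerA [a * b]mulrC -!addrA.
  by congr (_ + _); rewrite addrCA.
by move=> w; rewrite !tcons_word; apply: (word_multilin [::]).
Qed.

End Words.

Section Grading.
Variable V : graded K.

(* The component of degree n of a word, for the grading in which the degree of
   v_1 ... v_l is |v_1| + ... + |v_l|. *)
Fixpoint wgr (w : seq V) (n : nat) : tensalg V :=
  if w is v :: w' then \sum_(p < n.+1) tcons (gpr p v) (wgr w' (n - p))
  else if n == 0%N then word [::] else 0.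

Definition tagr (n : nat) (t : tensalg V) : tensalg V :=
  plift (wgr^~ n) t.

Lemma wgr_multilin n : multilin (wgr^~ n).
Proof.
move=> s a u v t; elim: s n => [|x s ih] n /=; rewrite scaler_sumr -big_split /=;
  apply: eq_bigr => p _; first by rewrite gpr_linear tconsl.
by rewrite ih tconsr.
Qed.

Lemma tagr_word n w : tagr n (word w) = wgr w n.
Proof. by rewrite /tagr plift_gen //; apply/word_compat/wgr_multilin. Qed.

Lemma tagr_linear n : linear (tagr n).
Proof. by apply: plift_linear; apply/word_compat/wgr_multilin. Qed.

Inductive hword : nat -> seq V -> Prop :=
| hword_nil : hword 0 [::]
| hword_cons d v n w : homog d v -> hword n w -> hword (d + n) (v :: w).

Lemma tagr_hword m w n : hword m w ->
  tagr n (word w) = if n == m then word w else 0.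
Proof.
rewrite tagr_word => h; elim: h n => {m w} [|d v m w vd _ ih] n //=.
case: (leqP d n) => dn; last first.
  rewrite big1 => [|p _].
    by case: eqP => // e; rewrite e ltnNge leq_addr in dn.
  rewrite -vd gprK ltn_eqF ?(lin0 (tconsl _)) //.
  exact: leq_trans (ltn_ord p) dn.
have dn' : (d < n.+1)%N by [].
rewrite (bigD1 (Ordinal dn')) //= big1 => [|p /negPf pd]; last first.
  by rewrite -vd gprK -[(p : nat) == d]/(p == Ordinal dn') pd (lin0 (tconsl _)).
rewrite addr0 vd ih -[in RHS](subnKC dn) eqn_add2l; case: eqP => _.
  by rewrite tcons_word.
exact: lin0 (tconsr _).
Qed.

Inductive hspan : tensalg V -> Prop :=
| hspan0 : hspan 0
| hspanD a d w t : hword d w -> hspan t -> hspan (a *: word w + t).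

Lemma hspan_add s t : hspan s -> hspan t -> hspan (s + t).
Proof.
move=> hs ht; elim: hs => [|a d w u hw _ ih]; first by rewrite add0r.
by rewrite -addrA; apply: hspanD hw ih.
Qed.

Lemma hspan_scale b t : hspan t -> hspan (b *: t).
Proof.
elim=> [|a d w u hw _ ih]; first by rewrite scaler0; exact: hspan0.
by rewrite scalerDr scalerA; apply: hspanD hw ih.
Qed.

Lemma hspan_cons v t : hspan t -> hspan (tcons v t).
Proof.
have [N ->] := gpr_sum v => ht.
rewrite (lin_sum (tconsl t)).
elim/big_ind: _ => [|x y|p _]; [exact: hspan0|exact: hspan_add|].
elim: ht => [|a d w u hw _ ih]; first by rewrite (lin0 (tconsr _)); exact: hspan0.
rewrite tconsr tcons_word; apply: (@hspanD _ (p + d)) => //.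
by apply: hword_cons => //; rewrite /homog gprK eqxx.
Qed.

Lemma hspan_all t : hspan t.
Proof.
move: t; apply: pres_ind => [|a w u]; first exact: hspan0.
apply: hspan_add; apply: hspan_scale; rewrite -[pgen w]/(word w).
elim: w => [|v w ih]; last by rewrite -tcons_word; apply: hspan_cons.
rewrite -[word _]addr0 -[word _]scale1r.
by apply: hspanD hword_nil _; exact: hspan0.
Qed.

Lemma hspan_ext (W : lmodType K) (f g : tensalg V -> W) :
  linear f -> linear g ->
  (forall d w, hword d w -> f (word w) = g (word w)) -> f =1 g.
Proof.
move=> fL gL fg t; elim: (hspan_all t) => [|a d w u hw _ ih].
  by rewrite (lin0 fL) (lin0 gL).
by rewrite fL gL (fg d w hw) ih.
Qed.

Lemma tagrK m n t : tagr m (tagr n t) = if m == n then tagr n t else 0.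
Proof.
elim: (hspan_all t) => [|a d w u hw _ ih].
  by rewrite !(lin0 (tagr_linear _)) if_same.
rewrite tagr_linear tagr_linear ih (tagr_hword n hw) (fun_if (tagr m)).
rewrite (lin0 (tagr_linear _)) (tagr_hword m hw).
by case: (m =P n) => [->|mn]; do ?case: eqP => //; rewrite ?scaler0 ?addr0 //;
   congruence.
Qed.

Lemma tagr_sum t : exists N, t = \sum_(n < N) tagr n t.
Proof.
suff [N NP] : exists N, forall M, (N <= M)%N -> t = \sum_(n < M) tagr n t.
  by exists N; apply: NP.
elim: (hspan_all t) => [|a d w u hw _ [N ih]].
  by exists 0%N => M _; rewrite big1 // => n _; rewrite (lin0 (tagr_linear _)).
exists (maxn N d.+1) => M; rewrite geq_max => /andP[NM dM].
under eq_bigr do rewrite tagr_linear.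
rewrite big_split -(ih M NM) -scaler_sumr; congr (_ *: _ + _).
rewrite (bigD1 (Ordinal dM)) //= (tagr_hword _ hw) eqxx big1 ?addr0 // => n nd.
rewrite (tagr_hword _ hw); case: eqP => // e.
by move: nd; rewrite -val_eqE /= e eqxx.
Qed.

Definition tensalg_graded : graded K := Graded tagr_linear tagrK tagr_sum.

End Grading.

Section Connected.
Variable V : vect K.

Definition taeps (t : tensalg_graded V) : K :=
  plift (fun w => (w == [::])%:R : K^o) t.

Lemma taeps_multilin : multilin (fun w : seq V => (w == [::])%:R : K^o).
Proof. by move=> [|x s] a u v t /=; rewrite scaler0 addr0. Qed.

Lemma taeps_word w : taeps (word w) = (w == [::])%:R.
Proof. by rewrite /taeps plift_gen //; apply/word_compat/taeps_multilin. Qed.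

Lemma taeps_scalar : scalar taeps.
Proof.
move=> a x y.
by rewrite /taeps (plift_linear (word_compat taeps_multilin)).
Qed.

Lemma tagr0_eps (t : tensalg_graded V) : gpr 0 t = taeps t *: word [::].
Proof.
move: t; apply: tensalg_ext => [|a x y|w]; first exact: tagr_linear.
  by rewrite taeps_scalar scalerDl scalerA.
rewrite [LHS]tagr_word taeps_word; case: w => [|v w] /=; first by rewrite scale1r.
by rewrite big_ord1 scale0r /= vgr0 (lin0 (tconsl _)).
Qed.

Lemma taeps_one : taeps (word [::]) = 1.
Proof. by rewrite taeps_word. Qed.

Definition tensalg_vectp : vectp K :=
  Vectp taeps_scalar taeps_one tagr0_eps.

End Connected.

Section Functoriality.
Variables (V W : vect K) (f : ghom V W).

Definition tamap (t : tensalg V) : tensalg W := plift (fun w => word (map f w)) t.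

Lemma tamap_multilin : multilin (fun w => word (map f w)).
Proof. by move=> s a u v t; rewrite !map_cat /= gfun_linear word_multilin. Qed.

Lemma tamap_word w : tamap (word w) = word (map f w).
Proof. by rewrite /tamap plift_gen //; apply/word_compat/tamap_multilin. Qed.

Lemma tamap_linear : linear tamap.
Proof. by apply: plift_linear; apply/word_compat/tamap_multilin. Qed.

Lemma map_hword d w : hword d w -> hword d (map f w).
Proof.
elim=> {d w} [|d v n w vd _ ih] /=; first exact: hword_nil.
by apply: hword_cons ih; rewrite /homog -gfun_gpr vd.
Qed.

Lemma tamap_gpr n t : tamap (tagr n t) = tagr n (tamap t).
Proof.
elim: (hspan_all t) => [|a d w u hw _ ih].
  by rewrite !(lin0 tamap_linear, lin0 (tagr_linear _)).
rewrite !(tagr_linear, tamap_linear) ih (tagr_hword _ hw) tamap_word.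
rewrite (tagr_hword _ (map_hword hw)); case: eqP => _; first by rewrite tamap_word.
by rewrite (lin0 tamap_linear).
Qed.

Definition tamap_hom : vphom (tensalg_vectp V) (tensalg_vectp W) :=
  @VPHom _ (tensalg_vectp V) (tensalg_vectp W)
    (@GHom _ (tensalg_vectp V) (tensalg_vectp W) tamap tamap_linear tamap_gpr)
    (tamap_word [::]).

End Functoriality.

End TensorAlgebra.

Record category := Category {
  obj :> Type;
  hom : obj -> obj -> Type;
  idc : forall x, hom x x;
  cpc : forall x y z, hom y z -> hom x y -> hom x z;
  cp1m : forall x y (f : hom x y), cpc (idc y) f = f;
  cpm1 : forall x y (f : hom x y), cpc f (idc x) = f;
  cpA : forall x y z t (h : hom z t) (g : hom y z) (f : hom x y),
    cpc h (cpc g f) = cpc (cpc h g) f }.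

Arguments idc {c} x.
Arguments cpc {c x y z} g f.

Record functor (C D : category) := Functor {
  fobj :> C -> D;
  fmap : forall x y, hom x y -> hom (fobj x) (fobj y);
  fmap1 : forall x, fmap (idc x) = idc (fobj x);
  fmapM : forall x y z (g : hom y z) (f : hom x y),
    fmap (cpc g f) = cpc (fmap g) (fmap f) }.

Arguments fmap {C D} F {x y} f : rename.

Definition fid (C : category) : functor C C :=
  @Functor C C id (fun _ _ f => f) (fun _ => erefl) (fun _ _ _ _ _ => erefl).

Definition fcomp (C D E : category) (G : functor D E) (F : functor C D) :
  functor C E.
Proof.
apply: (@Functor C E (fun x => G (F x)) (fun x y f => fmap G (fmap F f))).
  by move=> x; rewrite !fmap1.
by move=> x y z g f; rewrite !fmapM.
Defined.

Record natiso (C D : category) (F G : functor C D) := NatIso {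
  nfwd : forall x, hom (F x) (G x);
  nbwd : forall x, hom (G x) (F x);
  nnat : forall x y (f : hom x y),
    cpc (nfwd y) (fmap F f) = cpc (fmap G f) (nfwd x);
  nfwdK : forall x, cpc (nbwd x) (nfwd x) = idc (F x);
  nbwdK : forall x, cpc (nfwd x) (nbwd x) = idc (G x) }.

Arguments nfwd {C D F G} i x : rename.
Arguments nbwd {C D F G} i x : rename.

Definition isomorphic (C D : category) (F G : functor C D) :=
  inhabited (natiso F G).

Definition quasi_inverse (C D : category) (F : functor C D) (G : functor D C) :=
  isomorphic (fcomp G F) (fid C) /\ isomorphic (fcomp F G) (fid D).

Section BaseCategories.
Variable K : fieldType.

Definition VectCat : category.
Proof.
apply: (@Category (vect K) (fun V W => ghom V W) (fun V => gid V)
          (fun U V W g f => gcomp g f)).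
- by move=> V W f; apply: ghom_eq.
- by move=> V W f; apply: ghom_eq.
- by move=> U V W X h g f; apply: ghom_eq.
Defined.

Definition VectpCat : category.
Proof.
apply: (@Category (vectp K) (fun V W => vphom V W) (fun V => vpid V)
          (fun U V W g f => vpcomp g f)).
- by move=> V W f; apply: vphom_eq.
- by move=> V W f; apply: vphom_eq.
- by move=> U V W X h g f; apply: vphom_eq.
Defined.

Definition TensAlg : functor VectCat VectpCat.
Proof.
apply: (@Functor VectCat VectpCat (@tensalg_vectp K) (fun V W f => tamap_hom f)).
  move=> V; apply: vphom_eq => t /=; move: t.
  apply: tensalg_ext => [||w]; first exact: tamap_linear; first exact: lin_id.
  by rewrite tamap_word map_id.
move=> U V W g f; apply: vphom_eq => t /=; move: t.
apply: tensalg_ext => [||w]; first exact: tamap_linear.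
  by move=> a x y /=; rewrite !tamap_linear.
by rewrite /= !tamap_word map_comp.
Defined.

End BaseCategories.

(* A category of structures on objects of Vect^+: the structures [cstr V] on
   each V and the maps of Vect^+ that are morphisms for these structures. *)
Record structure (K : fieldType) := Structure {
  cstr : vectp K -> Type;
  cmor : forall V W, cstr V -> cstr W -> vphom V W -> Prop;
  cmor_id : forall V (s : cstr V), cmor s s (vpid V);
  cmor_comp : forall U V W (r : cstr U) (s : cstr V) (t : cstr W)
    (g : vphom V W) (f : vphom U V),
    cmor s t g -> cmor r s f -> cmor r t (vpcomp g f) }.

Arguments cstr {K} S V : rename.
Arguments cmor {K} S {V W} s t f : rename.

Section ConcreteCategory.
Variables (K : fieldType) (S : structure K).

Record sobj := SObj { scar :> vectp K; sstr : cstr S scar }.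

Record shom (X Y : sobj) := SHom {
  smap :> vphom X Y;
  smapP : cmor S (sstr X) (sstr Y) smap }.

Lemma shom_eq (X Y : sobj) (f g : shom X Y) : smap f = smap g -> f = g.
Proof.
case: f g => [f fP] [g gP] /= e; rewrite e in fP *.
by congr SHom; apply: Prop_irrelevance.
Qed.

Definition scat : category.
Proof.
apply: (@Category sobj shom (fun X => SHom (cmor_id (sstr X)))
  (fun X Y Z g f => SHom (cmor_comp (smapP g) (smapP f)))).
- by move=> X Y f; apply: shom_eq; apply: vphom_eq.
- by move=> X Y f; apply: shom_eq; apply: vphom_eq.
- by move=> X Y Z T h g f; apply: shom_eq; apply: vphom_eq.
Defined.

Definition forget : functor scat (VectpCat K) :=
  @Functor scat (VectpCat K) scar smap (fun _ => erefl) (fun _ _ _ _ _ => erefl).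

End ConcreteCategory.

Section Bialgebras.
Variable K : fieldType.
Implicit Types B C : vectp K.

(* Products and coproducts in Vect^+: the unit and the counit are the inclusion
   and the projection of V_0 = K. *)

Record is_product B (m : B -> B -> B) : Prop := IsProduct {
  prod_bilin : bilin m;
  prod_homog : forall p q x y, homog p x -> homog q y -> homog (p + q) (m x y);
  prodA : forall x y z, m x (m y z) = m (m x y) z;
  prod1x : forall x, m vone x = x;
  prodx1 : forall x, m x vone = x }.

Record is_coproduct B (D : B -> tens B B) : Prop := IsCoproduct {
  cop_linear : linear D;
  cop_gpr : forall n x, D (gpr n x) = tgr n (D x);
  copA : forall x, tassoc (tmap D id (D x)) = tmap id D (D x);
  cop_epsl : forall x, tsum (D x) (fun a b => veps a *: b) = x;
  cop_epsr : forall x, tsum (D x) (fun a b => veps b *: a) = x }.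

(* Being graded and connected, such a bialgebra is a Hopf algebra; the counit is
   multiplicative because the product has degree 0. *)
Record is_bialgebra B (m : B -> B -> B) (D : B -> tens B B) : Prop :=
  IsBialgebra {
  bialg_product : is_product m;
  bialg_coproduct : is_coproduct D;
  bialg_one : D vone = vone ⊗ vone;
  bialg_mul : forall x y, D (m x y) = tmul m m (D x) (D y) }.

(* x' ⊗ x'' *)
Definition redcop B (D : B -> tens B B) (x : B) : tens B B :=
  D x - x ⊗ vone - vone ⊗ x.

(* The half-shuffles are bilinear maps on Ker ε, extended by x ≺ 1 = x and
   1 ≺ x = 0 for x in Ker ε; the totalization [prec 1 1 = 0] is a convention that
   involves no choice and on which nothing else depends.  The symmetric extension
   of ≻ is given by [succ y x = prec x y]. *)
Record shuffle_bialgebra B := ShuffleBialgebra {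
  sh_mul : B -> B -> B;
  sh_cop : B -> tens B B;
  sh_prec : B -> B -> B;
  sh_succ : B -> B -> B;
  sh_bialg : is_bialgebra sh_mul sh_cop;
  sh_mulC : forall x y, sh_mul x y = sh_mul y x;
  sh_prec_bilin : bilin sh_prec;
  sh_prec_homog : forall p q x y,
    homog p x -> homog q y -> homog (p + q) (sh_prec x y);
  sh_mulE : forall x y, kereps x -> kereps y ->
    sh_mul x y = sh_prec x y + sh_succ x y;
  sh_precC : forall x y, sh_prec x y = sh_succ y x;
  sh_precA : forall x y z, kereps x -> kereps y -> kereps z ->
    sh_prec (sh_prec x y) z = sh_prec x (sh_prec y z + sh_succ y z);
  sh_precx1 : forall x, kereps x -> sh_prec x vone = x;
  sh_prec1x : forall x, kereps x -> sh_prec vone x = 0;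
  sh_prec11 : sh_prec vone vone = 0;
  sh_cop_prec : forall x y, kereps x -> kereps y ->
    sh_cop (sh_prec x y) =
      sh_prec x y ⊗ vone + vone ⊗ sh_prec x y + x ⊗ y
      + tsum (redcop sh_cop y) (fun y' y'' => sh_prec x y' ⊗ y'')
      + tsum (redcop sh_cop x) (fun x' x'' => sh_prec x' y ⊗ x'')
      + tsum (redcop sh_cop x) (fun x' x'' => x' ⊗ sh_mul x'' y)
      + tsum (redcop sh_cop x) (fun x' x'' =>
          tsum (redcop sh_cop y) (fun y' y'' =>
            sh_prec x' y' ⊗ sh_mul x'' y'')) }.

(* The half-coproducts are defined on Ker ε.  They are extended to B by 0 at 1;
   as the left leg of δ_≺ lies in Ker ε, the composite (δ_≺ ⊗ Id) ∘ δ_≺ does not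
   depend on this extension. *)
Record unshuffle_bialgebra B := UnshuffleBialgebra {
  un_mul : B -> B -> B;
  un_cop : B -> tens B B;
  un_prec : B -> tens B B;
  un_succ : B -> tens B B;
  un_bialg : is_bialgebra un_mul un_cop;
  un_copC : forall x, tswap (un_cop x) = un_cop x;
  un_prec_linear : linear un_prec;
  un_succ_linear : linear un_succ;
  un_prec_gpr : forall n x, un_prec (gpr n x) = tgr n (un_prec x);
  un_prec1 : un_prec vone = 0;
  un_succ1 : un_succ vone = 0;
  un_copE : forall x, kereps x -> un_cop x = un_prec x + un_succ x;
  un_precC : forall x, kereps x -> un_prec x = tswap (un_succ x);
  un_precA : forall x, kereps x ->
    tassoc (tmap un_prec id (un_prec x)) = tmap id un_cop (un_prec x);
  un_prec_epsl : forall x, kereps x ->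
    tsum (un_prec x) (fun a b => veps a *: b) = 0;
  un_prec_epsr : forall x, kereps x ->
    tsum (un_prec x) (fun a b => veps b *: a) = x;
  un_prec_mul : forall x y, kereps x -> kereps y ->
    un_prec (un_mul x y) = tmul un_mul un_mul (un_prec x) (un_cop y) }.

Record infinitesimal_bialgebra B := InfinitesimalBialgebra {
  inf_mul : B -> B -> B;
  inf_cop : B -> tens B B;
  inf_product : is_product inf_mul;
  inf_coproduct : is_coproduct inf_cop;
  inf_cop_mul : forall x y,
    inf_cop (inf_mul x y) =
      tsum (inf_cop y) (fun y1 y2 => inf_mul x y1 ⊗ y2)
      + tsum (inf_cop x) (fun x1 x2 => x1 ⊗ inf_mul x2 y)
      - x ⊗ y }.

Definition alg_mor B C (m : B -> B -> B) (m' : C -> C -> C) (f : vphom B C) :=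
  forall x y, f (m x y) = m' (f x) (f y).

Definition coalg_mor B C (D : B -> tens B B) (D' : C -> tens C C)
  (f : vphom B C) := forall x, D' (f x) = tmap f f (D x).

Record shuffle_mor B C (s : shuffle_bialgebra B) (t : shuffle_bialgebra C)
    (f : vphom B C) : Prop := ShuffleMor {
  shm_mul : alg_mor (sh_mul s) (sh_mul t) f;
  shm_cop : coalg_mor (sh_cop s) (sh_cop t) f;
  shm_prec : forall x y, kereps x -> kereps y ->
    f (sh_prec s x y) = sh_prec t (f x) (f y);
  shm_succ : forall x y, kereps x -> kereps y ->
    f (sh_succ s x y) = sh_succ t (f x) (f y) }.

Record unshuffle_mor B C (s : unshuffle_bialgebra B) (t : unshuffle_bialgebra C)
    (f : vphom B C) : Prop := UnshuffleMor {
  unm_mul : alg_mor (un_mul s) (un_mul t) f;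
  unm_cop : coalg_mor (un_cop s) (un_cop t) f;
  unm_prec : forall x, kereps x -> un_prec t (f x) = tmap f f (un_prec s x);
  unm_succ : forall x, kereps x -> un_succ t (f x) = tmap f f (un_succ s x) }.

Record infinitesimal_mor B C (s : infinitesimal_bialgebra B)
    (t : infinitesimal_bialgebra C) (f : vphom B C) : Prop :=
  InfinitesimalMor {
  infm_mul : alg_mor (inf_mul s) (inf_mul t) f;
  infm_cop : coalg_mor (inf_cop s) (inf_cop t) f }.

Lemma vphom_eps B C (f : vphom B C) x : veps (f x) = veps x.
Proof.
have := gfun_gpr f 0 x; rewrite !gpr0_eps (linZ (gfun_linear f)) vpfun1.
move/(congr1 veps); have eL := @veps_scalar K C.
have e0 : veps (0 : C) = 0.
  by have := eL (-1) 0 0; rewrite scaler0 addr0 mulN1r addNr.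
have eZ a (y : C) : veps (a *: y) = a * veps y.
  by rewrite -[a *: y]addr0 eL e0 addr0.
by rewrite !eZ !veps_one !mulr1.
Qed.

Lemma tmap_vpcomp A B C (g : vphom B C) (f : vphom A B) (t : tens A A) :
  tmap (vpcomp g f) (vpcomp g f) t = tmap g g (tmap f f t).
Proof. by apply: tmap_comp; apply: gfun_linear. Qed.

Definition shuffle_structure : structure K.
Proof.
apply: (@Structure K shuffle_bialgebra shuffle_mor).
  by move=> B s; split=> // x; rewrite tmap_id.
move=> A B C r s t g f [gm gD gp gs] [fm fD fp fs].
have fk x : kereps x -> kereps (f x) by rewrite /kereps vphom_eps.
split=> [x y|x|x y kx ky|x y kx ky].
- by rewrite /= fm gm.
- by rewrite tmap_vpcomp -fD gD.
- by rewrite /= fp // gp //; apply: fk.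
- by rewrite /= fs // gs //; apply: fk.
Defined.

Definition unshuffle_structure : structure K.
Proof.
apply: (@Structure K unshuffle_bialgebra unshuffle_mor).
  by move=> B s; split=> // x; rewrite tmap_id.
move=> A B C r s t g f [gm gD gp gs] [fm fD fp fs].
have fk x : kereps x -> kereps (f x) by rewrite /kereps vphom_eps.
split=> [x y|x|x kx|x kx].
- by rewrite /= fm gm.
- by rewrite tmap_vpcomp -fD gD.
- by rewrite tmap_vpcomp -fp // gp //; apply: fk.
- by rewrite tmap_vpcomp -fs // gs //; apply: fk.
Defined.

Definition infinitesimal_structure : structure K.
Proof.
apply: (@Structure K infinitesimal_bialgebra infinitesimal_mor).
  by move=> B s; split=> // x; rewrite tmap_id.
move=> A B C r s t g f [gm gD] [fm fD]; split=> [x y|x].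
- by rewrite /= fm gm.
- by rewrite tmap_vpcomp -fD gD.
Defined.

Definition primitive B (D : B -> tens B B) (x : B) :=
  D x = x ⊗ vone + vone ⊗ x.

Definition prec_primitive B (s : unshuffle_bialgebra B) (b : B) :=
  kereps b /\ un_prec s b = b ⊗ vone.

Lemma gpr_vone B n : gpr n (vone : B) = if n == 0%N then vone else 0.
Proof.
have e : gpr 0 (vone : B) = vone by rewrite gpr0_eps veps_one scale1r.
by rewrite -{1}e gprK; case: ifP => // /eqP ->.
Qed.

Lemma tgr_vone_r B n (x : B) : tgr n (x ⊗ (vone : B)) = gpr n x ⊗ vone.
Proof.
rewrite tgr_pure big_ord_recr /= subnn gpr_vone big1 ?add0r // => p _.
by rewrite gpr_vone subn_eq0 leqNgt ltn_ord (lin0 ((tpure_bilin _ _).2 _)).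
Qed.

Lemma tgr_vone_l B n (x : B) : tgr n ((vone : B) ⊗ x) = vone ⊗ gpr n x.
Proof.
rewrite tgr_pure big_ord_recl /= subn0 gpr_vone big1 ?addr0 // => p _.
by rewrite gpr_vone (lin0 ((tpure_bilin _ _).1 _)).
Qed.

Lemma veps0 B : veps (0 : B) = 0.
Proof.
by have := @veps_scalar K B (-1) 0 0; rewrite scaler0 addr0 mulN1r addNr.
Qed.

Lemma vepsD B (x y : B) : veps (x + y) = veps x + veps y.
Proof. by have := @veps_scalar K B 1 x y; rewrite scale1r mul1r. Qed.

Lemma vepsZ B a (x : B) : veps (a *: x) = a * veps x.
Proof. by have := @veps_scalar K B a x 0; rewrite !addr0 veps0 addr0. Qed.

Lemma eps_bilin B : bilin (fun a b : B => veps a *: b).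
Proof.
split=> [b a x y|x a b b']; first by rewrite veps_scalar scalerDl scalerA.
by rewrite scalerDr !scalerA [a * _]mulrC.
Qed.

Section Prim.
Variables (B : vectp K) (D : B -> tens B B) (DP : is_coproduct D).

Definition Prim_subgr : subgr B.
Proof.
apply: (@SubGr _ _ (primitive D)).
- rewrite /primitive (lin0 (cop_linear DP)).
  by rewrite (lin0 ((tpure_bilin _ _).1 _)) (lin0 ((tpure_bilin _ _).2 _)) addr0.
- move=> a x y; rewrite /primitive (cop_linear DP) => -> ->.
  by rewrite (tpure_bilin _ _).1 (tpure_bilin _ _).2 scalerDr addrACA.
- move=> n x; rewrite /primitive (cop_gpr DP) => ->.
  by rewrite (linD (tgr_linear n)) tgr_vone_r tgr_vone_l.
Defined.

Lemma Prim_gpr0 x : primitive D x -> gpr 0 x = 0.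
Proof.
move=> Px; have := cop_epsl DP x; rewrite Px.
rewrite (linD (tsum_linear (@eps_bilin B))) !tsum_pure; try exact: eps_bilin.
rewrite veps_one scale1r => /(canRL (addrK x)); rewrite subrr gpr0_eps.
by move=> ->.
Qed.

Definition Prim_vect : vect K := sgvect (S := Prim_subgr) Prim_gpr0.

End Prim.

Lemma coalg_mor_prim B C (D : B -> tens B B) (D' : C -> tens C C)
  (f : vphom B C) x : coalg_mor D D' f -> primitive D x -> primitive D' (f x).
Proof.
have fL := gfun_linear f.
move=> fD Px; rewrite /primitive fD Px (linD (tmap_linear fL fL)).
by rewrite !tmap_pure // vpfun1.
Qed.

Section PrecPrim.
Variables (B : vectp K) (s : unshuffle_bialgebra B).

Definition PrecPrim_subgr : subgr B.
Proof.
apply: (@SubGr _ _ (prec_primitive s)).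
- rewrite /prec_primitive /kereps veps0 (lin0 (un_prec_linear s)).
  by rewrite (lin0 ((tpure_bilin _ _).1 _)).
- move=> a x y [kx Px] [ky Py]; split.
    by rewrite /kereps vepsD vepsZ kx ky mulr0 addr0.
  by rewrite (un_prec_linear s) Px Py (tpure_bilin _ _).1.
- move=> n x [kx Px]; split; last by rewrite un_prec_gpr Px tgr_vone_r.
  have := gprK 0 n x; rewrite /kereps gpr0_eps => /(congr1 veps).
  rewrite vepsZ veps_one mulr1 => ->; case: eqP => [<-|_]; last exact: veps0.
  by rewrite gpr0_eps kx scale0r veps0.
Defined.

Lemma PrecPrim_gpr0 x : prec_primitive s x -> gpr 0 x = 0.
Proof. by case=> kx _; rewrite gpr0_eps kx scale0r. Qed.

Definition PrecPrim_vect : vect K := sgvect (S := PrecPrim_subgr) PrecPrim_gpr0.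

End PrecPrim.

Lemma unshuffle_mor_prim B C (s : unshuffle_bialgebra B)
    (t : unshuffle_bialgebra C) (f : vphom B C) x :
  unshuffle_mor s t f -> prec_primitive s x -> prec_primitive t (f x).
Proof.
have fL := gfun_linear f.
move=> fP [kx Px]; split; first by rewrite /kereps vphom_eps.
by rewrite (unm_prec fP kx) Px tmap_pure // vpfun1.
Qed.

Definition shuffle_prim : functor (scat shuffle_structure) (VectCat K).
Proof.
apply: (@Functor (scat shuffle_structure) (VectCat K)
  (fun X => Prim_vect (bialg_coproduct (sh_bialg (sstr X))))
  (fun X Y f =>
     @sghom K X Y (Prim_subgr (bialg_coproduct (sh_bialg (sstr X))))
       (Prim_subgr (bialg_coproduct (sh_bialg (sstr Y)))) f
       (fun x => coalg_mor_prim (shm_cop (smapP f))))).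
  by move=> X; apply: ghom_eq => x; apply: sgval_inj.
by move=> X Y Z g f; apply: ghom_eq => x; apply: sgval_inj.
Defined.

Definition infinitesimal_prim :
  functor (scat infinitesimal_structure) (VectCat K).
Proof.
apply: (@Functor (scat infinitesimal_structure) (VectCat K)
  (fun X => Prim_vect (inf_coproduct (sstr X)))
  (fun X Y f =>
     @sghom K X Y (Prim_subgr (inf_coproduct (sstr X)))
       (Prim_subgr (inf_coproduct (sstr Y))) f
       (fun x => coalg_mor_prim (infm_cop (smapP f))))).
  by move=> X; apply: ghom_eq => x; apply: sgval_inj.
by move=> X Y Z g f; apply: ghom_eq => x; apply: sgval_inj.
Defined.

Definition unshuffle_prim : functor (scat unshuffle_structure) (VectCat K).
Proof.
apply: (@Functor (scat unshuffle_structure) (VectCat K)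
  (fun X => PrecPrim_vect (sstr X))
  (fun X Y f =>
     @sghom K X Y (PrecPrim_subgr (sstr X)) (PrecPrim_subgr (sstr Y)) f
       (fun x => unshuffle_mor_prim (smapP f)))).
  by move=> X; apply: ghom_eq => x; apply: sgval_inj.
by move=> X Y Z g f; apply: ghom_eq => x; apply: sgval_inj.
Defined.

End Bialgebras.

Section Over.
Variables (K : fieldType) (S T : structure K).

Definition equivalent_over :=
  exists (F : functor (scat S) (scat T)) (G : functor (scat T) (scat S)),
    [/\ quasi_inverse F G,
        isomorphic (fcomp (forget T) F) (forget S)
      & isomorphic (fcomp (forget S) G) (forget T)].

(* A T-structure on every object of Vect^+ carrying an S-structure, such that
   S-morphisms are T-morphisms. *)
Record restructuring := Restructuring {
  rstr : forall V, cstr S V -> cstr T V;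
  rmor : forall V W (s : cstr S V) (t : cstr S W) (f : vphom V W),
    cmor S s t f -> cmor T (rstr s) (rstr t) f }.

Definition refunctor (r : restructuring) : functor (scat S) (scat T).
Proof.
apply: (@Functor (scat S) (scat T) (fun X => SObj (rstr r (sstr X)))
  (fun X Y (f : shom X Y) =>
     @SHom K T (SObj (rstr r (sstr X))) (SObj (rstr r (sstr Y)))
       f (rmor r (smapP f)))).
  by move=> X; apply: shom_eq.
by move=> X Y Z g f; apply: shom_eq.
Defined.

Definition naturally_equipped :=
  exists (r : restructuring) (G : functor (scat T) (scat S)),
    quasi_inverse (refunctor r) G.

End Over.

Definition isomorphic_over (K : fieldType) (S T : structure K) :=
  [/\ equivalent_over S T, naturally_equipped S T & naturally_equipped T S].

Definition posnat := {n : nat | (0 < n)%N}.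

Definition gperm := {k : nat & ('S_k * {ffun 'I_k -> posnat})%type}.

Section PermAlgebra.
Variable K : fieldType.

Definition permalg : lmodType K :=
  @pres K gperm (fun _ _ => False).

(* In [perm] notation, [sigma * tau] is tau ∘ sigma. *)
Definition gperm_mul (s t : gperm) : permalg :=
  let: (sigma, d) := tagged s in
  let: (tau, e) := tagged_as s t in
  if (tag s == tag t) && (d == [ffun i => e (sigma i)])
  then pgen (Tagged _ ((sigma * tau)%g, d)) else 0.

Definition permalg_mul (a b : permalg) : permalg :=
  plift (fun s => plift (fun t => gperm_mul s t) b) a.

Section Action.
Variable V : graded K.

(* Φ_(σ,d), written on arbitrary words by multilinearity; see [gperm_act_word]
   for words in homogeneous elements. *)
Definition gperm_act (s : gperm) (t : tensalg V) : tensalg V :=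
  let: existT k (sigma, d) := s in
  plift (fun w : seq V =>
    if size w == k
    then word [seq gpr (val (d i)) (nth 0 w (sigma i)) | i <- enum 'I_k]
    else 0) t.

Lemma gperm_act_multilin k (sigma : 'S_k) (d : {ffun 'I_k -> posnat}) :
  multilin (fun w : seq V =>
    if size w == k
    then word [seq gpr (val (d i)) (nth 0 w (sigma i)) | i <- enum 'I_k]
    else 0).
Proof.
move=> s a u v t; rewrite !size_cat /=.
case: eqP => [ek|_]; last by rewrite scaler0 addr0.
have sk : (size s < k)%N by rewrite -ek addnS ltnS leq_addr.
set j := Ordinal sk; set i0 := (sigma^-1)%g j.
have si0 : sigma i0 = j by rewrite permKV.
have i0e : i0 \in enum 'I_k by rewrite mem_enum.
have := enum_uniq 'I_k; case/splitPr: (enum _) / i0e => l1 l2.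
rewrite cat_uniq /= negb_or => /and3P[_ /andP[i1 _] /andP[i2 _]].
rewrite !map_cat /= si0 /= !nth_cat !ltnn !subnn /= gpr_linear.
have E l x y : i0 \notin l ->
    [seq gpr (val (d i)) (nth 0 (s ++ x :: t) (sigma i)) | i <- l] =
    [seq gpr (val (d i)) (nth 0 (s ++ y :: t) (sigma i)) | i <- l].
  move=> il; apply/eq_in_map => i il'; congr gpr; rewrite !nth_cat.
  case: ltnP => // le; case e: (sigma i - size s)%N => //.
  have sij : sigma i = j.
    by apply/val_inj/eqP => /=; rewrite eqn_leq le -subn_eq0 e.
  by move: il; rewrite /i0 -sij permK il'.
rewrite (E _ (a *: u + v) 0 i1) (E _ (a *: u + v) 0 i2) (E _ u 0 i1).
by rewrite (E _ u 0 i2) (E _ v 0 i1) (E _ v 0 i2) word_multilin.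
Qed.

Lemma gperm_act_word k (sigma : 'S_k) (d : {ffun 'I_k -> posnat})
    (w : seq V) (c : 'I_k -> nat) :
  size w = k -> (forall i : 'I_k, homog (c i) (nth 0 w i)) ->
  gperm_act (existT _ k (sigma, d)) (word w) =
    if [forall i, c (sigma i) == val (d i)]
    then word [seq nth 0 w (sigma i) | i <- enum 'I_k] else 0.
Proof.
move=> wk wc; rewrite /gperm_act plift_gen; last first.
  exact/word_compat/gperm_act_multilin.
rewrite wk eqxx; case: forallP => [cd|/forallP].
  by congr word; apply: eq_map => i; rewrite -(eqP (cd i)) wc.
rewrite negb_forall => /existsP[i /negPf ci].
have /splitPr[l1 l2] : i \in enum 'I_k by rewrite mem_enum.
rewrite map_cat /= -[nth _ _ (sigma i)]wc gprK eq_sym ci.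
have := word_multilin [seq gpr (val (d i)) (nth 0 w (sigma i)) | i <- l1]
  (-1) 0 0 [seq gpr (val (d i)) (nth 0 w (sigma i)) | i <- l2].
by rewrite scaler0 addr0 scaleN1r addNr.
Qed.

Definition permalg_act (a : permalg) (t : tensalg V) : tensalg V :=
  plift (fun s => gperm_act s t) a.

End Action.

Record is_permalg_action (V : graded K) (act : permalg -> V -> V) : Prop :=
  IsPermalgAction {
  pact_linearl : forall x, linear (act^~ x);
  pact_linearr : forall a, linear (act a);
  pact_gpr : forall a n x, act a (gpr n x) = gpr n (act a x);
  pact_mul : forall a b x, act (permalg_mul a b) x = act a (act b x) }.

Definition transported_action (S : structure K)
    (P : functor (scat S) (VectCat K))
    (I : natiso (fcomp (TensAlg K) P) (forget S))
    (X : scat S) (a : permalg) (x : scar X) : scar X :=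
  (nfwd I X : vphom _ _) (permalg_act a ((nbwd I X : vphom _ _) x)).

(* T(P(C)) ≅ F(C) naturally, and the action of the graded permutations on the
   F(C) transported along this isomorphism is natural in C. *)
Definition has_natural_permalg_action (S : structure K)
    (P : functor (scat S) (VectCat K)) :=
  exists I : natiso (fcomp (TensAlg K) P) (forget S),
    (forall X, is_permalg_action (transported_action I (X := X)))
    /\ (forall (X Y : scat S) (f : shom X Y) a x,
          f (transported_action I a x) = transported_action I a (f x)).

End PermAlgebra.

(* Main.v *)
(** Each of the three kinds of bialgebras carries a full coproduct [C], a "half
coproduct" [D] with [(D ⊗ id) D = (id ⊗ C) D], and a bilinear operation [▷] such
that [D (p ▷ y) = p ▷ y_1 ⊗ y_2], where [C y = y_1 ⊗ y_2], for every [p] in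
[P = {p in Ker ε | D p = p ⊗ 1}]: for infinitesimal and shuffle bialgebras [D] is
[C - 1 ⊗ id] and [▷] is the product, resp. the left half-shuffle; for unshuffle
bialgebras [D] is [δ_≺] and [▷] is the product.  In all cases [P] is the space of
primitive elements of the statement.

In this setting [θ : T(P) -> B], [θ (p w) = p ▷ θ w], is an isomorphism.  Define
[e] by recursion on the degree so that [x - ε x = e x_1 ▷ x_2], where
[D x = x_1 ⊗ x_2]; then [e] is a projection onto [P] with [e (p ▷ y) = ε y p], and
the inverse of [θ] is [E x = ε x + e x_1 · E x_2].

Hence every bialgebra of one kind is freely built on its primitive elements, and
the structures of the other two kinds on [T(P)] are transported along [θ]. *)

From mathcomp Require Import all_fingroup all_boot all_algebra.
From mathcomp Require Import ssrAC boolp.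
Require Import Defs.

Set Implicit Arguments.
Unset Strict Implicit.
Unset Printing Implicit Defensive.

Import GRing.Theory.
Local Open Scope ring_scope.

(** * Linear maps and tensors *)

(** The characteristic is arbitrary, so projections onto primitive elements that divide by word
    lengths or factorials, such as the Dynkin and Eulerian ones, are excluded. A half coproduct
    avoids the division: on T(P) it keeps the first letter on the left, D (p w) = p w_1 ⊗ w_2, so
    that this letter can be singled out. In the sum of the e x_1 ▷ x_2, the terms with x_2 in degree
    0 add up to e x, by the right counit of D and p ▷ 1 = p, while all others involve e in smaller
    degrees; hence x - ε x = e x_1 ▷ x_2 can be solved for e x. On T(V) the free infinitesimal
    bialgebra has concatenation and deconcatenation, the free shuffle bialgebra has the shuffle
    product and deconcatenation, the free unshuffle bialgebra has concatenation and the unshuffle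
    coproduct. The comparison passes through Vect: taking primitive elements and forming T(V) are
    mutually inverse equivalences with each category, where P(T(V)) ≅ V because the primitive
    elements of T(V), in the sense proper to each kind, are its letters. *)

Section LinearCombinators.
Variable K : fieldType.
Implicit Types U V W X : lmodType K.

Lemma lin_const0 U V : linear (fun _ : U => 0 : V).
Proof. by move=> a x y; rewrite scaler0 addr0. Qed.

Lemma lin_add U V (f g : U -> V) :
  linear f -> linear g -> linear (fun x => f x + g x).
Proof. by move=> fL gL a x y; rewrite fL gL scalerDr addrACA. Qed.

Lemma lin_opp U V (f : U -> V) : linear f -> linear (fun x => - f x).
Proof. by move=> fL a x y; rewrite fL opprD scalerN. Qed.

Lemma lin_scale U V c (f : U -> V) : linear f -> linear (fun x => c *: f x).
Proof. by move=> fL a x y; rewrite fL scalerDr !scalerA mulrC. Qed.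

Lemma lin_veps U V (B : vectp K) (f : U -> B) (c : V) :
  linear f -> linear (fun x => veps (f x) *: c).
Proof. by move=> fL a x y; rewrite fL veps_scalar scalerDl scalerA. Qed.

Lemma lin_compose U V W (g : V -> W) (f : U -> V) :
  linear g -> linear f -> linear (fun x => g (f x)).
Proof. by move=> gL fL a x y; rewrite fL gL. Qed.

Lemma lin_bilinl U V W X (m : V -> W -> X) (f : U -> V) c :
  bilin m -> linear f -> linear (fun x => m (f x) c).
Proof. by move=> [mL _] fL a x y; rewrite fL mL. Qed.

Lemma lin_bilinr U V W X (m : W -> V -> X) (f : U -> V) c :
  bilin m -> linear f -> linear (fun x => m c (f x)).
Proof. by move=> [_ mL] fL a x y; rewrite fL mL. Qed.

Lemma lin_tpurel U V W (f : U -> V) (c : W) :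
  linear f -> linear (fun x => f x ⊗ c).
Proof. exact/lin_bilinl/tpure_bilin. Qed.

Lemma lin_tpurer U V W (f : U -> V) (c : W) :
  linear f -> linear (fun x => c ⊗ f x).
Proof. exact/lin_bilinr/tpure_bilin. Qed.

Lemma lin_tsum U V W X (F : U -> tens V W) (b : V -> W -> X) :
  bilin b -> linear F -> linear (fun x => tsum (F x) b).
Proof. by move=> bB; apply: lin_compose; apply: tsum_linear. Qed.

Lemma lin_tsum_body U V W X (t : tens V W) (b : U -> V -> W -> X) :
  (forall x, bilin (b x)) -> (forall v w, linear (fun x => b x v w)) ->
  linear (fun x => tsum t (b x)).
Proof.
move=> bB bL a x y; move: t; apply: tens_ext => [||v w].
- exact: tsum_linear.
- by apply: lin_add; [apply: lin_scale|]; apply: tsum_linear.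
- by rewrite !tsum_pure // bL.
Qed.

End LinearCombinators.

Ltac lin_head t := lazymatch t with ?f _ => lin_head f | _ => t end.

Ltac lin_same s t :=
  let h := lin_head s in let h' := lin_head t in constr_eq h h'.

Ltac lin_hyp :=
  match goal with
  | H : GRing.linear_for _ ?g |- GRing.linear_for _ ?f =>
    lin_same f g; exact H
  | H : bilin ?g |- bilin ?f => lin_same f g; exact H
  | H : bilin ?g |- GRing.linear_for _ ?f => lin_same f g; exact (H.2 _)
  | H : forall _, GRing.linear_for _ _ |- GRing.linear_for _ _ => exact (H _)
  | H : forall _, bilin _ |- bilin _ => exact (H _)
  end.

(** An extension point, rebound with [::=] whenever new linear or bilinear maps are introduced;
    [lin] and [lin_struct] always call its current value. *)
Ltac lin_leaf := fail.

(* The unifier would unfold the operations when a lemma does not apply, so the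
   lemmas and the hypotheses are selected by the head symbol of the goal. *)
Ltac lin :=
  intros; cbv beta;
  lazymatch goal with
  | |- bilin (fun _ _ => _) => split; lin
  | |- bilin _ => first [ lin_leaf | lin_hyp | split; lin ]
  | |- GRing.linear_for _ (fun x => x) => exact: lin_id
  | |- GRing.linear_for _ (fun x => _) =>
    first [ lin_struct | lin_hyp ]
  | |- GRing.linear_for _ _ => first [ lin_leaf | lin_hyp | exact: lin_id ]
  end
with lin_struct :=
  match goal with
  | |- GRing.linear_for _ (fun x => 0) => exact: lin_const0
  | |- GRing.linear_for _ (fun x => @?f x + @?g x) => apply: lin_add; lin
  | |- GRing.linear_for _ (fun x => - @?f x) => apply: lin_opp; lin
  | |- GRing.linear_for _ (fun x => veps (@?f x) *: ?c) =>
    apply: lin_veps; lin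
  | |- GRing.linear_for _ (fun x => _ *: @?f x) => apply: lin_scale; lin
  | |- GRing.linear_for _ (fun x => \sum_(i <- _ | _) _) => apply: lin_big; lin
  | |- GRing.linear_for _ (fun x => @?f x ⊗ ?c) => apply: lin_tpurel; lin
  | |- GRing.linear_for _ (fun x => ?c ⊗ @?f x) => apply: lin_tpurer; lin
  | |- GRing.linear_for _ (fun x => tsum (@?F x) ?b) => apply: lin_tsum; lin
  | |- GRing.linear_for _ (fun x => tsum ?t (@?b x)) =>
    apply: lin_tsum_body; lin
  | |- GRing.linear_for _ (fun x => ?h (@?F x)) =>
    apply: (@lin_compose _ _ _ _ h F); [ solve [lin] | solve [lin] ]
  | |- GRing.linear_for _ (fun x => ?m (@?F x) ?c) =>
    apply: (@lin_bilinl _ _ _ _ _ m F c);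
    [ solve [first [lin_leaf | lin_hyp]] | solve [lin] ]
  end.

Ltac lin_leaf_basic :=
  lazymatch goal with
  | |- GRing.linear_for _ (gpr _) => exact: gpr_linear
  | |- GRing.linear_for _ (gfun _) => exact: gfun_linear
  | |- GRing.linear_for _ (tgr _) => exact: tgr_linear
  | |- GRing.linear_for _ (tcons _) => exact: tconsr
  | |- GRing.linear_for _ (tpure _) => exact: (tpure_bilin _ _).2
  | |- GRing.linear_for _ (tmap _ _) => apply: tmap_linear; lin
  | |- bilin (@tpure _ _ _) => exact: tpure_bilin
  | |- bilin (@tcons _ _) => split; [exact: tconsl|exact: tconsr]
  end.

Ltac lin_leaf ::= lin_leaf_basic.

Section TensorSums.
Variable K : fieldType.
Implicit Types U V W : lmodType K.

Lemma tsum_eq U V W (t : tens U V) (b b' : U -> V -> W) :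
  (forall u v, b u v = b' u v) -> tsum t b = tsum t b'.
Proof.
by move=> e; congr tsum; apply: funext => u; apply: funext => v; exact: e.
Qed.

Lemma tsum_id U V (t : tens U V) : tsum t (fun u v => u ⊗ v) = t.
Proof.
move: t; apply: tens_ext => [||u v]; try by lin.
by rewrite tsum_pure //; lin.
Qed.

Lemma lin_tsumE U V W W' (h : W -> W') (t : tens U V) (b : U -> V -> W) :
  linear h -> bilin b -> h (tsum t b) = tsum t (fun u v => h (b u v)).
Proof.
move=> hL bB; have hbB : bilin (fun u v => h (b u v)).
  by split=> [v|u]; apply: lin_compose => //; [case: bB|case: bB].
by move: t; apply: tens_ext => [||u v]; [lin|lin|rewrite !tsum_pure].
Qed.

Arguments lin_tsumE {U V W W' h t b}.

Lemma tsum_tmap U V U' V' W (f : U -> U') (g : V -> V') (b : U' -> V' -> W)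
  (t : tens U V) : linear f -> linear g -> bilin b ->
  tsum (tmap f g t) b = tsum t (fun u v => b (f u) (g v)).
Proof.
move=> fL gL bB; rewrite /tmap (lin_tsumE (h := fun s => tsum s b)); try by lin.
by apply: tsum_eq => u v; rewrite tsum_pure.
Qed.

Lemma tsumD U V W (t : tens U V) (b b' : U -> V -> W) : bilin b -> bilin b' ->
  tsum t (fun u v => b u v + b' u v) = tsum t b + tsum t b'.
Proof.
move=> bB bB'; move: t; apply: tens_ext => [||u v]; [| |]; try by lin.
by rewrite !tsum_pure //; lin.
Qed.

End TensorSums.
Arguments lin_tsumE {K U V W W' h t b}.
Arguments tsum_eq {K U V W t b} b'.

(** * Recursion on the degree *)

Section GradedRecursion.
Variable K : fieldType.
Implicit Types V : graded K.

Lemma gpr_homog V n (x : V) : homog n (gpr n x).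
Proof. by rewrite /homog gprK eqxx. Qed.

Lemma homog_gpr V n m (x : V) : homog n x -> gpr m x = if m == n then x else 0.
Proof. by move=> xn; rewrite -xn gprK. Qed.

Lemma homog_lin V n a (x y : V) : homog n x -> homog n y -> homog n (a *: x + y).
Proof. by move=> xn yn; rewrite /homog gpr_linear xn yn. Qed.

Lemma homog0 V n : homog n (0 : V).
Proof. exact/lin0/gpr_linear. Qed.

Lemma homogD V n (x y : V) : homog n x -> homog n y -> homog n (x + y).
Proof. by move=> xn yn; rewrite /homog (linD (gpr_linear n)) xn yn. Qed.

Lemma homog_ind V (P : V -> Prop) : P 0 -> (forall x y, P x -> P y -> P (x + y)) ->
  (forall n x, homog n x -> P x) -> forall x, P x.
Proof.
move=> P0 PD Ph x; have [N ->] := gpr_sum x.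
by elim/big_ind: _ => // n _; apply: (Ph n); apply: gpr_homog.
Qed.

Lemma homog_ext V (W : lmodType K) (f g : V -> W) : linear f -> linear g ->
  (forall n x, homog n x -> f x = g x) -> f =1 g.
Proof.
move=> fL gL fg; apply: homog_ind => // [|x y fx fy].
  by rewrite (lin0 fL) (lin0 gL).
by rewrite (linD fL) (linD gL) fx fy.
Qed.

Lemma gpr_large V (x : V) N : x = \sum_(n < N) gpr n x ->
  forall m, (N <= m)%N -> gpr m x = 0.
Proof.
move=> xN m Nm; rewrite xN (lin_sum (gpr_linear m)) big1 // => n _.
by rewrite gprK gtn_eqF // (leq_trans (ltn_ord n)).
Qed.

(** The iterates of [Phi] starting from 0 become stationary in each degree: on degree n all iterates
    from the (n+1)-st on agree, because [Phi] looks only at smaller degrees. The stable values are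
    glued along homogeneous components. Both e and E are obtained in this way. *)
Lemma graded_rec V (W : lmodType K) (Phi : (V -> W) -> V -> W) :
  (forall f, linear f -> linear (Phi f)) ->
  (forall n f g x, linear f -> linear g ->
     (forall p y, (p < n)%N -> homog p y -> f y = g y) ->
     homog n x -> Phi f x = Phi g x) ->
  exists f, linear f /\ f =1 Phi f.
Proof.
move=> PhiL Phi_loc; pose it n := iter n Phi (fun _ => 0).
have itL n : linear (it n) by elim: n => [|n ih] /=; [lin|exact: PhiL].
have it_stable n : forall m x, homog n x -> (n < m)%N -> it m x = it n.+1 x.
  elim/ltn_ind: n => n ih [|m] x xn // nm.
  apply: (Phi_loc n) => // p y pn yp.
  transitivity (it p.+1 y); [|symmetry]; apply: ih => //.
  exact: leq_trans pn nm.
(* An element has finitely many components but no given bound on their degrees. One is chosen, and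
   [fE] shows that any larger bound gives the same sum; a common bound then yields linearity. *)
have [N NP] := choice (@gpr_sum _ V).
pose f x := \sum_(n < N x) it n.+1 (gpr n x).
have fE M x : (N x <= M)%N -> f x = \sum_(n < M) it n.+1 (gpr n x).
  move=> NM; rewrite /f (big_ord_widen M (fun n => it n.+1 (gpr n x))) //.
  rewrite big_mkcond; apply: eq_bigr => n _; case: ltnP => // Nn.
  by rewrite (gpr_large (NP x)) // (lin0 (itL _)).
have fL : linear f.
  move=> a x y; pose M := maxn (N (a *: x + y)) (maxn (N x) (N y)).
  rewrite !(fE M) ?leq_max ?leqnn ?orbT // scaler_sumr -big_split.
  by apply: eq_bigr => n _; rewrite gpr_linear itL.
have f_homog n x : homog n x -> f x = it n.+1 x.
  move=> xn; pose M := maxn (N x) n.+1; rewrite (fE M) ?leq_maxl //.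
  have nM : (n < M)%N by rewrite leq_max ltnSn orbT.
  rewrite (bigD1 (Ordinal nM)) //= xn big1 ?addr0 // => p /negPf pn.
  rewrite (homog_gpr _ xn) -[_ == n]/(p == Ordinal nM) pn.
  exact: (lin0 (itL p.+1)).
exists f; split=> //; apply: homog_ext => // [|n x xn]; first exact: PhiL.
rewrite (f_homog n) //=; apply: (Phi_loc n) => // p y pn yp.
by rewrite (f_homog p) // (it_stable p).
Qed.

(** A tensor of total degree n is a sum of pure tensors of bidegree (p, n - p). This carries
    induction hypotheses about smaller degrees under a Sweedler sum. *)
Lemma tgr_agree (U V : graded K) (W : lmodType K) n (t : tens U V)
  (F G : U -> V -> W) : bilin F -> bilin G ->
  (forall p a b, (p <= n)%N -> homog p a -> homog (n - p) b -> F a b = G a b) ->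
  tgr n t = t -> tsum t F = tsum t G.
Proof.
move=> FB GB FG <-; move: t; apply: tens_ext => [||u v]; try by lin.
rewrite tgr_pure !(lin_sum (tsum_linear _)) //; apply: eq_bigr => p _.
rewrite !tsum_pure //; apply: (FG p); try exact: gpr_homog.
exact: (ltn_ord p).
Qed.

Lemma tgr_homog (U V : graded K) (B : graded K) (D : B -> tens U V) n x :
  (forall m x, D (gpr m x) = tgr m (D x)) -> homog n x -> tgr n (D x) = D x.
Proof. by move=> Dg xn; rewrite -Dg xn. Qed.

End GradedRecursion.

(** * The augmentation and the projection onto its kernel *)

Section Augmentation.
Variables (K : fieldType) (B : vectp K).

Lemma homog_eps n (x : B) : homog n x -> n != 0%N -> veps x = 0.
Proof.
move=> xn n0; have := homog_gpr 0 xn; rewrite eq_sym (negPf n0) gpr0_eps.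
by move/(congr1 veps); rewrite vepsZ veps_one veps0 mulr1.
Qed.

Definition epos (x : B) : B := x - veps x *: vone.

Lemma epos_linear : linear epos.
Proof. by rewrite /epos; lin. Qed.

Lemma epos_homog0 x : homog 0 x -> epos x = 0.
Proof. by move=> x0; rewrite /epos -gpr0_eps x0 subrr. Qed.

Lemma kereps_epos x : kereps (epos x).
Proof. by rewrite /kereps /epos -scaleNr vepsD vepsZ veps_one mulr1 addrN. Qed.

Lemma epos_id x : kereps x -> epos x = x.
Proof. by rewrite /epos => ->; rewrite scale0r subr0. Qed.

Lemma eposK x : x = epos x + veps x *: vone.
Proof. by rewrite /epos subrK. Qed.

Lemma homog_vone : homog 0 (vone : B).
Proof. by rewrite /homog gpr_vone. Qed.

End Augmentation.

Ltac lin_leaf_epos :=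
  lazymatch goal with
  | |- GRing.linear_for _ (@epos _ _) => exact: epos_linear
  | |- _ => lin_leaf_basic
  end.

Ltac lin_leaf ::= lin_leaf_epos.

(** * Linear maps out of T(V) by recursion on words *)

Section TensorFold.
Variables (K : fieldType) (V W : lmodType K) (w0 : W) (g : V -> W -> W).

(** The universal property of T(V) as the space generated by one point under a bilinear action of
    [V]. Concatenation, the unshuffle coproduct and θ are all of this form. *)
Definition tfold (t : tensalg V) : W := plift (foldr g w0) t.

Hypothesis gB : bilin g.

Lemma tfold_multilin : multilin (foldr g w0).
Proof.
move=> s a u v t; elim: s => [|x s ih] /=; first by rewrite gB.1.
by rewrite ih gB.2.
Qed.

Lemma tfold_linear : linear tfold.
Proof. exact/plift_linear/word_compat/tfold_multilin. Qed.

Lemma tfold_word w : tfold (word w) = foldr g w0 w.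
Proof. by rewrite /tfold plift_gen //; apply/word_compat/tfold_multilin. Qed.

Lemma tfold_nil : tfold (word [::]) = w0.
Proof. by rewrite tfold_word. Qed.

Lemma tfold_cons v t : tfold (tcons v t) = g v (tfold t).
Proof.
move: t; apply: tensalg_ext => [||w].
- by apply: lin_compose; [exact: tfold_linear|exact: tconsr].
- by apply: lin_compose; [exact: gB.2|exact: tfold_linear].
- by rewrite tcons_word !tfold_word.
Qed.

End TensorFold.

Lemma tcons_ext (K : fieldType) (V W : lmodType K) (f g : tensalg V -> W) :
  linear f -> linear g -> f (word [::]) = g (word [::]) ->
  (forall v t, f t = g t -> f (tcons v t) = g (tcons v t)) -> f =1 g.
Proof.
move=> fL gL fg0 fgS; apply: tensalg_ext => //; elim=> // v w ih.
by rewrite -tcons_word fgS.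
Qed.

Lemma tcons_bilin (K : fieldType) (V : lmodType K) : bilin (@tcons K V).
Proof. by split=> [t|v]; [exact: tconsl|exact: tconsr]. Qed.

Lemma homog_tcons (K : fieldType) (V : graded K) d n (v : V)
    (t : tensalg_graded V) :
  homog d v -> homog n t -> homog (d + n) (tcons v t : tensalg_graded V).
Proof.
move=> vd <-; elim: (hspan_all t) => [|a m w u hw _ ih].
  by rewrite (lin0 (gpr_linear n)) (lin0 (tconsr _)); apply: homog0.
rewrite [gpr n _](tagr_linear n) (tagr_hword n hw) tconsr.
apply: homog_lin => //; case: eqP => [->|_]; last first.
  by rewrite (lin0 (tconsr _)); apply: homog0.
by rewrite tcons_word /homog [LHS](tagr_hword _ (hword_cons vd hw)) eqxx.
Qed.

(** * Reconstruction from primitive elements *)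

Section Coassociativity.
Variable K : fieldType.
Implicit Types U V W X Y : lmodType K.

Lemma tassoc_linear U V W : linear (@tassoc K U V W).
Proof. by rewrite /tassoc; lin. Qed.

Lemma tsum_tassoc U V W X (g : U -> tens V W -> X) (t : tens (tens U V) W) :
  bilin g ->
  tsum (tassoc t) g = tsum t (fun s w => tsum s (fun u v => g u (v ⊗ w))).
Proof.
move=> gB; rewrite /tassoc (lin_tsumE (h := fun s => tsum s g)); try by lin.
apply: tsum_eq => s w.
rewrite (lin_tsumE (h := fun s => tsum s g)); try by lin.
by apply: tsum_eq => u v; rewrite tsum_pure.
Qed.

(* In Sweedler notation: [a ⊗ b_1 ⊗ b_2 = a_1 ⊗ a_2 ⊗ b]. *)
Lemma coassoc_sum U V W X Y (d : U -> tens V W) (c : Y -> tens W X)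
   (t : tens U X) (t' : tens V Y) (Z : lmodType K) (g : V -> W -> X -> Z) :
  linear d -> linear c ->
  (forall b c, linear (fun a => g a b c)) ->
  (forall a c, linear (fun b => g a b c)) ->
  (forall a b, linear (g a b)) ->
  tassoc (tmap d id t) = tmap id c t' ->
  tsum t' (fun a b => tsum (c b) (fun b1 b2 => g a b1 b2)) =
  tsum t (fun a b => tsum (d a) (fun a1 a2 => g a1 a2 b)).
Proof.
move=> dL cL g1 g2 g3 e.
have gB a : bilin (g a) by split=> [v|u]; [exact: g2|exact: g3].
pose G a s := tsum s (g a).
have GB : bilin G.
  split=> [s|a]; last exact: tsum_linear.
  by apply: lin_tsum_body => // v w; apply: g1.
have idL (P : lmodType K) : linear (@id P) by exact: lin_id.
transitivity (tsum (tmap id c t') G); first by rewrite tsum_tmap.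
rewrite -e tsum_tassoc // tsum_tmap //.
  apply: tsum_eq => u v; apply: tsum_eq => a b.
  by rewrite /G tsum_pure.
split=> [w|s].
  apply: tsum_linear; split=> [v|u]; first by apply: GB.1.
  by apply: lin_compose; [apply: GB.2|lin].
apply: lin_tsum_body => [w|v w]; last first.
  by apply: lin_compose; [apply: GB.2|lin].
split=> [v|u]; first by apply: GB.1.
by apply: lin_compose; [apply: GB.2|lin].
Qed.

End Coassociativity.

(** * Half coproducts, the projection onto their primitive elements, and θ *)

Section HalfBialgebra.
Variables (K : fieldType) (B : vectp K).

(** The last field is the form that each of the three product-coproduct axioms takes, in terms of
    [D], once the left factor satisfies [D p = p ⊗ vone]. *)
Record half_bialgebra (C D : B -> tens B B) (act : B -> B -> B) : Prop :=
  HalfBialgebra {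
  hb_cop_linear : linear C;
  hb_cop_gpr : forall n x, C (gpr n x) = tgr n (C x);
  hb_cop1 : C vone = vone ⊗ vone;
  hb_cop_epsl : forall x, tsum (C x) (fun a b => veps a *: b) = x;
  hb_half_linear : linear D;
  hb_half_gpr : forall n x, D (gpr n x) = tgr n (D x);
  hb_half1 : D vone = 0;
  hb_half_epsl : forall x, tsum (D x) (fun a b => veps a *: b) = 0;
  hb_half_epsr : forall x, tsum (D x) (fun a b => veps b *: a) = epos x;
  hb_halfA : forall x, tassoc (tmap D id (D x)) = tmap id C (D x);
  hb_act_bilin : bilin act;
  hb_act_homog : forall p q x y,
    homog p x -> homog q y -> homog (p + q) (act x y);
  hb_act1 : forall x, kereps x -> act x vone = x;
  hb_half_act : forall p y, kereps p -> D p = p ⊗ vone ->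
    D (act p y) = tsum (C y) (fun a b => act p a ⊗ b) }.

Variables (C D : B -> tens B B) (act : B -> B -> B).
Hypothesis H : half_bialgebra C D act.

Let CL := hb_cop_linear H.
Let DL := hb_half_linear H.
Let aB := hb_act_bilin H.

Lemma act0 x : act x 0 = 0. Proof. exact: lin0 (aB.2 x). Qed.
Lemma act0l x : act 0 x = 0. Proof. exact: lin0 (aB.1 x). Qed.

(** [act] adds degrees and [epos] leaves only positive ones, where ε vanishes. *)
Lemma eps_act_epos x y : veps (act x (epos y)) = 0.
Proof.
have eL : linear (@epos K B) := @epos_linear K B.
move: x; apply: homog_ind => [|x x' h h'|p x xp]; first by rewrite act0l veps0.
  by rewrite (linD (aB.1 _)) vepsD h h' addr0.
move: y; apply: homog_ind => [|y y' h h'|q y yq].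
- by rewrite (lin0 eL) act0 veps0.
- by rewrite (linD eL) (linD (aB.2 _)) vepsD h h' addr0.
case: q yq => [|q] yq; first by rewrite epos_homog0 // act0 veps0.
rewrite epos_id; last exact: homog_eps yq _.
by apply: homog_eps (hb_act_homog H xp yq) _; rewrite addnS.
Qed.

Lemma eps_epos_act x y : veps (act (epos x) y) = 0.
Proof.
have eL : linear (@epos K B) := @epos_linear K B.
move: y; apply: homog_ind => [|y y' h h'|q y yq]; first by rewrite act0 veps0.
  by rewrite (linD (aB.2 _)) vepsD h h' addr0.
move: x; apply: homog_ind => [|x x' h h'|p x xp].
- by rewrite (lin0 eL) act0l veps0.
- by rewrite (linD eL) (linD (aB.1 _)) vepsD h h' addr0.
case: p xp => [|p] xp; first by rewrite epos_homog0 // act0l veps0.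
rewrite epos_id; last exact: homog_eps xp _.
exact: homog_eps (hb_act_homog H xp yq) _.
Qed.

Lemma eps_act x y : kereps x -> veps (act x y) = 0.
Proof. by move/epos_id => <-; apply: eps_epos_act. Qed.

(* [act (e a) (epos b)] only involves [e] in degrees smaller than that of [x],
   because [epos] kills degree [0]. *)
Lemma projector_exists : exists e : B -> B, linear e /\
  forall x, e x = epos x - tsum (D x) (fun a b => act (e a) (epos b)).
Proof.
pose Phi (f : B -> B) x := epos x - tsum (D x) (fun a b => act (f a) (epos b)).
apply: (@graded_rec _ _ _ Phi) => [f fL|n f g x fL gL fg xn].
  by rewrite /Phi; lin.
rewrite /Phi; congr (_ - _); apply: (@tgr_agree _ _ _ _ n); try by lin.
  move=> p a b; rewrite leq_eqVlt => /predU1P[->|pn] pa bp.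
    by rewrite subnn in bp; rewrite epos_homog0 // !act0.
  by rewrite (fg p).
exact: tgr_homog (hb_half_gpr H) xn.
Qed.

Section Projector.
Variable e : B -> B.
Hypothesis eL : linear e.
Hypothesis eE :
  forall x, e x = epos x - tsum (D x) (fun a b => act (e a) (epos b)).

Lemma proj_vone : e vone = 0.
Proof.
rewrite eE (hb_half1 H) (epos_homog0 (homog_vone B)) sub0r.
by rewrite (lin0 (tsum_linear _)) ?oppr0 //; lin.
Qed.

Lemma proj_kereps x : kereps (e x).
Proof.
rewrite /kereps eE -scaleN1r vepsD vepsZ kereps_epos.
suff -> : forall t, veps (tsum t (fun a b => act (e a) (epos b))) = 0.
  by rewrite mulr0 addr0.
have bB : bilin (fun a b => act (e a) (epos b)) by lin.
apply: tens_ind => [|u v t ih]; first by rewrite (lin0 (tsum_linear bB)) veps0.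
by rewrite (linD (tsum_linear bB)) vepsD ih tsum_pure // eps_act_epos addr0.
Qed.

Lemma proj_epos x : e (epos x) = e x.
Proof. by rewrite {2}(eposK x) (linD eL) (linZ eL) proj_vone scaler0 addr0. Qed.

(** The recursion for [e] freed from [epos]. Replacing [epos b] by [b] adds the terms ε(b) e(a) ▷ 1
    = e(ε(b) a), whose sum is e(x) by the right counit of [D]. *)
Lemma proj_split x : epos x = tsum (D x) (fun a b => act (e a) b).
Proof.
transitivity (tsum (D x) (fun a b => act (e a) (epos b) + e (veps b *: a))).
  rewrite tsumD; [|by lin|by lin].
  rewrite -(lin_tsumE eL (b := fun a b => veps b *: a)); last by lin.
  by rewrite (hb_half_epsr H) proj_epos addrC eE subrK.
apply: tsum_eq => a b; rewrite {3}(eposK b) (linD (aB.2 _)) (linZ (aB.2 _)).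
by rewrite (hb_act1 H) ?(linZ eL) //; apply: proj_kereps.
Qed.

(** Induction on the degree. In the recursion for [e x], the element [e a] is already known to be
    primitive whenever [epos b] is nonzero, so [hb_half_act] computes [D] of each summand. These add
    up to D x - e x ⊗ 1, which is subtracted from D x. *)
Lemma proj_half x : D (e x) = e x ⊗ vone.
Proof.
move: x; apply: homog_ext; try by lin.
elim/ltn_ind => n ih x xn.
rewrite {1}eE -scaleN1r (linD DL) (linZ DL) scaleN1r.
rewrite (lin_tsumE DL); last by lin.
have -> : D (epos x) = D x.
  by rewrite [in RHS](eposK x) (linD DL) (linZ DL) (hb_half1 H) scaler0 addr0.
pose G a b := tsum (C b) (fun b1 b2 => act (e a) b1 ⊗ b2).
have GB : bilin G by rewrite /G; lin.
rewrite (@tgr_agree _ _ _ _ n _ _ (fun a b => G a (epos b))); first last.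
- exact: tgr_homog (hb_half_gpr H) xn.
- move=> p a b; rewrite leq_eqVlt => /predU1P[->|pn] pa bp.
    rewrite subnn in bp; rewrite epos_homog0 // act0 (lin0 DL).
    by rewrite (lin0 (GB.2 a)).
  by rewrite (hb_half_act H) //; [apply: proj_kereps|apply: (ih p)].
- by lin.
- by lin.
have -> : tsum (D x) (fun a b => G a (epos b)) =
          tsum (D x) (fun a b => G a b + - (e (veps b *: a) ⊗ vone)).
  apply: tsum_eq => a b; rewrite {2}(eposK b) (linD (GB.2 a)) (linZ (GB.2 a)).
  rewrite {3}/G (hb_cop1 H) tsum_pure; last by lin.
  rewrite (hb_act1 H); last exact: proj_kereps.
  by rewrite (linZ eL) (linZ ((tpure_bilin _ _).1 _)) addrK.
rewrite tsumD; [|by lin|by lin].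
rewrite -(lin_tsumE (h := fun y => - (e y ⊗ vone))
           (b := fun a b => veps b *: a)); [|by lin|by lin].
rewrite (hb_half_epsr H) proj_epos opprD opprK addrA.
(* Half coassociativity turns the sum of the [G a b] into that of the (e a_1 ▷ a_2) ⊗ b, that is, of
   the [epos a ⊗ b] by [proj_split]. It differs from [D x] by 1 ⊗ ε(a) b, which the left counit of
   [D] kills. *)
rewrite /G (coassoc_sum (d := D) (t := D x)); try by lin.
  suff -> : tsum (D x) (fun a b => tsum (D a) (fun a1 a2 => act (e a1) a2 ⊗ b))
            = D x by rewrite subrr add0r.
  rewrite -[RHS]subr0.
  transitivity (D x - (vone ⊗ tsum (D x) (fun a b => veps a *: b)) : tens B B).
    rewrite -{2}[D x]tsum_id (lin_tsumE (h := fun y => - (vone ⊗ y))); try by lin.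
    rewrite -tsumD; [|by lin|by lin].
    apply: tsum_eq => a b.
    rewrite -(lin_tsumE (h := fun y => y ⊗ b)) -?proj_split; try by lin.
    rewrite /epos -!scaleN1r (linD ((tpure_bilin _ _).1 _)).
    rewrite !(linZ ((tpure_bilin _ _).1 _)).
    by rewrite (linZ ((tpure_bilin _ _).2 _)).
  by rewrite (hb_half_epsl H) (lin0 ((tpure_bilin _ _).2 _)).
exact: hb_halfA H x.
Qed.

(** Induction on the degree of [y]: by [hb_half_act] the recursion for e(p ▷ y) only calls e(p ▷
    y_1), equal to ε(y_1) p in smaller degrees. By the left counit of [C] it therefore subtracts p ▷
    [epos y] from p ▷ y. *)
Lemma proj_act p y : kereps p -> D p = p ⊗ vone -> e (act p y) = veps y *: p.
Proof.
move=> p0 Dp; move: y; apply: homog_ext; try by lin.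
elim/ltn_ind => n ih y yn.
rewrite eE epos_id ?(hb_half_act H) //; last exact: eps_act.
rewrite (lin_tsumE (h := fun t => tsum t _)); [|by lin|by lin].
rewrite (@tgr_agree _ _ _ _ n _ _
  (fun a b => act p (epos (veps a *: b)))); first last.
- exact: tgr_homog (hb_cop_gpr H) yn.
- move=> q a b; rewrite tsum_pure; last by lin.
  rewrite leq_eqVlt => /predU1P[->|qn] qa bq.
    rewrite subnn in bq; rewrite (linZ (@epos_linear K B)).
    by rewrite epos_homog0 // scaler0 !act0.
  rewrite (ih q) // (linZ (aB.1 _)) (linZ (@epos_linear K B)).
  by rewrite (linZ (aB.2 _)).
- by lin.
- by lin.
rewrite -(lin_tsumE (h := fun y => act p (epos y))
           (b := fun a b => veps a *: b)); [|by lin|by lin].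
rewrite (hb_cop_epsl H) {1}(eposK y) (linD (aB.2 _)) (linZ (aB.2 _)).
by rewrite (hb_act1 H) // addrAC subrr add0r.
Qed.

End Projector.

(** The primitive elements enter through the characterization [PE] because the statement describes
    them in two ways: by the full coproduct for shuffle and infinitesimal bialgebras, by the half
    coproduct for unshuffle ones. *)
Variable P : subgr B.
Hypothesis P0 : forall x, sgmem P x -> gpr 0 x = 0.
Hypothesis PE : forall x, sgmem P x <-> kereps x /\ D x = x ⊗ vone.

Let V := sgvect P0.

Definition theta_fun : tensalg V -> B :=
  tfold vone (fun (v : sgtype P) y => act (sgval v) y).

Lemma theta_act_bilin : bilin (fun (v : sgtype P) y => act (sgval v) y).
Proof.
split=> [y|v]; last exact: aB.2.
by apply: (lin_bilinl _ aB); exact: (@sgval_linear K B P).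
Qed.

Lemma theta_linear : linear theta_fun.
Proof. exact: tfold_linear theta_act_bilin. Qed.

Lemma theta_nil : theta_fun (word [::]) = vone.
Proof. exact: tfold_nil theta_act_bilin. Qed.

Lemma theta_cons v t : theta_fun (tcons v t) = act (sgval v) (theta_fun t).
Proof. exact: (tfold_cons _ theta_act_bilin). Qed.

Lemma theta_hword d (w : seq V) : hword d w -> homog d (theta_fun (word w)).
Proof.
elim=> {d w} [|d v n w vd _ ih]; first by rewrite theta_nil; exact: homog_vone.
rewrite -tcons_word theta_cons; apply: (hb_act_homog H) => //.
by rewrite /homog -[in RHS]vd.
Qed.

Lemma theta_gpr n (t : tensalg_vectp V) :
  theta_fun (gpr n t) = gpr n (theta_fun t).
Proof.
rewrite -[gpr n t]/(tagr n t).
move: t; apply: hspan_ext => [||d w hw].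
- exact: lin_compose theta_linear (@tagr_linear _ _ _).
- exact: lin_compose (@gpr_linear _ _ _) theta_linear.
rewrite (tagr_hword n hw) (homog_gpr _ (theta_hword hw)).
by case: ifP => // _; apply: lin0 theta_linear.
Qed.

Definition theta : vphom (tensalg_vectp V) B :=
  @VPHom K (tensalg_vectp V) B
    (@GHom K (tensalg_vectp V) B theta_fun theta_linear theta_gpr) theta_nil.

(** E θ = id by induction on words: in E(p ▷ y), [proj_act] turns e(p ▷ y_1) into ε(y_1) p, and the
    left counit of [C] leaves p E(y). θ E = id by induction on the degree: θ carries the equation of
    [E] to [proj_split]. *)
Lemma theta_bij : bijective theta.
Proof.
have [e [eL eE]] := projector_exists.
have eP x : sgmem P (e x) by apply/PE; split;
  [exact: proj_kereps eE x|exact: proj_half eL eE x].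
pose e' x : V := sgmk (eP x).
have e'L : linear e' by move=> a x y; apply: sgval_inj; exact: eL.
have thL := theta_linear.
have tcB := @tcons_bilin K V.
have veL : linear (fun x : B => veps x *: (word [::] : tensalg V)) by lin.
pose Phi (f : B -> tensalg V) x := 
  veps x *: word [::] + tsum (D x) (fun a b => tcons (e' a) (f b)).
have [E [EL EE]] : exists E, linear E /\ E =1 Phi E.
  apply: graded_rec => [f fL|n f g x fL gL fg xn]; first by rewrite /Phi; lin.
  rewrite /Phi; congr (_ + _); apply: (@tgr_agree _ _ _ _ n); try by lin.
    (* For [a] in degree 0 the letter [e' a] vanishes, so [E] is only called in degrees below n. *)
    case=> [|p] a b pn ap bp; last first.
      by rewrite (fg (n - p.+1)%N) // ltn_subrL (leq_trans _ pn).
    suff -> : e' a = 0 by rewrite !(lin0 (tcB.1 _)).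
    apply: sgval_inj => /=; rewrite (eposK a) epos_homog0 // add0r (linZ eL).
    by rewrite (proj_vone eL eE) scaler0.
  exact: tgr_homog (hb_half_gpr H) xn.
exists E.
  apply: tcons_ext; [exact: lin_compose EL thL|exact: lin_id| |].
    rewrite /= theta_nil EE /Phi veps_one scale1r (hb_half1 H).
    by rewrite (lin0 (tsum_linear _)) ?addr0 //; lin.
  move=> v t /= ih; have [v0 Dv] := (PE _).1 (sgvalP v).
  rewrite theta_cons EE /Phi eps_act // scale0r add0r (hb_half_act H) //.
  rewrite (lin_tsumE (h := fun t => tsum t _)); [|by lin|by lin].
  transitivity (tcons v (E (tsum (C (theta_fun t)) (fun a b => veps a *: b))));
    last by rewrite (hb_cop_epsl H) ih.
  rewrite (lin_tsumE (h := fun y => tcons v (E y))); [|by lin|by lin].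
  apply: tsum_eq => a b; rewrite tsum_pure; last by lin.
  have -> : e' (act (sgval v) a) = veps a *: v.
    by apply: sgval_inj; rewrite /= (proj_act eL eE).
  by rewrite (linZ EL) (linZ (tcB.1 _)) (linZ (tcB.2 _)).
apply: homog_ext => [||n]; [exact: lin_compose thL EL|exact: lin_id|].
elim/ltn_ind: n => n ih x xn /=.
rewrite EE /Phi (linD thL) (linZ thL) theta_nil [RHS]eposK addrC.
congr (_ + _); rewrite (proj_split eL eE x).
rewrite (lin_tsumE thL); last by lin.
have thcB : bilin (fun a b => theta_fun (tcons (e' a) (E b))) by lin.
apply: (@tgr_agree _ _ _ _ n); [by lin|by lin| |]; last first.
  exact: tgr_homog (hb_half_gpr H) xn.
case=> [|p] a b pn ap bp; rewrite theta_cons /=; last first.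
  by congr act; apply: ih bp; rewrite ltn_subrL (leq_trans _ pn).
suff -> : e a = 0 by rewrite !act0l.
rewrite (eposK a) epos_homog0 // add0r (linZ eL).
by rewrite (proj_vone eL eE) scaler0.
Qed.

End HalfBialgebra.

(** * The three structures on the tensor algebra *)

Section TensorGrading.
Variable K : fieldType.

(** Every projection [tgr m] is prescribed, the vanishing ones included. This is the shape needed to
    commute a coproduct with all [tgr m]; [tgr n t = t] alone would leave the orthogonality of the
    projections to be proved. *)
Definition thomog (U V : graded K) n (t : tens U V) := 
  forall m, tgr m t = if m == n then t else 0.

Lemma thomog_pure (U V : graded K) p q n (u : U) (v : V) :
  homog p u -> homog q v -> n = (p + q)%N -> thomog n (u ⊗ v).
Proof.
move=> up vq -> m; rewrite tgr_pure.
case: (ltnP m p) => mp.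
  rewrite ltn_eqF ?(leq_trans mp) ?leq_addr // big1 // => i _.
  rewrite (homog_gpr _ up) ltn_eqF ?(lin0 ((tpure_bilin _ _).1 _)) //.
  exact: leq_trans (ltn_ord i) mp.
rewrite (bigD1 (Ordinal (mp : p < m.+1)%N)) //= big1 ?addr0 => [|i /negPf ip].
  rewrite up (homog_gpr _ vq) -{2}(subnKC mp) eqn_add2l; case: ifP => // _.
  exact: lin0 ((tpure_bilin _ _).2 _).
rewrite (homog_gpr _ up) -[_ == p]/(i == Ordinal (mp : p < m.+1)%N) ip.
exact: lin0 ((tpure_bilin _ _).1 _).
Qed.

Lemma thomog0 (U V : graded K) n : thomog n (0 : tens U V).
Proof. by move=> m; rewrite (lin0 (tgr_linear m)) if_same. Qed.

Lemma thomogD (U V : graded K) n (s t : tens U V) :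
  thomog n s -> thomog n t -> thomog n (s + t).
Proof.
by move=> hs ht m; rewrite (linD (tgr_linear m)) hs ht; case: ifP; rewrite ?addr0.
Qed.

Lemma thomog_ind (U V : graded K) n (Q : tens U V -> Prop) :
  Q 0 -> (forall s t, Q s -> Q t -> Q (s + t)) ->
  (forall p q u v, homog p u -> homog q v -> n = (p + q)%N -> Q (u ⊗ v)) ->
  forall t, thomog n t -> Q t.
Proof.
move=> Q0 QD Qp t /(_ n); rewrite eqxx => <-.
move: t; apply: tens_ind => [|u v t ih]; first by rewrite (lin0 (tgr_linear n)).
rewrite (linD (tgr_linear n)); apply: (QD) => //.
rewrite tgr_pure; elim/big_ind: _ => [||i _]; [exact: Q0|exact: QD|].
apply: Qp; [exact: gpr_homog|exact: gpr_homog|].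
by rewrite subnKC // -ltnS.
Qed.

Lemma thomog_tmap (U V U' V' : graded K) d d' n (f : U -> U') (g : V -> V') t :
  linear f -> linear g -> (forall p u, homog p u -> homog (d + p) (f u)) ->
  (forall p u, homog p u -> homog (d' + p) (g u)) ->
  thomog n t -> thomog (d + d' + n) (tmap f g t).
Proof.
move=> fL gL fd gd; have L := tmap_linear fL gL.
move: t; apply: thomog_ind => [|s t|p q u v up vq ->].
- by rewrite (lin0 L); apply: thomog0.
- by rewrite (linD L); apply: thomogD.
rewrite tmap_pure //; apply: thomog_pure (fd _ _ up) (gd _ _ vq) _.
by rewrite addnACA.
Qed.

Lemma homog_tagr_ind (V : vect K) n (Q : tensalg_vectp V -> Prop) : Q 0 ->
  (forall a w u, hword n w -> Q u -> Q (a *: (word w : tensalg V) + u)) ->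
  forall t, homog n t -> Q t.
Proof.
move=> Q0 QD t <-; elim: (hspan_all t) => [|a m w u hw _ ih].
  by rewrite [gpr n _](lin0 (tagr_linear n)).
rewrite [gpr n _](tagr_linear n) (tagr_hword n hw); case: eqP => [e|_].
  by apply: QD => //; rewrite e.
by rewrite scaler0 add0r.
Qed.

Lemma homog_bilin (V : vect K) (m : tensalg_vectp V -> tensalg_vectp V ->
    tensalg_vectp V) :
  bilin m ->
  (forall d w n x, hword d w -> hword n x ->
     homog (d + n) (m (word w) (word x))) ->
  forall p q x y, homog p x -> homog q y -> homog (p + q) (m x y).
Proof.
move=> mB mH p q x y xp yq; move: x xp.
apply: homog_tagr_ind => [|a w u hw hu].
  by rewrite (lin0 (mB.1 _)); apply: homog0.
rewrite mB.1; apply: homog_lin => //; move: y yq {hu}.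
apply: homog_tagr_ind => [|b x y hx hy].
  by rewrite (lin0 (mB.2 _)); apply: homog0.
by rewrite mB.2; apply: homog_lin => //; apply: mH.
Qed.

Lemma tgr_hwords (V : vect K) (D : tensalg_vectp V -> 
    tens (tensalg_vectp V) (tensalg_vectp V)) : linear D ->
  (forall d w, hword d w -> thomog d (D (word w))) ->
  forall n x, D (gpr n x) = tgr n (D x).
Proof.
move=> DL Dh n x; rewrite -[gpr n x]/(tagr n x).
move: x; apply: hspan_ext => [||d w hw].
- exact: lin_compose DL (@tagr_linear _ _ _).
- exact: lin_compose (@tgr_linear _ _ _ _) DL.
by rewrite (tagr_hword n hw) (Dh d) //; case: ifP => // _; apply: lin0 DL.
Qed.

End TensorGrading.

(** * Concatenation, shuffle and half-shuffle on T(V) *)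

Section FreeObject.
Variables (K : fieldType) (V : vect K).
Local Notation T := (tensalg_vectp V).
Local Notation TT := (tens T T).
Local Notation one := (@vone K T).
Local Notation tc := (@tcons K V : V -> T -> T).

Lemma tc_bilin : bilin tc.
Proof. exact: tcons_bilin. Qed.

Lemma T_ext (W : lmodType K) (f g : T -> W) :
  linear f -> linear g -> f one = g one ->
  (forall v t, f t = g t -> f (tc v t) = g (tc v t)) -> f =1 g.
Proof. exact: tcons_ext. Qed.

Lemma eps_word w : veps (word w : T) = (w == [::])%:R.
Proof. exact: taeps_word. Qed.

Lemma eps_tc v t : veps (tc v t) = 0.
Proof.
move: t; apply: pres_ind => [|a w u ih].
  by rewrite (lin0 (tconsr v)) veps0.
rewrite tconsr vepsD vepsZ ih addr0 -[pgen w]/(word w) tcons_word eps_word.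
by rewrite mulr0.
Qed.

Lemma epos_tc v t : epos (tc v t) = tc v t.
Proof. exact/epos_id/eps_tc. Qed.

(** The [tc v t] span Ker ε. Composing with [epos] makes both maps vanish at 1, so that they can be
    compared on all of T(V). *)
Lemma ker_ext (W : lmodType K) (f g : T -> W) x : linear f -> linear g ->
  (forall v t, f (tc v t) = g (tc v t)) -> kereps x -> f x = g x.
Proof.
move=> fL gL fg /epos_id <-; move: x; apply: T_ext => [|||v t _].
- exact: lin_compose fL (@epos_linear _ _).
- exact: lin_compose gL (@epos_linear _ _).
- by rewrite epos_homog0 ?(lin0 fL) ?(lin0 gL) //; apply: homog_vone.
- by rewrite epos_tc fg.
Qed.

(** Case analysis on the first letter: the identification of Ker ε with V ⊗ T(V), extended by 0 at
    1. Contrary to [tfold], the tail is handed over as it is. *)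
Definition tlead (W : lmodType K) (g : V -> T -> W) (t : T) : W :=
  plift (fun w : seq V => if w is v :: w' then g v (word w') else 0) t.

Section Lead.
Variables (W : lmodType K) (g : V -> T -> W).
Hypothesis gB : bilin g.

Lemma tlead_multilin :
  multilin (fun w : seq V => if w is v :: w' then g v (word w') else 0).
Proof.
by case=> [|x s] a u v t /=; [rewrite gB.1|rewrite word_multilin gB.2].
Qed.

Lemma tlead_linear : linear (tlead g).
Proof. exact/plift_linear/word_compat/tlead_multilin. Qed.

Lemma tlead_one : tlead g one = 0.
Proof. by rewrite /tlead plift_gen //; apply/word_compat/tlead_multilin. Qed.

Lemma tlead_tc v t : tlead g (tc v t) = g v t.
Proof.
move: t; apply: tensalg_ext => [||w]; [|exact: gB.2|].
  by apply: lin_compose tlead_linear (tconsr v).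
rewrite tcons_word /tlead plift_gen //.
exact/word_compat/tlead_multilin.
Qed.
End Lead.

Definition consl (v : V) (x : TT) : TT := tmap (tc v) id x.
Definition consr (v : V) (x : TT) : TT := tmap id (tc v) x.

Lemma tc_linear v : linear (tc v). Proof. exact: tconsr. Qed.
Lemma idT_linear : linear (@id T). Proof. exact: lin_id. Qed.
Hint Resolve tc_linear idT_linear : core.

Lemma consl_pure v a b : consl v (a ⊗ b) = tc v a ⊗ b.
Proof. exact: tmap_pure. Qed.

Lemma consr_pure v a b : consr v (a ⊗ b) = a ⊗ tc v b.
Proof. exact: tmap_pure. Qed.

Lemma consl_bilin : bilin consl.
Proof.
have B := tc_bilin.
by rewrite /consl /tmap; split=> [x|v]; lin.
Qed.

Lemma consr_bilin : bilin consr.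
Proof.
have B := tc_bilin.
by rewrite /consr /tmap; split=> [x|v]; lin.
Qed.

Section Half.
Variable C : T -> TT.
Hypothesis CL : linear C.

(** The half coproduct of a free object: the first letter stays on the left and [C] splits the tail.
    It serves for deconcatenation and for the unshuffle coproduct alike. *)
Definition half : T -> TT := tlead (fun v t => consl v (C t)).

Lemma half_bilin : bilin (fun v t => consl v (C t)).
Proof.
by split=> [t|v]; [exact: consl_bilin.1|exact: lin_compose (consl_bilin.2 v) CL].
Qed.

Lemma half_linear : linear half. Proof. exact: tlead_linear half_bilin. Qed.
Lemma half_one : half one = 0. Proof. exact: tlead_one half_bilin. Qed.
Lemma half_tc v t : half (tc v t) = consl v (C t).
Proof. exact: tlead_tc half_bilin _ _. Qed.
End Half.

Definition conc (s t : T) : T := tfold t (@tcons K V) s.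

Lemma conc_one t : conc one t = t.
Proof. exact: tfold_nil (@tcons_bilin _ _). Qed.

Lemma conc_tc v s t : conc (tc v s) t = tc v (conc s t).
Proof. exact: tfold_cons (@tcons_bilin _ _) _ _. Qed.

Lemma conc_bilin : bilin conc.
Proof.
have L t : linear (conc^~ t) by exact: tfold_linear (@tcons_bilin _ _).
split=> // s a t u; move: s; apply: T_ext => [|||v s ih].
- exact: L.
- by lin.
- by rewrite !conc_one.
- by rewrite !conc_tc ih tconsr.
Qed.

Lemma concA x y z : conc x (conc y z) = conc (conc x y) z.
Proof.
have B := conc_bilin.
move: x; apply: T_ext => [|||v x ih]; [by lin|by lin| |].
  by rewrite !conc_one.
by rewrite !conc_tc ih.
Qed.

Lemma concx1 x : conc x one = x.
Proof.
have B := conc_bilin.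
move: x; apply: T_ext => [|||v x ih]; [by lin|by lin| |].
  by rewrite !conc_one.
by rewrite !conc_tc ih.
Qed.

Lemma word_nil : (word [::] : T) = one.
Proof. by []. Qed.

Lemma word_tc v w : (word (v :: w) : T) = tc v (word w).
Proof. by rewrite tcons_word. Qed.

Lemma homog_tc d n v (t : T) : homog d v -> homog n t -> homog (d + n) (tc v t).
Proof. exact: homog_tcons. Qed.

Lemma homog_word d w : hword d w -> homog d (word w : T).
Proof. by move=> hw; rewrite /homog [LHS](tagr_hword d hw) eqxx. Qed.

Lemma conc_homog p q x y : homog p x -> homog q y -> homog (p + q) (conc x y).
Proof.
apply: homog_bilin conc_bilin _ _ _ _ _ => {x y p q} d w n x hw hx.
elim: hw => {d w} [|d v m w vd hw ih].
  by rewrite [word [::]]/(one) conc_one; apply: homog_word.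
by rewrite word_tc conc_tc -addnA; apply: homog_tc.
Qed.

Lemma conc_product : is_product conc.
Proof.
split; [exact: conc_bilin|exact: conc_homog|exact: concA|exact: conc_one|].
exact: concx1.
Qed.

(** The shuffle of two words. Each recursive call removes the first letter of one of them; the inner
    [fix] serves the calls that keep the first word and shorten the second. *)
Fixpoint wsh (w : seq V) : seq V -> T :=
  if w is v :: w' then
    fix aux x := if x is u :: x' then tc v (wsh w' x) + tc u (aux x')
                 else word w
  else @word K V.

Lemma wsh_nil w : wsh w [::] = word w. Proof. by case: w. Qed.

Lemma wsh_cons v w u x :
  wsh (v :: w) (u :: x) = tc v (wsh w (u :: x)) + tc u (wsh (v :: w) x).
Proof. by []. Qed.

Lemma wshC w x : wsh w x = wsh x w.
Proof.
elim: w x => [|v w ihw] x; first by rewrite wsh_nil.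
elim: x => [|u x ihx] //.
by rewrite !wsh_cons ihx ihw addrC.
Qed.

Lemma wsh_multilinr w : multilin (wsh w).
Proof.
elim: w => [|v w ihw]; first exact: word_multilin.
move=> s a u u' t; elim: s => [|x s ih].
  rewrite !wsh_cons (ihw [::] a u u' t) tconsr (tconsl _ a u u') scalerDr.
  by rewrite !addrA; congr (_ + _); rewrite addrAC.
rewrite !wsh_cons ih (ihw (x :: s)) !tconsr scalerDr.
by rewrite !addrA; congr (_ + _); rewrite addrAC.
Qed.

Lemma wsh_multilinl x : multilin (wsh^~ x).
Proof. by move=> s a u v t; rewrite !(wshC _ x) wsh_multilinr. Qed.

Definition sh (s t : T) : T := plift (fun w => plift (wsh w) t) s.

Lemma sh_bilin : bilin sh.
Proof.
have L w : linear (fun t : T => plift (wsh w) t).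
  exact: plift_linear (word_compat (@wsh_multilinr w)).
have M (t : T) : multilin (fun w => plift (wsh w) t : T).
  move=> s a u v x; move: t; apply: tensalg_ext => [||w]; [exact: L| |].
    by apply: lin_add; [apply: lin_scale|]; apply: L.
  by rewrite !plift_gen; try (exact/word_compat/wsh_multilinr);
    apply: wsh_multilinl.
split=> [t|s]; first exact: plift_linear (word_compat (M t)).
move=> a t u; move: s; apply: tensalg_ext => [||w].
- exact: plift_linear (word_compat (M _)).
- apply: lin_add; [apply: lin_scale|];
    exact: plift_linear (word_compat (M _)).
- rewrite /sh !plift_gen; try exact: word_compat (M _); exact: L.
Qed.

Lemma sh_word w x : sh (word w) (word x) = wsh w x.
Proof.
rewrite /sh plift_gen; first by rewrite plift_gen //; exact/word_compat/wsh_multilinr.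
move=> s t h; apply: word_compat h => {s t} s a u v t.
by rewrite !plift_gen; try (exact/word_compat/wsh_multilinr);
  apply: wsh_multilinl.
Qed.

Lemma T_ext2 (W : lmodType K) (f g : T -> T -> W) : bilin f -> bilin g ->
  (forall w x, f (word w) (word x) = g (word w) (word x)) ->
  forall s t, f s t = g s t.
Proof.
move=> fB gB fg s t; move: s; apply: tensalg_ext => [||w].
- exact: fB.1.
- exact: gB.1.
- by move: t; apply: tensalg_ext => [||x]; [exact: fB.2|exact: gB.2|].
Qed.

Lemma shC s t : sh s t = sh t s.
Proof.
have B := sh_bilin.
by apply: (T_ext2 (g := fun s t => sh t s)) => [||w x];
  [lin|lin|rewrite !sh_word wshC].
Qed.

Lemma sh1x t : sh one t = t.
Proof.
have B := sh_bilin.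
by move: t; apply: tensalg_ext => [||w]; [lin|lin|rewrite sh_word].
Qed.

Lemma shx1 t : sh t one = t.
Proof. by rewrite shC sh1x. Qed.

Lemma sh_tc v s u t :
  sh (tc v s) (tc u t) = tc v (sh s (tc u t)) + tc u (sh (tc v s) t).
Proof.
have B := sh_bilin; have tB := tc_bilin.
move: s t; apply: T_ext2 => [||w x]; [by lin|by lin|].
by rewrite -!word_tc !sh_word.
Qed.

Definition prec (s t : T) : T := tlead (fun v s' => tc v (sh s' t)) s.

Lemma prec_lead_bilin t : bilin (fun v s' => tc v (sh s' t)).
Proof. by have B := sh_bilin; have tB := tc_bilin; lin. Qed.

Lemma prec1x t : prec one t = 0.
Proof. exact: tlead_one (prec_lead_bilin t). Qed.

Lemma prec_tc v s t : prec (tc v s) t = tc v (sh s t).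
Proof. exact: tlead_tc (prec_lead_bilin t) _ _. Qed.

Lemma prec_bilin : bilin prec.
Proof.
have L t : linear (prec^~ t) by exact: tlead_linear (prec_lead_bilin t).
split=> // s a t u; move: s; apply: T_ext => [|||v s _].
- exact: L.
- by lin.
- by rewrite !prec1x scaler0 addr0.
- by rewrite !prec_tc sh_bilin.2 tconsr.
Qed.

Lemma precx1 x : kereps x -> prec x one = x.
Proof.
have B := prec_bilin.
apply: (@ker_ext _ (prec^~ one) id) => [||v t]; [by lin|by lin|].
by rewrite prec_tc shx1.
Qed.

Lemma sh_split x y : kereps x -> kereps y -> sh x y = prec x y + prec y x.
Proof.
have B := prec_bilin; have B' := sh_bilin; have tB := tc_bilin.
move=> x0 y0.
apply: (@ker_ext _ (sh^~ y) (fun x => prec x y + prec y x)) x0 => [||v s].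
- by lin.
- by lin.
apply: (@ker_ext _ (sh _) (fun y => prec _ y + prec y _)) y0 => [||u t].
- by lin.
- by lin.
by rewrite sh_tc !prec_tc (shC _ t).
Qed.

(** Sort both sides by first letter. The terms beginning with [a] or [b] match by the induction on
    the first or the second word. On the left those beginning with [c] come in a pair, which is the
    expansion of [c] followed by the triple shuffle with the shorter third word, where [ihz]
    applies. *)
Lemma shA x y z : sh (sh x y) z = sh x (sh y z).
Proof.
have B := sh_bilin; have tB := tc_bilin.
move: x; apply: tensalg_ext => [||wx]; [by lin|by lin|].
move: y z; apply: T_ext2 => [||wy wz]; [by lin|by lin|].
elim: wx wy wz => [|a x ihx] wy wz; first by rewrite !sh1x.
elim: wy wz => [|b y ihy] wz; first by rewrite !(shx1, sh1x).
elim: wz => [|c z ihz]; first by rewrite !shx1.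
have ax := ihx (b :: y) (c :: z); have bx := ihy (c :: z).
rewrite !word_tc in ihz ax bx *; rewrite (sh_tc b) (linD (B.2 _)) in ax.
rewrite (sh_tc a _ b) (sh_tc b _ c) (linD (B.1 _)) (linD (B.2 _)).
rewrite !(sh_tc _ (sh _ _)) !(sh_tc _ _ _ (sh _ _)) ax bx -ihz (sh_tc a _ b).
rewrite (linD (B.1 _)) !(linD (tconsr _)) !addrA.
by rewrite [LHS](+%R.[ACl 1*4*2*3*5]).
Qed.

End FreeObject.

Lemma tmul_bilin (K : fieldType) (U V : lmodType K) (m : U -> U -> U)
    (m' : V -> V -> V) : bilin m -> bilin m' -> bilin (tmul m m').
Proof. by move=> mB mB'; rewrite /tmul; split=> [t|s]; lin. Qed.

Lemma tmul_pure (K : fieldType) (U V : lmodType K) (m : U -> U -> U)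
    (m' : V -> V -> V) a b c d : bilin m -> bilin m' ->
  tmul m m' (a ⊗ b) (c ⊗ d) = m a c ⊗ m' b d.
Proof. by move=> mB mB'; rewrite /tmul tsum_pure ?tsum_pure //; lin. Qed.

Lemma tens_ext2 (K : fieldType) (U V U' V' W : lmodType K)
    (f g : tens U V -> tens U' V' -> W) : bilin f -> bilin g ->
  (forall a b c d, f (a ⊗ b) (c ⊗ d) = g (a ⊗ b) (c ⊗ d)) ->
  forall s t, f s t = g s t.
Proof.
move=> fB gB fg s t; move: s; apply: tens_ext => [||a b].
- exact: fB.1.
- exact: gB.1.
- by move: t; apply: tens_ext => [||c d]; [exact: fB.2|exact: gB.2|].
Qed.

Lemma tswap_linear (K : fieldType) (U V : lmodType K) :
  linear (@tswap K U V).
Proof. by rewrite /tswap; lin. Qed.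

Lemma tswap_pure (K : fieldType) (U V : lmodType K) (u : U) (v : V) :
  tswap (u ⊗ v) = v ⊗ u.
Proof. by rewrite /tswap tsum_pure //; lin. Qed.

Lemma tswapK (K : fieldType) (U V : lmodType K) (t : tens U V) :
  tswap (tswap t) = t.
Proof.
have L := @tswap_linear K; move: t; apply: tens_ext => [||u v].
- exact: lin_compose (L _ _) (L _ _).
- exact: lin_id.
- by rewrite !tswap_pure.
Qed.

Lemma tassoc_pure (K : fieldType) (U V W : lmodType K) (u : U) (v : V) (w : W) :
  tassoc ((u ⊗ v) ⊗ w) = u ⊗ (v ⊗ w).
Proof.
rewrite /tassoc tsum_pure; last by lin.
by rewrite tsum_pure //; lin.
Qed.

Section Counits.
Variables (K : fieldType) (B : vectp K).
Local Notation TT := (tens B B).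

Definition epsl (x : TT) : B := tsum x (fun a b => veps a *: b).
Definition epsr (x : TT) : B := tsum x (fun a b => veps b *: a).

Lemma epsl_linear : linear epsl. Proof. by rewrite /epsl; lin. Qed.
Lemma epsr_linear : linear epsr. Proof. by rewrite /epsr; lin. Qed.
Lemma epsl_pure a b : epsl (a ⊗ b) = veps a *: b.
Proof. by rewrite /epsl tsum_pure //; lin. Qed.
Lemma epsr_pure a b : epsr (a ⊗ b) = veps b *: a.
Proof. by rewrite /epsr tsum_pure //; lin. Qed.
End Counits.

Ltac lin_leaf ::=
  lazymatch goal with
  | |- GRing.linear_for _ (@tassoc _ _ _ _) => exact: tassoc_linear
  | |- GRing.linear_for _ (@tswap _ _ _) => exact: tswap_linear
  | |- GRing.linear_for _ (consl _) => exact: (consl_bilin _).2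
  | |- GRing.linear_for _ (consr _) => exact: (consr_bilin _).2
  | |- GRing.linear_for _ (conc _) => exact: (conc_bilin _).2
  | |- GRing.linear_for _ (sh _) => exact: (sh_bilin _).2
  | |- GRing.linear_for _ (prec _) => exact: (prec_bilin _).2
  | |- GRing.linear_for _ (tmul _ _ _) => apply: (tmul_bilin _ _).2; lin
  | |- GRing.linear_for _ (@epsl _ _) => exact: epsl_linear
  | |- GRing.linear_for _ (@epsr _ _) => exact: epsr_linear
  | |- bilin (@consl _ _) => exact: consl_bilin
  | |- bilin (@consr _ _) => exact: consr_bilin
  | |- bilin (@conc _ _) => exact: conc_bilin
  | |- bilin (@sh _ _) => exact: sh_bilin
  | |- bilin (@prec _ _) => exact: prec_bilin
  | |- bilin (tmul _ _) => apply: tmul_bilin; lin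
  | |- _ => lin_leaf_epos
  end.

(** * Deconcatenation and the unshuffle coproduct on T(V) *)

Section FreeCoproducts.
Variables (K : fieldType) (V : vect K).
Local Notation T := (tensalg_vectp V).
Local Notation TT := (tens T T).
Local Notation one := (@vone K T).
Local Notation tc := (@tcons K V : V -> T -> T).

Lemma consl_linear v : linear (@consl K V v).
Proof. exact: (consl_bilin V).2. Qed.
Lemma consr_linear v : linear (@consr K V v).
Proof. exact: (consr_bilin V).2. Qed.
Hint Resolve tc_linear idT_linear consl_linear consr_linear : core.

(** This is not a [tfold]: the term with empty left leg needs the word itself, and not just the
    image of its tail. *)
Fixpoint wdec (w : seq V) : TT :=
  if w is v :: w' then one ⊗ (word w : T) + consl v (wdec w') else one ⊗ one.

Lemma wdec_multilin : multilin wdec.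
Proof.
move=> s a u v t; elim: s => [|x s ih] /=.
  rewrite (consl_bilin V).1 (word_multilin [::] a u v t).
  by rewrite (tpure_bilin _ _).2 scalerDr addrACA.
rewrite ih (word_multilin (x :: s) a u v t) consl_linear.
by rewrite (tpure_bilin _ _).2 scalerDr addrACA.
Qed.

Definition deconc (t : T) : TT := plift wdec t.

Lemma deconc_linear : linear deconc.
Proof. exact/plift_linear/word_compat/wdec_multilin. Qed.

Lemma deconc_word w : deconc (word w) = wdec w.
Proof. by rewrite /deconc plift_gen //; exact/word_compat/wdec_multilin. Qed.

Lemma deconc_one : deconc one = one ⊗ one.
Proof. exact: deconc_word [::]. Qed.

Lemma deconc_tc v t : deconc (tc v t) = one ⊗ tc v t + consl v (deconc t).
Proof.
have dL := deconc_linear.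
move: t; apply: tensalg_ext => [||w]; [by lin|by lin|].
by rewrite -word_tc !deconc_word.
Qed.

Lemma deconc_half t : deconc t = one ⊗ t + half deconc t.
Proof.
have dL := deconc_linear; have hL := half_linear dL.
move: t; apply: T_ext => [|||v t _]; [by lin|by lin| |].
  by rewrite deconc_one half_one // addr0.
by rewrite deconc_tc half_tc.
Qed.

(** The step is left multiplication by v ⊗ 1 + 1 ⊗ v, so this is the coproduct that is
    multiplicative for concatenation and for which letters are primitive. *)
Definition unsh (t : T) : TT := 
  tfold (one ⊗ one : TT) (fun v d => consl v d + consr v d) t.

Lemma unsh_step_bilin : bilin (fun v (d : TT) => consl v d + consr v d).
Proof. by lin. Qed.

Lemma unsh_linear : linear unsh.
Proof. exact: tfold_linear unsh_step_bilin. Qed.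

Lemma unsh_one : unsh one = one ⊗ one.
Proof. exact: tfold_nil unsh_step_bilin. Qed.

Lemma unsh_tc v t : unsh (tc v t) = consl v (unsh t) + consr v (unsh t).
Proof. exact: tfold_cons unsh_step_bilin _ _. Qed.

Lemma tswap_consl v (x : TT) : tswap (consl v x) = consr v (tswap x).
Proof.
move: x; apply: tens_ext => [||a b]; [by lin|by lin|].
by rewrite consl_pure !tswap_pure consr_pure.
Qed.

Lemma tswap_consr v (x : TT) : tswap (consr v x) = consl v (tswap x).
Proof. by rewrite -[x in LHS]tswapK -tswap_consl tswapK. Qed.

Lemma unshC x : tswap (unsh x) = unsh x.
Proof.
have dL := unsh_linear.
move: x; apply: T_ext => [|||v t ih]; [by lin|by lin| |].
  by rewrite unsh_one tswap_pure.
rewrite unsh_tc (linD (@tswap_linear _ _ _)) tswap_consl tswap_consr ih.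
by rewrite addrC.
Qed.

Definition consl3 v (x : tens T TT) : tens T TT := tmap (tc v) id x.

Lemma idTT_linear : linear (@id TT). Proof. exact: lin_id. Qed.
Hint Resolve idTT_linear : core.

Lemma consl3_linear v : linear (consl3 v).
Proof. exact: tmap_linear. Qed.

Lemma tmap_consl (W : lmodType K) (f : T -> W) v (x : TT) : linear f ->
  tmap id f (consl v x) = tmap (tc v) id (tmap id f x).
Proof.
move=> fL; have iL : linear (@id W) := @lin_id K W.
move: x; apply: tens_ext => [||a b]; [by lin|by lin|].
by rewrite consl_pure !tmap_pure.
Qed.

Lemma tassoc_consl v (s : TT) (b : T) :
  tassoc (consl v s ⊗ b) = consl3 v (tassoc (s ⊗ b)).
Proof.
have cL := @consl3_linear v.
move: s; apply: tens_ext => [||a a']; [by lin|by lin|].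
by rewrite consl_pure !tassoc_pure /consl3 tmap_pure.
Qed.

Lemma tassoc_consr v (s : TT) (b : T) :
  tassoc (consr v s ⊗ b) = tmap id (consl v) (tassoc (s ⊗ b)).
Proof.
have cL := @consl3_linear v.
move: s; apply: tens_ext => [||a a']; [by lin|by lin|].
by rewrite consr_pure !tassoc_pure tmap_pure // consl_pure.
Qed.

Lemma tassoc_tc v (s : TT) (b : T) :
  tassoc (s ⊗ tc v b) = tmap id (consr v) (tassoc (s ⊗ b)).
Proof.
have cL := @consl3_linear v.
move: s; apply: tens_ext => [||a a']; [by lin|by lin|].
by rewrite !tassoc_pure tmap_pure // consr_pure.
Qed.

Lemma deconcA x :
  tassoc (tmap deconc id (deconc x)) = tmap id deconc (deconc x).
Proof.
have dL := deconc_linear; have cL v := @consl3_linear v.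
have E v (X : TT) : tassoc (tmap deconc id (consl v X)) =
    one ⊗ consl v X + consl3 v (tassoc (tmap deconc id X)).
  move: X; apply: tens_ext => [||a b]; [by lin|by lin|].
  rewrite consl_pure !tmap_pure // deconc_tc (linD ((tpure_bilin _ _).1 _)).
  by rewrite (linD (@tassoc_linear _ _ _ _)) tassoc_pure tassoc_consl.
move: x; apply: T_ext => [|||v t ih]; [by lin|by lin| |].
  by rewrite deconc_one !tmap_pure // deconc_one tassoc_pure.
rewrite deconc_tc !(linD (tmap_linear _ _)) // (linD (@tassoc_linear _ _ _ _)).
rewrite E ih !tmap_pure // deconc_one tassoc_pure deconc_tc tmap_consl //.
by rewrite (linD ((tpure_bilin _ _).2 _)) addrA.
Qed.

Lemma tmap_consr (W : lmodType K) (f : T -> W) v (x : TT) : linear f ->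
  tmap id f (consr v x) = tmap id (fun t => f (tc v t)) x.
Proof.
move=> fL; move: x; apply: tens_ext => [||a b].
- by lin.
- by lin.
by rewrite consr_pure !tmap_pure //; lin.
Qed.

(** A new first letter can go to any of three legs, and each side puts it once in each of them. *)
Lemma unshA x : tassoc (tmap unsh id (unsh x)) = tmap id unsh (unsh x).
Proof.
have dL := unsh_linear; have cL v := @consl3_linear v.
have E v (X : TT) : tassoc (tmap unsh id (consl v X)) =
    consl3 v (tassoc (tmap unsh id X)) +
    tmap id (consl v) (tassoc (tmap unsh id X)).
  move: X; apply: tens_ext => [||a b]; [by lin|by lin|].
  rewrite consl_pure !tmap_pure // unsh_tc (linD ((tpure_bilin _ _).1 _)).
  by rewrite (linD (@tassoc_linear _ _ _ _)) tassoc_consl tassoc_consr.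
have E' v (X : TT) : tassoc (tmap unsh id (consr v X)) =
    tmap id (consr v) (tassoc (tmap unsh id X)).
  move: X; apply: tens_ext => [||a b]; [by lin|by lin|].
  by rewrite consr_pure !tmap_pure // tassoc_tc.
move: x; apply: T_ext => [|||v t ih]; [by lin|by lin| |].
  by rewrite unsh_one !tmap_pure // unsh_one tassoc_pure.
rewrite unsh_tc !(linD (tmap_linear _ _)) // (linD (@tassoc_linear _ _ _ _)).
rewrite E E' ih tmap_consl // tmap_consr // -addrA; congr (_ + _).
have F (X : TT) : tmap id (fun t => unsh (tc v t)) X =
    tmap id (consl v) (tmap id unsh X) + tmap id (consr v) (tmap id unsh X).
  move: X; apply: tens_ext => [||a b]; [by lin|by lin|].
  rewrite !tmap_pure //; last by lin.
  by rewrite unsh_tc (linD ((tpure_bilin _ _).2 _)).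
by rewrite F.
Qed.

Hint Resolve epsl_linear epsr_linear : core.

Lemma epsl_consl (v : V) x : epsl (consl v x) = 0.
Proof.
move: x; apply: tens_ext => [||a b]; [by lin|by lin|].
by rewrite consl_pure epsl_pure eps_tc scale0r.
Qed.

Lemma epsr_consr (v : V) x : epsr (consr v x) = 0.
Proof.
move: x; apply: tens_ext => [||a b]; [by lin|by lin|].
by rewrite consr_pure epsr_pure eps_tc scale0r.
Qed.

Lemma epsl_consr (v : V) x : epsl (consr v x) = tc v (epsl x).
Proof.
move: x; apply: tens_ext => [||a b]; [by lin|by lin|].
by rewrite consr_pure !epsl_pure (linZ (tc_linear v)).
Qed.

Lemma epsr_consl (v : V) x : epsr (consl v x) = tc v (epsr x).
Proof.
move: x; apply: tens_ext => [||a b]; [by lin|by lin|].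
by rewrite consl_pure !epsr_pure (linZ (tc_linear v)).
Qed.

Lemma deconc_epsl x : epsl (deconc x) = x.
Proof.
have dL := deconc_linear.
move: x; apply: T_ext => [|||v t ih]; [by lin|by lin| |].
  by rewrite deconc_one epsl_pure veps_one scale1r.
by rewrite deconc_tc (linD (@epsl_linear K T)) epsl_consl epsl_pure veps_one scale1r addr0.
Qed.

Lemma deconc_epsr x : epsr (deconc x) = x.
Proof.
have dL := deconc_linear.
move: x; apply: T_ext => [|||v t ih]; [by lin|by lin| |].
  by rewrite deconc_one epsr_pure veps_one scale1r.
by rewrite deconc_tc (linD (@epsr_linear K T)) epsr_consl ih epsr_pure eps_tc scale0r add0r.
Qed.

Lemma unsh_epsl x : epsl (unsh x) = x.
Proof.
have dL := unsh_linear.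
move: x; apply: T_ext => [|||v t ih]; [by lin|by lin| |].
  by rewrite unsh_one epsl_pure veps_one scale1r.
by rewrite unsh_tc (linD (@epsl_linear K T)) epsl_consl epsl_consr ih add0r.
Qed.

Lemma unsh_epsr x : epsr (unsh x) = x.
Proof.
have dL := unsh_linear.
move: x; apply: T_ext => [|||v t ih]; [by lin|by lin| |].
  by rewrite unsh_one epsr_pure veps_one scale1r.
by rewrite unsh_tc (linD (@epsr_linear K T)) epsr_consl epsr_consr ih addr0.
Qed.

Lemma thomog_consl d n v (x : TT) :
  homog d v -> thomog n x -> thomog (d + n) (consl v x).
Proof.
move=> vd; rewrite -[X in thomog (X + n)]addn0.
apply: (@thomog_tmap K T T T T d 0 n (tc v) id) => // p u.
exact: homog_tc.
Qed.

Lemma thomog_consr d n v (x : TT) :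
  homog d v -> thomog n x -> thomog (d + n) (consr v x).
Proof.
move=> vd; rewrite -[X in thomog (X + n)]add0n.
apply: (@thomog_tmap K T T T T 0 d n id (tc v)) => // p u.
exact: homog_tc.
Qed.

Lemma deconc_gpr n x : deconc (gpr n x) = tgr n (deconc x).
Proof.
apply: tgr_hwords deconc_linear _ n x => d w.
elim=> {d w} [|d v m w vd hw ih].
  by rewrite deconc_one; apply: thomog_pure (homog_vone _) (homog_vone _) _.
rewrite word_tc deconc_tc; apply: thomogD; last exact: thomog_consl.
apply: thomog_pure (homog_vone _) _ (erefl _).
by apply: homog_tc => //; apply: homog_word.
Qed.

Lemma unsh_gpr n x : unsh (gpr n x) = tgr n (unsh x).
Proof.
apply: tgr_hwords unsh_linear _ n x => d w.
elim=> {d w} [|d v m w vd hw ih].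
  by rewrite unsh_one; apply: thomog_pure (homog_vone _) (homog_vone _) _.
by rewrite word_tc unsh_tc; apply: thomogD;
  [apply: thomog_consl|apply: thomog_consr].
Qed.

Lemma deconc_coproduct : is_coproduct deconc.
Proof.
split; [exact: deconc_linear|exact: deconc_gpr|exact: deconcA| |].
  exact: deconc_epsl.
exact: deconc_epsr.
Qed.

Lemma unsh_coproduct : is_coproduct unsh.
Proof.
split; [exact: unsh_linear|exact: unsh_gpr|exact: unshA| |].
  exact: unsh_epsl.
exact: unsh_epsr.
Qed.

Section HalfCoproduct.
Variable C : T -> TT.
Hypothesis CP : is_coproduct C.
Let CL := cop_linear CP.

Lemma half_gpr n x : half C (gpr n x) = tgr n (half C x).
Proof.
apply: tgr_hwords (half_linear CL) _ n x => d w.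
case=> {d w} [|d v m w vd hw].
  by rewrite half_one //; apply: thomog0.
rewrite word_tc half_tc //; apply: thomog_consl => // k.
rewrite -(cop_gpr CP) [gpr k _](tagr_hword k hw).
by case: ifP => // _; apply: lin0.
Qed.

Lemma half_epsl x : epsl (half C x) = 0.
Proof.
have hL := half_linear CL.
move: x; apply: T_ext => [|||v t ih]; [by lin|by lin| |].
  by rewrite half_one // (lin0 (@epsl_linear K T)).
by rewrite half_tc // epsl_consl.
Qed.

Lemma half_epsr x : epsr (half C x) = epos x.
Proof.
have hL := half_linear CL.
move: x; apply: T_ext => [|||v t ih]; [by lin|by lin| |].
  by rewrite half_one // (lin0 (@epsr_linear K T)) epos_homog0 //; apply: homog_vone.
by rewrite half_tc // epsr_consl epos_tc [epsr _](cop_epsr CP).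
Qed.

(** On both sides the first letter stays in the leftmost leg, so this is the coassociativity of [C]
    on the tail. *)
Lemma halfA x : tassoc (tmap (half C) id (half C x)) = tmap id C (half C x).
Proof.
have hL := half_linear CL; have cL v := @consl3_linear v.
move: x; apply: T_ext => [|||v t ih]; [by lin|by lin| |].
  by rewrite half_one // !(lin0 (tmap_linear _ _)) // (lin0 (@tassoc_linear _ _ _ _)).
rewrite half_tc // tmap_consl // -(copA CP).
suff E (X : TT) : tassoc (tmap (half C) id (consl v X)) =
   consl3 v (tassoc (tmap C id X)) by rewrite E.
move: X; apply: tens_ext => [||a b]; [by lin|by lin|].
by rewrite consl_pure !tmap_pure // half_tc // tassoc_consl.
Qed.

(** The projection onto words of length one, with values in [V]. It is the projection e of the free
    object, in accordance with e(p ▷ y) = ε(y) p. *)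
Definition letter1 (t : T) : V := tlead (fun v t => veps t *: v) t.

Lemma letter1_bilin : bilin (fun (v : V) (t : T) => veps t *: v).
Proof. by lin. Qed.

Lemma letter1_linear : linear letter1.
Proof. exact: tlead_linear letter1_bilin. Qed.

Lemma letter1_tc v t : letter1 (tc v t) = veps t *: v.
Proof. exact: tlead_tc letter1_bilin _ _. Qed.

(* On primitive elements this reads [x = word [:: letter1 x]]. *)
Lemma half_split x : tsum (half C x) (fun a b => tc (letter1 a) b) = epos x.
Proof.
have hL := half_linear CL; have lL := letter1_linear.
pose G (X : TT) := tsum X (fun a b => tc (letter1 a) b).
have GL : linear G by rewrite /G; lin.
rewrite -/(G _); move: x; apply: T_ext => [|||v t ih]; [by lin|by lin| |].
  by rewrite half_one // (lin0 GL) epos_homog0 //; apply: homog_vone.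
rewrite half_tc // epos_tc.
suff E (X : TT) : G (consl v X) = tc v (epsl X).
  by rewrite E [epsl _](cop_epsl CP).
move: X; apply: tens_ext => [||a b]; [by lin|by lin|].
rewrite consl_pure /G tsum_pure; last by lin.
by rewrite letter1_tc epsl_pure (linZ (tconsl b)) (linZ (tconsr v)).
Qed.

End HalfCoproduct.

End FreeCoproducts.

(** * The free bialgebras of the three kinds *)

Section FreeStructures.
Variables (K : fieldType) (V : vect K).
Local Notation T := (tensalg_vectp V).
Local Notation TT := (tens T T).
Local Notation one := (@vone K T).
Local Notation tc := (@tcons K V : V -> T -> T).
Hint Resolve tc_linear idT_linear : core.

Section TensorProducts.
Variables m m0 m' m0' : T -> T -> T.
Hypotheses (mB : bilin m) (m0B : bilin m0) (mB' : bilin m') (m0B' : bilin m0').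

(** The product may change when the first letter is taken off: [prec (tc v a) c] is [tc v (sh a c)].
    For concatenation [m] and [m0] coincide. *)
Lemma tmul_consl v (X Y : TT) : (forall a c, m (tc v a) c = tc v (m0 a c)) ->
  tmul m m' (consl v X) Y = consl v (tmul m0 m' X Y).
Proof.
move=> mm0; move: X Y; apply: tens_ext2 => [||a b c d]; [by lin|by lin|].
by rewrite consl_pure !tmul_pure // consl_pure mm0.
Qed.

Lemma tmul_consr v (X Y : TT) : (forall a c, m' (tc v a) c = tc v (m0' a c)) ->
  tmul m m' (consr v X) Y = consr v (tmul m m0' X Y).
Proof.
move=> mm0; move: X Y; apply: tens_ext2 => [||a b c d]; [by lin|by lin|].
by rewrite consr_pure !tmul_pure // consr_pure mm0.
Qed.

Lemma tmul_one (Y : TT) : (forall x, m one x = x) -> (forall x, m' one x = x) ->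
  tmul m m' (one ⊗ one) Y = Y.
Proof.
move=> m1 m1'; move: Y; apply: tens_ext => [||c d].
- by lin.
- exact: lin_id.
- by rewrite tmul_pure // m1 m1'.
Qed.

End TensorProducts.

Let dL := @deconc_linear K V.
Let uL := @unsh_linear K V.

(** Induction on [x]: besides prefixing [v] to the left legs, a new first letter adds only 1 ⊗ v x
    y, which belongs to the second sum as its term with [x1] equal to 1. *)
Lemma deconc_conc (x y : T) : deconc (conc x y) =
  tsum (deconc y) (fun y1 y2 => conc x y1 ⊗ y2)
  + tsum (deconc x) (fun x1 x2 => x1 ⊗ conc x2 y) - x ⊗ y.
Proof.
move: x; apply: T_ext => [|||v x ih]; [by lin|by lin| |].
  rewrite conc_one deconc_one tsum_pure; last by lin.
  rewrite conc_one addrK -[LHS]tsum_id; apply: tsum_eq => a b.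
  by rewrite conc_one.
rewrite conc_tc deconc_tc ih deconc_tc (linD (tsum_linear _)); last by lin.
rewrite tsum_pure; last by lin.
rewrite conc_tc !addrA -scaleN1r !(linD (consl_linear v)).
rewrite (linZ (consl_linear v)) consl_pure scaleN1r !addrA.
congr (_ + _ - _); first rewrite [LHS]addrC; first congr (_ + _).
  rewrite (lin_tsumE (consl_linear v)); last by lin.
  by apply: tsum_eq => a b; rewrite consl_pure conc_tc.
rewrite /consl (tsum_tmap _ (tc_linear v) (@idT_linear K V)); last by lin.
rewrite -/(consl v _) (lin_tsumE (consl_linear v)); last by lin.
by apply: tsum_eq => a b; rewrite consl_pure.
Qed.

Definition free_infinitesimal : infinitesimal_bialgebra T :=
  InfinitesimalBialgebra (conc_product V) (deconc_coproduct V) deconc_conc.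

Lemma unsh_conc (x y : T) :
  unsh (conc x y) = tmul (@conc K V) (@conc K V) (unsh x) (unsh y).
Proof.
move: x; apply: T_ext => [|||v x ih]; [by lin|by lin| |].
  rewrite conc_one unsh_one tmul_one //; try exact: conc_bilin;
    exact: conc_one.
have cB := @conc_bilin K V.
rewrite conc_tc !unsh_tc (linD ((tmul_bilin _ _).1 _)) // ih.
by rewrite (tmul_consl cB cB) ?(tmul_consr cB cB cB) // => *; rewrite conc_tc.
Qed.

Lemma free_unsh_bialgebra : is_bialgebra (@conc K V) (@unsh K V).
Proof.
split; [exact: conc_product|exact: unsh_coproduct|exact: unsh_one|].
exact: unsh_conc.
Qed.

Definition lead_unsh : T -> TT := half (@unsh K V).

Lemma lead_unsh_linear : linear lead_unsh.
Proof. exact: half_linear uL. Qed.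

Lemma lead_unsh_conc (x y : T) : kereps x ->
  lead_unsh (conc x y) = tmul (@conc K V) (@conc K V) (lead_unsh x) (unsh y).
Proof.
have hL := lead_unsh_linear; have cB := @conc_bilin K V.
apply: (@ker_ext _ _ _ (fun x => lead_unsh (conc x y))
  (fun x => tmul _ _ (lead_unsh x) (unsh y))) => [||v s]; [by lin|by lin|].
rewrite conc_tc /lead_unsh !half_tc // unsh_conc (tmul_consl cB cB) // => *.
by rewrite conc_tc.
Qed.

Lemma unsh_split (x : T) : kereps x ->
  unsh x = lead_unsh x + tswap (lead_unsh x).
Proof.
have hL := lead_unsh_linear.
apply: (@ker_ext _ _ _ (@unsh K V) 
  (fun x => lead_unsh x + tswap (lead_unsh x))) => [||v t]; [by lin|by lin|].
by rewrite /lead_unsh half_tc // unsh_tc tswap_consl unshC.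
Qed.

Definition free_unshuffle : unshuffle_bialgebra T.
Proof.
apply: (@UnshuffleBialgebra K T (@conc K V) (@unsh K V) lead_unsh
         (fun x => tswap (lead_unsh x))).
- exact: free_unsh_bialgebra.
- exact: unshC.
- exact: lead_unsh_linear.
- exact: lin_compose (@tswap_linear _ _ _) lead_unsh_linear.
- exact: half_gpr (unsh_coproduct V).
- exact: half_one.
- by rewrite /lead_unsh half_one // (lin0 (@tswap_linear _ _ _)).
- exact: unsh_split.
- by move=> x _; rewrite tswapK.
- by move=> x _; apply: halfA (unsh_coproduct V) x.
- by move=> x _; exact: (half_epsl (unsh_coproduct V) x).
- by move=> x x0; rewrite [LHS](half_epsr (unsh_coproduct V)) epos_id.
- by move=> x y x0 _; apply: lead_unsh_conc.
Defined.

Local Notation sh := (@sh K V).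
Local Notation prec := (@prec K V).

Let shB := @sh_bilin K V.

Lemma tmul_consl_one v u (X : TT) t :
  tmul sh sh (consl v X) (one ⊗ tc u t) = consl v (tmul sh sh X (one ⊗ tc u t)).
Proof.
move: X; apply: tens_ext => [||a b]; [by lin|by lin|].
by rewrite consl_pure !tmul_pure // consl_pure !shx1.
Qed.

Lemma tmul_one_consl v u (Y : TT) s :
  tmul sh sh (one ⊗ tc v s) (consl u Y) = consl u (tmul sh sh (one ⊗ tc v s) Y).
Proof.
move: Y; apply: tens_ext => [||a b]; [by lin|by lin|].
by rewrite consl_pure !tmul_pure // consl_pure !sh1x.
Qed.

Lemma tmul_consl2 v u (X Y : TT) :
  tmul sh sh (consl v X) (consl u Y) =
  consl v (tmul sh sh X (consl u Y)) + consl u (tmul sh sh (consl v X) Y).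
Proof.
move: X Y; apply: tens_ext2 => [||a b c d]; [by lin|by lin|].
rewrite !consl_pure !tmul_pure // !consl_pure sh_tc.
by rewrite (linD ((tpure_bilin _ _).1 _)).
Qed.

(** Split each deconcatenation according to whether its left leg is empty. When both left legs are
    nonempty, their shuffle begins with [v] or with [u]; the terms collected by that letter are the
    two instances of the induction hypotheses. *)
Lemma deconc_sh x y : deconc (sh x y) = tmul sh sh (deconc x) (deconc y).
Proof.
have H1 w : deconc (sh one w) = tmul sh sh (deconc one) (deconc w).
  by rewrite sh1x deconc_one tmul_one // => z; rewrite sh1x.
have tC X Y : tmul sh sh X Y = tmul sh sh Y X.
  move: X Y; apply: tens_ext2 => [||a b c d]; [by lin|by lin|].
  by rewrite !tmul_pure // !(@shC _ _ a, @shC _ _ b).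
move: x y; apply: T_ext2 => [||w x]; [by lin|by lin|].
elim: w x => [|v w ihw] x; first exact: H1.
elim: x => [|u x ihx]; first by rewrite shC tC -H1.
have := ihw (u :: x); move: ihx; rewrite !word_tc => ihx ihw'.
rewrite sh_tc (linD dL) !deconc_tc ihw' ihx.
have tB := tmul_bilin shB shB.
rewrite !(linD (tB.1 _)) !(linD (tB.2 _)) tmul_pure // sh1x.
rewrite tmul_consl_one tmul_one_consl tmul_consl2.
rewrite !deconc_tc !(linD (tB.1 _)) !(linD (tB.2 _)) !(linD (consl_linear _)).
rewrite sh_tc (linD ((tpure_bilin _ _).2 _)) !addrA.
by rewrite [LHS](+%R.[ACl 1*4*5*2*3*6]).
Qed.

(** The compact form of the shuffle bialgebra axiom: the half coproduct is multiplicative, with ≺ on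
    left legs and the shuffle on right ones, since the first letter of [x] always remains first on
    the left. *)
Lemma half_deconc_prec x y :
  half (@deconc K V) (prec x y) = tmul prec sh (half (@deconc K V) x) (deconc y).
Proof.
have hL := half_linear dL; have pB := @prec_bilin K V.
move: x; apply: T_ext => [|||v s _]; [by lin|by lin| |].
  by rewrite prec1x (lin0 hL) half_one // (lin0 ((tmul_bilin pB shB).1 _)).
rewrite prec_tc !half_tc // deconc_sh (tmul_consl pB shB) // => a c.
exact: prec_tc.
Qed.

Lemma wsh_hword d (w : seq V) n x :
  hword d w -> hword n x -> homog (d + n) (wsh w x).
Proof.
move=> hw; elim: hw n x => {d w} [|d v m w vd hw ihw] n x hx.
  exact: homog_word.
elim: hx => {n x} [|e u n x ue hx ihx].
  by rewrite wsh_nil addn0; apply: homog_word; apply: hword_cons.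
rewrite wsh_cons; apply: homogD.
  by rewrite -addnA; apply: homog_tc => //; apply: ihw; apply: hword_cons.
by rewrite addnCA; apply: homog_tc.
Qed.

Lemma sh_homog p q x y : homog p x -> homog q y -> homog (p + q) (sh x y).
Proof.
apply: homog_bilin shB _ p q x y => d w n x hw hx.
by rewrite sh_word; apply: wsh_hword.
Qed.

Lemma prec_homog p q x y :
  homog p x -> homog q y -> homog (p + q) (prec x y).
Proof.
apply: homog_bilin (@prec_bilin K V) _ p q x y => d w n x hw hx.
case: hw => {d w} [|d v m w vd hw].
  by rewrite [word [::]]/one prec1x; apply: homog0.
rewrite word_tc prec_tc -addnA; apply: homog_tc => //.
by apply: sh_homog; apply: homog_word.
Qed.

Lemma sh_product : is_product sh.
Proof.
split; [exact: shB|exact: sh_homog| |exact: sh1x|exact: shx1].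
by move=> x y z; rewrite shA.
Qed.

Lemma free_sh_bialgebra : is_bialgebra sh (@deconc K V).
Proof.
split; [exact: sh_product|exact: deconc_coproduct|exact: deconc_one|].
exact: deconc_sh.
Qed.

Lemma precA x y z : prec (prec x y) z = prec x (sh y z).
Proof.
have pB := @prec_bilin K V.
move: x; apply: T_ext => [|||v s _]; [by lin|by lin| |].
  by rewrite !prec1x (lin0 (pB.1 z)).
by rewrite !prec_tc shA.
Qed.

Lemma half_redcop x : half (@deconc K V) x = x ⊗ one + redcop (@deconc K V) x.
Proof. by rewrite /redcop deconc_half addrC addrAC subrK addrAC subrr add0r. Qed.

Lemma deconc_redcop x :
  deconc x = x ⊗ one + one ⊗ x + redcop (@deconc K V) x.
Proof. by rewrite /redcop -[X in _ = _ + X]addrA -opprD [RHS]addrC subrK. Qed.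

(** Multiply out [half_deconc_prec] with D x = x ⊗ 1 + x' ⊗ x'' and C y = y ⊗ 1 + 1 ⊗ y + y' ⊗ y''.
    The six products, together with 1 ⊗ (x ≺ y), are the seven terms. *)
Lemma deconc_prec x y : kereps x -> kereps y ->
  deconc (prec x y) =
    prec x y ⊗ one + one ⊗ prec x y + x ⊗ y
    + tsum (redcop (@deconc K V) y) (fun y' y'' => prec x y' ⊗ y'')
    + tsum (redcop (@deconc K V) x) (fun x' x'' => prec x' y ⊗ x'')
    + tsum (redcop (@deconc K V) x) (fun x' x'' => x' ⊗ sh x'' y)
    + tsum (redcop (@deconc K V) x) (fun x' x'' =>
        tsum (redcop (@deconc K V) y) (fun y' y'' =>
          prec x' y' ⊗ sh x'' y'')).
Proof.
move=> x0 y0; have pB := @prec_bilin K V.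
rewrite deconc_half half_deconc_prec half_redcop (deconc_redcop y).
(* As a ≺ 1 = a - ε(a) 1, the product of x' ⊗ x'' with 1 ⊗ y carries a correction with right leg the
   shuffle of ε(x') x'' and y; this equation removes it. *)
have r0 : epsl (redcop (@deconc K V) x) = 0.
  rewrite /redcop -!scaleN1r !(linD (@epsl_linear K T)) !(linZ (@epsl_linear K T)).
  by rewrite deconc_epsl !epsl_pure x0 veps_one scale0r scaler0 addr0 scale1r
             scaleN1r subrr.
move: (redcop _ x) r0 (redcop _ y) => rx r0 ry.
have tB := tmul_bilin pB shB.
rewrite !(linD (tB.1 _)) !(linD (tB.2 _)) !tmul_pure // shx1 sh1x precx1 //.
have -> : tmul prec sh (x ⊗ one) ry = tsum ry (fun a b => prec x a ⊗ b).
  rewrite /tmul tsum_pure; last by lin.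
  by apply: tsum_eq => a b; rewrite sh1x.
have -> : tmul prec sh rx (y ⊗ one) = tsum rx (fun a b => prec a y ⊗ b).
  rewrite /tmul; apply: tsum_eq => a b; rewrite tsum_pure ?shx1 //; lin.
have -> : tmul prec sh rx (one ⊗ y) = tsum rx (fun a b => a ⊗ sh b y).
  transitivity (tsum rx (fun a b => a ⊗ sh b y + - (one ⊗ sh (veps a *: b) y))).
    rewrite /tmul; apply: tsum_eq => a b; rewrite tsum_pure; last by lin.
    rewrite {1}(eposK a) (linD (pB.1 _)) (linZ (pB.1 _)) prec1x scaler0 addr0.
    rewrite precx1; last exact: kereps_epos.
    rewrite (linZ (shB.1 _)) (linZ ((tpure_bilin _ _).2 _)).
    rewrite -(linZ ((tpure_bilin _ _).1 _)) -scaleN1r.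
    rewrite -(linZ ((tpure_bilin _ _).1 _)) -(linD ((tpure_bilin _ _).1 _)).
    by rewrite scaleN1r.
  rewrite tsumD; [|by lin|by lin].
  rewrite -(lin_tsumE (h := fun t => - (one ⊗ sh t y))); [|by lin|by lin].
  rewrite [tsum _ _ in X in _ + X]r0.
  by rewrite (lin0 (shB.1 _)) (lin0 ((tpure_bilin _ _).2 _)) oppr0 addr0.
by rewrite !addrA [X in X + _ + _ + _ + _ + _]addrC.
Qed.

Definition free_shuffle : shuffle_bialgebra T.
Proof.
apply: (@ShuffleBialgebra K T sh (@deconc K V) prec (fun x y => prec y x)).
- exact: free_sh_bialgebra.
- exact: shC.
- exact: prec_bilin.
- exact: prec_homog.
- exact: sh_split.
- by [].
- by move=> x y z _ y0 z0; rewrite precA sh_split.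
- exact: precx1.
- by move=> x _; rewrite prec1x.
- exact: prec1x.
- exact: deconc_prec.
Defined.

End FreeStructures.

(** * The three kinds of bialgebras *)

Lemma kereps_vphom (K : fieldType) (B B' : vectp K) (f : vphom B B') x :
  kereps x -> kereps (f x).
Proof. by rewrite /kereps vphom_eps. Qed.

Lemma eps_ext (K : fieldType) (B : vectp K) (W : lmodType K) (f g : B -> W) :
  linear f -> linear g -> f vone = g vone ->
  (forall x, kereps x -> f x = g x) -> f =1 g.
Proof.
move=> fL gL fg1 fg x; rewrite (eposK x) (linD fL) (linD gL) (linZ fL) (linZ gL).
by rewrite fg1 fg //; apply: kereps_epos.
Qed.

(** * Half coproducts of the form C - 1 ⊗ id *)

Section CoproductHalf.
Variables (K : fieldType) (B : vectp K) (C : B -> tens B B).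
Variable act : B -> B -> B.
Hypothesis CP : is_coproduct C.
Hypothesis C1 : C vone = vone ⊗ vone.
Let CL := cop_linear CP.

Definition cop_half (x : B) : tens B B := C x - vone ⊗ x.

Lemma cop_half_linear : linear cop_half.
Proof. by rewrite /cop_half; lin. Qed.

Lemma cop_half_prim x : primitive C x <-> kereps x /\ cop_half x = x ⊗ vone.
Proof.
rewrite /primitive /cop_half; split=> [Px|[_ <-]]; last by rewrite subrK.
split; last by rewrite Px addrK.
have := Prim_gpr0 CP Px; rewrite gpr0_eps => /(congr1 veps).
by rewrite vepsZ veps_one veps0 mulr1.
Qed.

Hypothesis actB : bilin act.
Hypothesis act_homog : forall p q x y,
  homog p x -> homog q y -> homog (p + q) (act x y).
Hypothesis act1 : forall x, kereps x -> act x vone = x.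
Hypothesis cop_act : forall p y, primitive C p ->
  C (act p y) = tsum (C y) (fun a b => act p a ⊗ b) + vone ⊗ act p y.

(** Half coassociativity is the coassociativity of [C] with 1 ⊗ C x subtracted from both sides: the
    two terms 1 ⊗ 1 ⊗ x arising in (D ⊗ id) D cancel. *)
Lemma cop_half_bialgebra : half_bialgebra C cop_half act.
Proof.
have hL := cop_half_linear; have iL := @lin_id K B.
split=> //.
- exact: cop_gpr CP.
- exact: cop_epsl CP.
- move=> n x; rewrite /cop_half -scaleN1r (linD (tgr_linear n)).
  by rewrite (linZ (tgr_linear n)) tgr_vone_l (cop_gpr CP) scaleN1r.
- by rewrite /cop_half C1 subrr.
- move=> x; rewrite -[LHS]/(epsl _) /cop_half -scaleN1r (linD (@epsl_linear K B)).
  rewrite (linZ (@epsl_linear K B)) epsl_pure veps_one scale1r scaleN1r.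
  by rewrite [epsl _](cop_epsl CP) subrr.
- move=> x; rewrite -[LHS]/(epsr _) /cop_half -scaleN1r (linD (@epsr_linear K B)).
  rewrite (linZ (@epsr_linear K B)) epsr_pure scaleN1r.
  by rewrite [epsr _](cop_epsr CP).
- move=> x; have oL : linear (fun y : B => (vone : B) ⊗ y) by lin.
  have E (X : tens B B) : tassoc (tmap cop_half id X) =
      tassoc (tmap C id X) - vone ⊗ X.
    move: X; apply: tens_ext => [||a b]; [by lin|by lin|].
    rewrite !tmap_pure // /cop_half -scaleN1r (linD ((tpure_bilin _ _).1 _)).
    rewrite (linZ ((tpure_bilin _ _).1 _)) (linD (@tassoc_linear _ _ _ _)).
    by rewrite (linZ (@tassoc_linear _ _ _ _)) tassoc_pure scaleN1r.
  have tL := tmap_linear iL CL.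
  rewrite E /cop_half -!scaleN1r (linD (tmap_linear CL iL)).
  rewrite (linZ (tmap_linear CL iL)) (linD tL) (linZ tL) !tmap_pure // C1.
  rewrite (linD (@tassoc_linear _ _ _ _)) (linZ (@tassoc_linear _ _ _ _)).
  rewrite tassoc_pure (copA CP) (linD ((tpure_bilin _ _).2 _)).
  rewrite (linZ ((tpure_bilin _ _).2 _)) !scaleN1r opprD opprK.
  by rewrite -addrA; congr (_ + _); rewrite addrC addrK.
- move=> p y p0 Dp; have Pp : primitive C p by apply/cop_half_prim.
  by rewrite /cop_half cop_act // addrK.
Qed.

End CoproductHalf.

(** * Compatibility of θ with coproducts and products *)

Section ThetaCoproduct.
Variables (K : fieldType) (B : vectp K) (C D : B -> tens B B).
Variable act : B -> B -> B.
Hypothesis H : half_bialgebra C D act.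
Variable P : subgr B.
Hypothesis P0 : forall x, sgmem P x -> gpr 0 x = 0.
Hypothesis PE : forall x, sgmem P x <-> kereps x /\ D x = x ⊗ vone.
Local Notation V := (sgvect P0).
Local Notation T := (tensalg_vectp V).
Local Notation th := (theta H P0).

Lemma thetaL : linear th. Proof. exact: gfun_linear. Qed.

Lemma theta_one : th vone = vone. Proof. exact: vpfun1. Qed.

Lemma theta_tc v t : th (tcons v t) = act (sgval v) (th t).
Proof. exact: (theta_cons H). Qed.

Lemma theta_consl v (X : tens T T) :
  tmap th th (consl v X) = tsum (tmap th th X) (fun a b => act (sgval v) a ⊗ b).
Proof.
have thL := thetaL; have aB := hb_act_bilin H.
rewrite tsum_tmap //; last by lin.
move: X; apply: tens_ext => [||a b]; [by lin|by lin|].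
rewrite consl_pure tmap_pure // tsum_pure; last by lin.
by rewrite theta_tc.
Qed.

Lemma theta_consr v (X : tens T T) :
  tmap th th (consr v X) = tsum (tmap th th X) (fun a b => a ⊗ act (sgval v) b).
Proof.
have thL := thetaL; have aB := hb_act_bilin H.
rewrite tsum_tmap //; last by lin.
move: X; apply: tens_ext => [||a b]; [by lin|by lin|].
rewrite consr_pure tmap_pure // tsum_pure; last by lin.
by rewrite theta_tc.
Qed.

Lemma theta_half_tc (C' : T -> tens T T) v t :
  C (th t) = tmap th th (C' t) -> D (th (tcons v t)) = tmap th th (consl v (C' t)).
Proof.
move=> e; have [v0 Dv] := (PE _).1 (sgvalP v).
by rewrite theta_tc (hb_half_act H) // e theta_consl.
Qed.

Lemma theta_half (C' : T -> tens T T) : linear C' ->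
  (forall t, C (th t) = tmap th th (C' t)) ->
  forall x, D (th x) = tmap th th (half C' x).
Proof.
move=> CL e; have thL := thetaL; have DL := hb_half_linear H.
have hL := half_linear CL.
apply: T_ext => [|||v t _]; [by lin|by lin| |].
  by rewrite theta_one (hb_half1 H) half_one // (lin0 (tmap_linear _ _)).
by rewrite half_tc // (theta_half_tc v (e t)).
Qed.

Lemma theta_conc (m : B -> B -> B) : is_product m ->
  (forall x y z, act x (m y z) = m (act x y) z) ->
  forall x y, th (conc x y) = m (th x) (th y).
Proof.
move=> mP am x y; have thL := thetaL; have mB := prod_bilin mP.
move: x; apply: T_ext => [|||v t ih]; [by lin|by lin| |].
  by rewrite conc_one theta_one (prod1x mP).
by rewrite conc_tc !theta_tc ih am.
Qed.

End ThetaCoproduct.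

(** With D = C - 1 ⊗ id, the value of [C] on a word follows from that of [D], hence from [C] on the
    tail, whatever ▷ is. This is why infinitesimal and shuffle bialgebras share deconcatenation as
    their free coproduct. *)
Lemma theta_deconc (K : fieldType) (B : vectp K) (C : B -> tens B B)
    (act : B -> B -> B) (H : half_bialgebra C (cop_half C) act) (P : subgr B)
    (P0 : forall x, sgmem P x -> gpr 0 x = 0)
    (PE : forall x, sgmem P x <-> kereps x /\ cop_half C x = x ⊗ vone) x :
  C (theta H P0 x) = tmap (theta H P0) (theta H P0) (deconc x).
Proof.
have thL := @gfun_linear K _ _ (theta H P0); have CL := hb_cop_linear H.
have dL := @deconc_linear K (sgvect P0).
move: x; apply: T_ext => [|||v t ih]; [by lin|by lin| |].
  by rewrite theta_one deconc_one tmap_pure // theta_one (hb_cop1 H).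
rewrite deconc_tc (linD (tmap_linear _ _)) // tmap_pure // theta_one.
by rewrite -(theta_half_tc PE v ih) /cop_half addrC subrK.
Qed.

Section InfinitesimalSide.
Variables (K : fieldType) (B : vectp K) (s : infinitesimal_bialgebra B).

(** This is not among the axioms: the compatibility at x = y = 1 reads Δ(1) = Δ(1) + Δ(1) - 1 ⊗
    1. *)
Lemma inf_cop1 : inf_cop s vone = vone ⊗ vone.
Proof.
have mB := prod_bilin (inf_product s).
have := inf_cop_mul s vone vone; rewrite !(prod1x (inf_product s)).
rewrite (tsum_eq (fun a b => a ⊗ b)); last first.
  by move=> a b; rewrite (prod1x (inf_product s)).
rewrite [X in _ + X - _](tsum_eq (fun a b => a ⊗ b)); last first.
  by move=> a b; rewrite (prodx1 (inf_product s)).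
rewrite tsum_id => /eqP; rewrite -addrA -subr_eq0 opprD addrA subrr sub0r.
by rewrite oppr_eq0 subr_eq0 => /eqP.
Qed.

Lemma inf_half : half_bialgebra (inf_cop s) (cop_half (inf_cop s)) (inf_mul s).
Proof.
have mB := prod_bilin (inf_product s).
apply: cop_half_bialgebra; [exact: inf_coproduct|exact: inf_cop1|by lin| | |].
- exact: prod_homog (inf_product s).
- by move=> x _; apply: prodx1 (inf_product s) x.
(* For primitive [p] the sum of the p_1 ⊗ p_2 y is p ⊗ y + 1 ⊗ p y, and p ⊗ y cancels against the
   last term of the axiom. *)
move=> p y Pp; rewrite inf_cop_mul Pp (linD (tsum_linear _)); last by lin.
rewrite !tsum_pure; try by lin.
by rewrite (prod1x (inf_product s)) -addrA addrAC subrr add0r.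
Qed.

Let P0 : forall x, sgmem (Prim_subgr (inf_coproduct s)) x -> gpr 0 x = 0 :=
  Prim_gpr0 (inf_coproduct s).

Lemma inf_prim x : sgmem (Prim_subgr (inf_coproduct s)) x <->
  kereps x /\ cop_half (inf_cop s) x = x ⊗ vone.
Proof. exact: cop_half_prim (inf_coproduct s) x. Qed.

Lemma inf_theta_mor :
  infinitesimal_mor (free_infinitesimal _) s (theta inf_half P0).
Proof.
split=> [x y|x]; last exact: theta_deconc inf_prim x.
apply: theta_conc (inf_product s) _ x y => x y z.
exact: prodA (inf_product s) x y z.
Qed.

End InfinitesimalSide.

Section ShuffleSide.
Variables (K : fieldType) (B : vectp K) (s : shuffle_bialgebra B).
Local Notation C := (sh_cop s).
Let mP := bialg_product (sh_bialg s).
Let CP := bialg_coproduct (sh_bialg s).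
Let mB := prod_bilin mP.
Let pB := sh_prec_bilin s.

(** A primitive [p] has p' ⊗ p'' = 0, so three of the seven terms of the axiom vanish, and p ≺ 1 = p
    gathers three others into the sum of the p ≺ y_1 ⊗ y_2. The axiom covers Ker ε only, hence the
    separate case [y = 1]. *)
Lemma sh_cop_prim p y : primitive C p ->
  C (sh_prec s p y) =
    tsum (C y) (fun a b => sh_prec s p a ⊗ b) + vone ⊗ sh_prec s p y.
Proof.
move=> Pp; have [p0 _] := (cop_half_prim CP p).1 Pp.
have CL : linear C := cop_linear CP.
have rp : redcop C p = 0 by rewrite /redcop Pp addrAC addrK subrr.
move: y; apply: eps_ext => [|||z z0]; [by lin|by lin| |].
  rewrite sh_precx1 // (bialg_one (sh_bialg s)) tsum_pure; last by lin.
  by rewrite sh_precx1.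
rewrite (sh_cop_prec s p0 z0) rp !(lin0 (tsum_linear _)) ?addr0; first last.
- by lin.
- by lin.
- by lin.
have -> : C z = redcop C z + vone ⊗ z + z ⊗ vone by rewrite /redcop !subrK.
rewrite !(linD (tsum_linear _)) ?tsum_pure; try by lin.
rewrite sh_precx1 // addrC !addrA [LHS]addrAC; congr (_ + _).
by rewrite addrAC.
Qed.

Lemma sh_half : half_bialgebra C (cop_half C) (sh_prec s).
Proof.
apply: cop_half_bialgebra => //.
- exact: bialg_one (sh_bialg s).
- exact: sh_prec_homog.
- exact: sh_precx1.
- exact: sh_cop_prim.
Qed.

Lemma sh_prec_mulA x y z : kereps x -> kereps z ->
  sh_prec s (sh_prec s x y) z = sh_prec s x (sh_mul s y z).
Proof.
move=> x0 z0; move: y; apply: eps_ext => [|||y y0]; [by lin|by lin| |].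
  by rewrite sh_precx1 // (prod1x mP).
by rewrite sh_precA // sh_mulE.
Qed.

Lemma sh_prim x : sgmem (Prim_subgr CP) x <->
  kereps x /\ cop_half C x = x ⊗ vone.
Proof. exact: cop_half_prim. Qed.

Let P0 : forall x, sgmem (Prim_subgr CP) x -> gpr 0 x = 0 := Prim_gpr0 CP.
Local Notation th := (theta sh_half P0).
Let thL : linear th := @gfun_linear K _ _ th.

(** The images of nonempty words lie in Ker ε, so their product is the sum of ≺ and ≻, and (v ≺ a) ≺
    b = v ≺ (a ⋆ b) turns these halves into the two terms of the shuffle recursion. *)
Lemma theta_sh x y : th (sh x y) = sh_mul s (th x) (th y).
Proof.
move: x y; apply: T_ext2 => [||w x]; [by lin|by lin|].
elim: w x => [|v w ihw] x.
  by rewrite word_nil sh1x theta_one (prod1x mP).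
elim: x => [|u x ihx].
  by rewrite word_nil shx1 theta_one (prodx1 mP).
have k a t : kereps (th (tcons a t)) by apply: kereps_vphom; apply: eps_tc.
have p0 (a : sgvect P0) : kereps (sgval a) by case: ((sh_prim _).1 (sgvalP a)).
have := ihw (u :: x); move: ihx; rewrite !word_tc => ihx ihw'.
rewrite sh_tc (linD thL) [RHS]sh_mulE // -sh_precC !theta_tc ihw' ihx !theta_tc.
rewrite !sh_prec_mulA -?theta_tc //; congr (_ + sh_prec s _ _).
by rewrite sh_mulC.
Qed.

Lemma sh_theta_mor : shuffle_mor (free_shuffle _) s th.
Proof.
have E x y : kereps x -> kereps y -> th (prec x y) = sh_prec s (th x) (th y).
  move=> x0 y0; apply: (@ker_ext _ _ _ (fun x => th (prec x y))
    (fun x => sh_prec s (th x) (th y))) x0 => [||v z]; [by lin|by lin|].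
  rewrite prec_tc !theta_tc theta_sh sh_prec_mulA //.
    by case: ((sh_prim _).1 (sgvalP v)).
  exact: kereps_vphom.
split=> [x y|x|//|x y x0 y0].
- exact: theta_sh.
- exact: theta_deconc sh_prim x.
- by rewrite -!sh_precC; exact: E.
Qed.

End ShuffleSide.

Section UnshuffleSide.
Variables (K : fieldType) (B : vectp K) (s : unshuffle_bialgebra B).
Let mP := bialg_product (un_bialg s).
Let CP := bialg_coproduct (un_bialg s).
Let mB := prod_bilin mP.
Let pL := un_prec_linear s.
Let CL : linear (un_cop s) := cop_linear CP.

Lemma un_prec_epos x : un_prec s (epos x) = un_prec s x.
Proof. by rewrite {2}(eposK x) (linD pL) (linZ pL) un_prec1 scaler0 addr0. Qed.

Lemma un_half : half_bialgebra (un_cop s) (un_prec s) (un_mul s).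
Proof.
split=> //.
- exact: cop_gpr CP.
- exact: bialg_one (un_bialg s).
- exact: cop_epsl CP.
- exact: un_prec_gpr.
- exact: un_prec1.
- by move=> x; rewrite -un_prec_epos un_prec_epsl //; apply: kereps_epos.
- by move=> x; rewrite -un_prec_epos un_prec_epsr //; apply: kereps_epos.
- by move=> x; rewrite -un_prec_epos un_precA //; apply: kereps_epos.
- exact: prod_homog mP.
- by move=> x _; apply: prodx1 mP x.
move=> p y p0 Dp; move: y; apply: eps_ext => [|||y y0]; [by lin|by lin| |].
  rewrite (prodx1 mP) (bialg_one (un_bialg s)) tsum_pure; last by lin.
  by rewrite (prodx1 mP).
rewrite un_prec_mul // Dp /tmul tsum_pure; last by lin.
by apply: tsum_eq => a b; rewrite (prod1x mP).
Qed.

Lemma un_prim x : sgmem (PrecPrim_subgr s) x <->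
  kereps x /\ un_prec s x = x ⊗ vone.
Proof. by []. Qed.

Lemma un_succE x : un_succ s x = tswap (un_prec s x).
Proof.
have sL := un_succ_linear s.
move: x; apply: eps_ext => [|||x x0]; [by lin|by lin| |].
  by rewrite un_succ1 un_prec1 (lin0 (@tswap_linear _ _ _)).
by rewrite un_precC // tswapK.
Qed.

Let P0 : forall x, sgmem (PrecPrim_subgr s) x -> gpr 0 x = 0 :=
  @PrecPrim_gpr0 K B s.
Local Notation th := (theta un_half P0).
Let thL : linear th := @gfun_linear K _ _ th.

(** From δ_≺ p = p ⊗ 1 and the symmetry of δ_≺ and δ_≻ follows δ p = p ⊗ 1 + 1 ⊗ p; multiplicativity
    of δ then reproduces the step of [unsh]. *)
Lemma theta_unsh x : un_cop s (th x) = tmap th th (unsh x).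
Proof.
have uL := @unsh_linear K (sgvect P0).
move: x; apply: T_ext => [|||v t ih]; [by lin|by lin| |].
  rewrite theta_one unsh_one tmap_pure // theta_one.
  exact: bialg_one (un_bialg s).
have [v0 Dv] := (un_prim _).1 (sgvalP v).
rewrite unsh_tc (linD (tmap_linear _ _)) // theta_consl theta_consr -ih theta_tc.
rewrite (bialg_mul (un_bialg s)) (un_copE s v0) un_succE Dv tswap_pure.
have tB := tmul_bilin mB mB; rewrite (linD (tB.1 _)) /tmul.
rewrite !tsum_pure; try by lin.
by congr (_ + _); apply: tsum_eq => a b; rewrite (prod1x mP).
Qed.

Lemma tswap_tmap (U V U' V' : lmodType K) (f : U -> U') (g : V -> V') t :
  linear f -> linear g -> tswap (tmap f g t) = tmap g f (tswap t).
Proof.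
move=> fL gL; move: t; apply: tens_ext => [||u v]; [by lin|by lin|].
by rewrite tmap_pure // !tswap_pure tmap_pure.
Qed.

Lemma un_theta_mor : unshuffle_mor (free_unshuffle _) s th.
Proof.
have E x : un_prec s (th x) = tmap th th (lead_unsh x).
  exact: (theta_half un_prim (@unsh_linear _ _) theta_unsh).
have M x y : th (conc x y) = un_mul s (th x) (th y).
  by apply: theta_conc mP _ x y => ? ? ?; apply: prodA mP _ _ _.
split=> [x y|x|x _|x _].
- exact: M.
- exact: theta_unsh.
- exact: E.
- by rewrite un_succE E tswap_tmap.
Qed.

End UnshuffleSide.

(** * Transport of structure *)

Section InverseMorphism.
Variables (K : fieldType) (A B : vectp K) (f : vphom A B) (g : vphom B A).
Hypotheses (fK : cancel f g) (gK : cancel g f).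
Let fL : linear f := gfun_linear f.
Let gL : linear g := gfun_linear g.

Lemma tmapK (t : tens A A) : tmap g g (tmap f f t) = t.
Proof.
rewrite -tmap_comp // -[RHS]tmap_id.
by congr tmap; apply: funext => x; apply: fK.
Qed.

Lemma alg_mor_inv m m' : alg_mor m m' f -> alg_mor m' m g.
Proof. by move=> fM x y; rewrite -{1}(gK x) -{1}(gK y) -fM fK. Qed.

Lemma coalg_mor_inv D D' : coalg_mor D D' f -> coalg_mor D' D g.
Proof. by move=> fD x; rewrite -{2}(gK x) fD tmapK. Qed.

Lemma infinitesimal_mor_inv s t : infinitesimal_mor s t f ->
  infinitesimal_mor t s g.
Proof. by case=> fM fD; split; [apply: alg_mor_inv|apply: coalg_mor_inv]. Qed.

Lemma shuffle_mor_inv s t : shuffle_mor s t f -> shuffle_mor t s g.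
Proof.
case=> fM fD fp fs; split; [exact: alg_mor_inv|exact: coalg_mor_inv| |].
  move=> x y x0 y0; rewrite -{1}(gK x) -{1}(gK y) -fp ?fK //; exact: kereps_vphom.
move=> x y x0 y0; rewrite -{1}(gK x) -{1}(gK y) -fs ?fK //; exact: kereps_vphom.
Qed.

Lemma unshuffle_mor_inv s t : unshuffle_mor s t f -> unshuffle_mor t s g.
Proof.
case=> fM fD fp fs; split; [exact: alg_mor_inv|exact: coalg_mor_inv| |].
  by move=> x x0; rewrite -{2}(gK x) fp ?tmapK //; apply: kereps_vphom.
by move=> x x0; rewrite -{2}(gK x) fs ?tmapK //; apply: kereps_vphom.
Qed.

End InverseMorphism.

Section Transport.
Variables (K : fieldType) (A B : vectp K) (f : vphom A B) (g : vphom B A).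
Hypotheses (fK : cancel f g) (gK : cancel g f).
Let fL : linear f := gfun_linear f.
Let gL : linear g := gfun_linear g.
Let ffL : linear (tmap f f) := tmap_linear fL fL.

Definition transp_mul (m : A -> A -> A) (x y : B) : B := f (m (g x) (g y)).
Definition transp_cop (D : A -> tens A A) (x : B) : tens B B :=
  tmap f f (D (g x)).

Lemma g_vone : g vone = vone. Proof. exact: vpfun1. Qed.
Lemma f_vone : f vone = vone. Proof. exact: vpfun1. Qed.

Lemma homog_mor n x : homog n x -> homog n (g x).
Proof. by move=> xn; rewrite /homog -gfun_gpr xn. Qed.

Lemma transp_bilin m : bilin m -> bilin (transp_mul m).
Proof. by move=> mB; rewrite /transp_mul; split=> [y|x]; lin. Qed.

Lemma transp_linear D : linear D -> linear (transp_cop D).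
Proof. by move=> DL; rewrite /transp_cop; lin. Qed.

Lemma transp_homog (m : A -> A -> A) :
  (forall p q x y, homog p x -> homog q y -> homog (p + q) (m x y)) ->
  forall p q x y, homog p x -> homog q y -> homog (p + q) (transp_mul m x y).
Proof.
move=> mh p q x y xp yq; rewrite /homog /transp_mul -gfun_gpr.
by congr (gfun f _); apply: mh; apply: homog_mor.
Qed.

Lemma tmap_gpr n (t : tens A A) : tmap f f (tgr n t) = tgr n (tmap f f t).
Proof.
move: t; apply: tens_ext => [||a b]; [by lin|by lin|].
rewrite tgr_pure tmap_pure // tgr_pure (lin_sum ffL); apply: eq_bigr => p _.
by rewrite tmap_pure // !gfun_gpr.
Qed.

Lemma transp_gpr D : (forall n x, D (gpr n x) = tgr n (D x)) ->
  forall n x, transp_cop D (gpr n x) = tgr n (transp_cop D x).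
Proof. by move=> Dg n x; rewrite /transp_cop gfun_gpr Dg tmap_gpr. Qed.

Lemma transp_product m : is_product m -> is_product (transp_mul m).
Proof.
move=> mP; split.
- exact/transp_bilin/(prod_bilin mP).
- exact/transp_homog/(prod_homog mP).
- by move=> x y z; rewrite /transp_mul !fK (prodA mP).
- by move=> x; rewrite /transp_mul g_vone (prod1x mP).
- by move=> x; rewrite /transp_mul g_vone (prodx1 mP).
Qed.

Lemma tmap_tassoc (t : tens (tens A A) A) :
  tassoc (tmap (tmap f f) f t) = tmap f (tmap f f) (tassoc t).
Proof.
move: t; apply: tens_ext => [||s c]; [by lin|by lin|].
rewrite tmap_pure //; move: s; apply: tens_ext => [||a b]; [by lin|by lin|].
by rewrite tmap_pure // !tassoc_pure !tmap_pure.
Qed.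

Lemma tmap_transpl (D : A -> tens A A) t : linear D ->
  tmap (transp_cop D) id (tmap f f t) = tmap (tmap f f) f (tmap D id t).
Proof.
move=> DL; have DL' := transp_linear DL; have iL := @lin_id K.
move: t; apply: tens_ext => [||a b]; [by lin|by lin|].
by rewrite !tmap_pure // /transp_cop fK.
Qed.

Lemma tmap_transpr (D : A -> tens A A) t : linear D ->
  tmap id (transp_cop D) (tmap f f t) = tmap f (tmap f f) (tmap id D t).
Proof.
move=> DL; have DL' := transp_linear DL; have iL := @lin_id K.
move: t; apply: tens_ext => [||a b]; [by lin|by lin|].
by rewrite !tmap_pure // /transp_cop fK.
Qed.

(** Two coproducts are allowed so that this covers both ordinary coassociativity and the mixed
    relation between δ_≺ and δ. *)
Lemma transp_coassoc D C x : linear D -> linear C ->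
  tassoc (tmap D id (D (g x))) = tmap id C (D (g x)) ->
  tassoc (tmap (transp_cop D) id (transp_cop D x)) =
  tmap id (transp_cop C) (transp_cop D x).
Proof.
move=> DL CL DC; rewrite {2}/transp_cop tmap_transpl // tmap_tassoc DC.
by rewrite -tmap_transpr.
Qed.

Lemma transp_epsl D x : tsum (transp_cop D x) (fun a b => veps a *: b) =
  f (tsum (D (g x)) (fun a b => veps a *: b)).
Proof.
rewrite tsum_tmap //; last by lin.
rewrite (lin_tsumE fL); last by lin.
by apply: tsum_eq => a b; rewrite vphom_eps (linZ fL).
Qed.

Lemma transp_epsr D x : tsum (transp_cop D x) (fun a b => veps b *: a) =
  f (tsum (D (g x)) (fun a b => veps b *: a)).
Proof.
rewrite tsum_tmap //; last by lin.
rewrite (lin_tsumE fL); last by lin.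
by apply: tsum_eq => a b; rewrite vphom_eps (linZ fL).
Qed.

Lemma transp_coproduct D : is_coproduct D -> is_coproduct (transp_cop D).
Proof.
move=> DP; have DL := cop_linear DP; split.
- exact: transp_linear.
- exact/transp_gpr/(cop_gpr DP).
- by move=> x; apply: transp_coassoc => //; apply: (copA DP).
- by move=> x; rewrite transp_epsl (cop_epsl DP) gK.
- by move=> x; rewrite transp_epsr (cop_epsr DP) gK.
Qed.

Lemma transp_tmul m m' s t : bilin m -> bilin m' ->
  tmul (transp_mul m) (transp_mul m') (tmap f f s) (tmap f f t) =
  tmap f f (tmul m m' s t).
Proof.
move=> mB mB'; have tB := transp_bilin mB; have tB' := transp_bilin mB'.
have TB := tmul_bilin mB mB'; have TB' := tmul_bilin tB tB'.
move: s t; apply: tens_ext2 => [||a b c d].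
- by split=> [y|x]; lin.
- by split=> [y|x]; lin.
by rewrite !tmap_pure // !tmul_pure // tmap_pure // /transp_mul !fK.
Qed.

Lemma transp_bialgebra m D : is_bialgebra m D ->
  is_bialgebra (transp_mul m) (transp_cop D).
Proof.
case=> mP DP D1 Dm; have mB := prod_bilin mP.
split; [exact: transp_product|exact: transp_coproduct| |].
  by rewrite /transp_cop g_vone D1 tmap_pure // f_vone.
move=> x y; rewrite /transp_cop {1}/transp_mul fK Dm.
by rewrite transp_tmul.
Qed.

Lemma transp_alg_mor m : alg_mor m (transp_mul m) f.
Proof. by move=> x y; rewrite /transp_mul !fK. Qed.

Lemma transp_coalg_mor D : coalg_mor D (transp_cop D) f.
Proof. by move=> x; rewrite /transp_cop fK. Qed.

Definition transp_infinitesimal (s : infinitesimal_bialgebra A) :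
  infinitesimal_bialgebra B.
Proof.
apply: (@InfinitesimalBialgebra K B (transp_mul (inf_mul s))
  (transp_cop (inf_cop s))).
- exact/transp_product/inf_product.
- exact/transp_coproduct/inf_coproduct.
move=> x y; have mB := prod_bilin (inf_product s).
have tB := transp_bilin mB.
rewrite {1}/transp_mul {1}/transp_cop fK inf_cop_mul.
rewrite -scaleN1r !(linD ffL) (linZ ffL) scaleN1r tmap_pure // !gK.
rewrite !tsum_tmap; try by lin.
rewrite !(lin_tsumE ffL); try by lin.
congr (_ + _ - _); apply: tsum_eq => a b; 
  by rewrite tmap_pure // /transp_mul !fK.
Defined.

Lemma transp_infinitesimal_mor s :
  infinitesimal_mor s (transp_infinitesimal s) f.
Proof. by split; [apply: transp_alg_mor|apply: transp_coalg_mor]. Qed.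

Lemma transp_redcop D x :
  redcop (transp_cop D) x = tmap f f (redcop D (g x)).
Proof.
rewrite /redcop -!scaleN1r !(linD ffL) !(linZ ffL) !tmap_pure // !gK.
by rewrite !f_vone.
Qed.

Definition transp_shuffle (s : shuffle_bialgebra A) : shuffle_bialgebra B.
Proof.
apply: (@ShuffleBialgebra K B (transp_mul (sh_mul s)) (transp_cop (sh_cop s))
  (transp_mul (sh_prec s)) (transp_mul (sh_succ s))).
- exact/transp_bialgebra/sh_bialg.
- by move=> x y; rewrite /transp_mul sh_mulC.
- exact/transp_bilin/sh_prec_bilin.
- exact/transp_homog/sh_prec_homog.
- move=> x y x0 y0; rewrite /transp_mul sh_mulE; try exact: kereps_vphom.
  exact: linD.
- by move=> x y; rewrite /transp_mul sh_precC.
- move=> x y z x0 y0 z0; rewrite /transp_mul -(linD fL) !fK.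
  by rewrite sh_precA //; apply: kereps_vphom.
- move=> x x0; rewrite /transp_mul g_vone sh_precx1 //; exact: kereps_vphom.
- move=> x x0; rewrite /transp_mul g_vone sh_prec1x; last exact: kereps_vphom.
  exact: lin0.
- by rewrite /transp_mul g_vone sh_prec11; apply: lin0.
move=> x y x0 y0; have mB := prod_bilin (bialg_product (sh_bialg s)).
have pB := sh_prec_bilin s; have tB := transp_bilin mB.
have tB' := transp_bilin pB.
rewrite {1}/transp_mul {1}/transp_cop fK sh_cop_prec; try exact: kereps_vphom.
rewrite !(linD ffL) !tmap_pure // f_vone !gK !transp_redcop.
rewrite !tsum_tmap; try by lin.
rewrite !(lin_tsumE ffL); try by lin.
congr (_ + _ + _ + _ + _ + _ + _); apply: tsum_eq => a b.
- by rewrite tmap_pure // /transp_mul !fK.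
- by rewrite tmap_pure // /transp_mul !fK.
- by rewrite tmap_pure // /transp_mul !fK.
rewrite tsum_tmap // ?(lin_tsumE ffL); try by lin.
by apply: tsum_eq => c d; rewrite tmap_pure // /transp_mul !fK.
Defined.

Lemma transp_shuffle_mor s : shuffle_mor s (transp_shuffle s) f.
Proof.
by split; [apply: transp_alg_mor|apply: transp_coalg_mor| |] => x y _ _;
  apply: transp_alg_mor.
Qed.

Definition transp_unshuffle (s : unshuffle_bialgebra A) : unshuffle_bialgebra B.
Proof.
apply: (@UnshuffleBialgebra K B (transp_mul (un_mul s)) (transp_cop (un_cop s))
  (transp_cop (un_prec s)) (transp_cop (un_succ s))).
- exact/transp_bialgebra/un_bialg.
- by move=> x; rewrite /transp_cop tswap_tmap // un_copC.
- exact/transp_linear/un_prec_linear.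
- exact/transp_linear/un_succ_linear.
- exact/transp_gpr/un_prec_gpr.
- by rewrite /transp_cop g_vone un_prec1; apply: lin0.
- by rewrite /transp_cop g_vone un_succ1; apply: lin0.
- move=> x x0; rewrite /transp_cop un_copE; last exact: kereps_vphom.
  exact: linD.
- move=> x x0; rewrite /transp_cop tswap_tmap // un_precC //.
  exact: kereps_vphom.
- move=> x x0; apply: transp_coassoc.
  + exact: un_prec_linear.
  + exact: cop_linear (bialg_coproduct (un_bialg s)).
  + by apply: un_precA; apply: kereps_vphom.
- move=> x x0; rewrite transp_epsl un_prec_epsl; last exact: kereps_vphom.
  exact: lin0.
- move=> x x0; rewrite transp_epsr un_prec_epsr ?gK //; exact: kereps_vphom.
move=> x y x0 y0; have mB := prod_bilin (bialg_product (un_bialg s)).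
rewrite /transp_cop {1}/transp_mul fK un_prec_mul; try exact: kereps_vphom.
by rewrite transp_tmul.
Defined.

Lemma transp_unshuffle_mor s : unshuffle_mor s (transp_unshuffle s) f.
Proof.
by split; [apply: transp_alg_mor|apply: transp_coalg_mor| |] => x _;
  apply: transp_coalg_mor.
Qed.

End Transport.

(** * Functoriality of the tensor algebra *)

Section FreeMorphisms.
Variables (K : fieldType) (V W : vect K) (f : ghom V W).
Local Notation T := (tensalg_vectp V).
Local Notation phi := (tamap_hom f : vphom (tensalg_vectp V) (tensalg_vectp W)).

Let phiL : linear phi := gfun_linear phi.

Lemma free_map_one : phi vone = vone. Proof. exact: vpfun1. Qed.

Lemma free_map_tc v (t : T) : phi (tcons v t : T) = tcons (f v) (phi t).
Proof.
move: t; apply: tensalg_ext => [||w].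
- exact: lin_compose phiL (tc_linear v).
- exact: lin_compose (tc_linear (f v)) phiL.
by rewrite tcons_word /= !tamap_word tcons_word.
Qed.

Lemma free_map_consl v (X : tens T T) :
  tmap phi phi (consl v X) = consl (f v) (tmap phi phi X).
Proof.
move: X; apply: tens_ext => [||a b]; [by lin|by lin|].
by rewrite consl_pure !tmap_pure // consl_pure free_map_tc.
Qed.

Lemma free_map_consr v (X : tens T T) :
  tmap phi phi (consr v X) = consr (f v) (tmap phi phi X).
Proof.
move: X; apply: tens_ext => [||a b]; [by lin|by lin|].
by rewrite consr_pure !tmap_pure // consr_pure free_map_tc.
Qed.

Lemma free_map_conc x y : phi (conc x y) = conc (phi x) (phi y).
Proof.
move: x; apply: T_ext => [|||v x ih]; [by lin|by lin| |].
  by rewrite conc_one free_map_one conc_one.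
by rewrite conc_tc !free_map_tc conc_tc ih.
Qed.

Lemma free_map_deconc x : deconc (phi x) = tmap phi phi (deconc x).
Proof.
have dL U := @deconc_linear K U.
move: x; apply: T_ext => [|||v x ih]; [by lin|by lin| |].
  by rewrite free_map_one !deconc_one tmap_pure // free_map_one.
rewrite free_map_tc !deconc_tc (linD (tmap_linear _ _)) // tmap_pure //.
by rewrite free_map_one free_map_tc free_map_consl ih.
Qed.

Lemma free_map_unsh x : unsh (phi x) = tmap phi phi (unsh x).
Proof.
have uL U := @unsh_linear K U.
move: x; apply: T_ext => [|||v x ih]; [by lin|by lin| |].
  by rewrite free_map_one !unsh_one tmap_pure // free_map_one.
rewrite free_map_tc !unsh_tc (linD (tmap_linear _ _)) //.
by rewrite free_map_consl free_map_consr ih.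
Qed.

Lemma free_map_lead x : lead_unsh (phi x) = tmap phi phi (lead_unsh x).
Proof.
have hL U := @lead_unsh_linear K U; have uL U := @unsh_linear K U.
move: x; apply: T_ext => [|||v x _]; [by lin|by lin| |].
  by rewrite free_map_one /lead_unsh !half_one // (lin0 (tmap_linear _ _)).
by rewrite free_map_tc /lead_unsh !half_tc // free_map_consl free_map_unsh.
Qed.

Lemma free_map_sh x y : phi (sh x y) = sh (phi x) (phi y).
Proof.
move: x y; apply: T_ext2 => [||w x]; [by lin|by lin|].
elim: w x => [|v w ihw] x.
  by rewrite word_nil sh1x free_map_one sh1x.
elim: x => [|u x ihx]; first by rewrite word_nil shx1 free_map_one shx1.
have := ihw (u :: x); move: ihx; rewrite !word_tc => ihx ihw'.
rewrite sh_tc (linD phiL) !free_map_tc ihw' ihx !free_map_tc.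
by rewrite sh_tc.
Qed.

Lemma free_map_prec x y : phi (prec x y) = prec (phi x) (phi y).
Proof.
move: x; apply: T_ext => [|||v x _]; [by lin|by lin| |].
  by rewrite free_map_one !prec1x (lin0 phiL).
by rewrite free_map_tc !prec_tc free_map_tc free_map_sh.
Qed.

Lemma free_infinitesimal_mor :
  infinitesimal_mor (free_infinitesimal V) (free_infinitesimal W) phi.
Proof. by split; [exact: free_map_conc|exact: free_map_deconc]. Qed.

Lemma free_shuffle_mor : shuffle_mor (free_shuffle V) (free_shuffle W) phi.
Proof.
split; [exact: free_map_sh|exact: free_map_deconc| |] => x y _ _.
  exact: free_map_prec.
exact: free_map_prec.
Qed.

Lemma free_unshuffle_mor :
  unshuffle_mor (free_unshuffle V) (free_unshuffle W) phi.
Proof.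
split; [exact: free_map_conc|exact: free_map_unsh| |] => x _.
  exact: free_map_lead.
have E : tswap (lead_unsh (phi x)) = tmap phi phi (tswap (lead_unsh x)).
  by rewrite free_map_lead tswap_tmap.
exact: E.
Qed.

(** This is the naturality in V of the isomorphism P(T(V)) ≅ V. *)
Lemma free_map_letter1 x : letter1 (phi x) = f (letter1 x).
Proof.
have lL U := @letter1_linear K U; have fL := gfun_linear f.
move: x; apply: T_ext => [|||v x _]; [by lin|by lin| |].
  by rewrite free_map_one /letter1 !tlead_one ?(lin0 fL) //; exact: letter1_bilin.
by rewrite free_map_tc !letter1_tc vphom_eps (linZ fL).
Qed.

End FreeMorphisms.

(** * The primitive elements of T(V) are its letters *)

Section FreePrimitives.
Variables (K : fieldType) (V : vect K).
Local Notation T := (tensalg_vectp V).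
Local Notation tc := (@tcons K V : V -> T -> T).
Variables (C : T -> tens T T) (Q : subgr T).
Hypothesis CP : is_coproduct C.
Hypothesis C1 : C vone = vone ⊗ vone.
Hypothesis QE : forall x, sgmem Q x <-> kereps x /\ half C x = x ⊗ vone.

Lemma letter_mem v : sgmem Q (tc v vone).
Proof.
have CL := cop_linear CP.
by apply/QE; split; [apply: eps_tc|rewrite half_tc // C1 consl_pure].
Qed.

Definition letter_fun (v : V) : sgtype Q := sgmk (letter_mem v).

Lemma letter_linear : linear letter_fun.
Proof. by move=> a u v; apply: sgval_inj; rewrite /= tconsl. Qed.

Lemma letter_gpr n v : letter_fun (gpr n v) = sggpr n (letter_fun v).
Proof.
pose h (v : V) : T := tc v vone.
have hL : linear h by rewrite /h; lin.
apply: sgval_inj; suff: h (gpr n v) = gpr n (h v) by [].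
move: v; apply: homog_ext => [||d v vd].
- exact: lin_compose hL (@gpr_linear _ V n).
- exact: lin_compose (@gpr_linear _ T n) hL.
rewrite (homog_gpr _ vd) (homog_gpr (n := d)).
  by case: ifP => // _; apply: lin0.
by rewrite -[d]addn0; apply: homog_tc => //; apply: homog_vone.
Qed.

Definition letter : ghom V (sggraded Q) :=
  @GHom K V (sggraded Q) letter_fun letter_linear letter_gpr.

Lemma letterK : cancel letter (fun x => letter1 (sgval x)).
Proof. by move=> v; rewrite /= letter1_tc veps_one scale1r. Qed.

Lemma letter1K : cancel (fun x : sgtype Q => letter1 (sgval x)) letter.
Proof.
move=> x; apply: sgval_inj; have [x0 Dx] := (QE _).1 (sgvalP x).
rewrite /= -[RHS](epos_id x0) -(half_split CP) Dx tsum_pure //.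
by have lL := @letter1_linear K V; lin.
Qed.

Lemma letter1_sg_linear : linear (fun x : sggraded Q => letter1 (sgval x)).
Proof.
by apply: lin_compose (@letter1_linear K V) _; exact: (@sgval_linear K T Q).
Qed.

Lemma letter1_sg_gpr n (x : sggraded Q) :
  letter1 (sgval (gpr n x)) = gpr n (letter1 (sgval x)).
Proof. by rewrite -{1}(letter1K x) -(gfun_gpr letter) letterK. Qed.

Definition unletter : ghom (sggraded Q) V :=
  @GHom K (sggraded Q) V _ letter1_sg_linear letter1_sg_gpr.

End FreePrimitives.

(** * Schur-Weyl categories *)

Section NaturalIsomorphisms.

Lemma natiso_inv_nat (C D : category) (F G : functor C D) (i : natiso F G)
    x y (f : hom x y) :
  cpc (nbwd i y) (fmap G f) = cpc (fmap F f) (nbwd i x).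
Proof.
rewrite -[LHS]cpm1 -(nbwdK i x) !cpA -[cpc (cpc _ _) (nfwd i x)]cpA -nnat cpA.
by rewrite nfwdK cp1m.
Qed.

Lemma isomorphic_sym (C D : category) (F G : functor C D) :
  isomorphic F G -> isomorphic G F.
Proof.
case=> i; constructor; exists (fun x => nbwd i x) (fun x => nfwd i x).
- exact: natiso_inv_nat.
- exact: nbwdK.
- exact: nfwdK.
Qed.

Lemma isomorphic_trans (C D : category) (F G H : functor C D) :
  isomorphic F G -> isomorphic G H -> isomorphic F H.
Proof.
case=> i [j]; constructor.
exists (fun x => cpc (nfwd j x) (nfwd i x)) (fun x => cpc (nbwd i x) (nbwd j x)).
- by move=> x y f; rewrite -cpA nnat cpA nnat cpA.
- by move=> x; rewrite cpA -[cpc (cpc _ _) (nfwd j x)]cpA nfwdK cpm1 nfwdK.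
- by move=> x; rewrite cpA -[cpc (cpc _ _) (nbwd i x)]cpA nbwdK cpm1 nbwdK.
Qed.

Lemma isomorphic_compl (C D E : category) (G : functor D E) (F F' : functor C D) :
  isomorphic F F' -> isomorphic (fcomp G F) (fcomp G F').
Proof.
case=> i; constructor; exists (fun x => fmap G (nfwd i x) : hom (fcomp G F x) _)
  (fun x => fmap G (nbwd i x) : hom (fcomp G F' x) _).
- by move=> x y f /=; rewrite -!fmapM nnat.
- by move=> x /=; rewrite -fmapM nfwdK fmap1.
- by move=> x /=; rewrite -fmapM nbwdK fmap1.
Qed.

Lemma isomorphic_compr (C D E : category) (G G' : functor D E) (F : functor C D) :
  isomorphic G G' -> isomorphic (fcomp G F) (fcomp G' F).
Proof.
case=> i; constructor; exists (fun x => nfwd i (F x) : hom (fcomp G F x) _)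
  (fun x => nbwd i (F x) : hom (fcomp G' F x) _).
- by move=> x y f /=; rewrite nnat.
- by move=> x /=; rewrite nfwdK.
- by move=> x /=; rewrite nbwdK.
Qed.

Lemma fcompA_iso (A B C D : category) (H : functor C D) (G : functor B C)
    (F : functor A B) :
  isomorphic (fcomp H (fcomp G F)) (fcomp (fcomp H G) F).
Proof.
constructor; exists (fun x => idc (H (G (F x)))) (fun x => idc (H (G (F x)))).
- by move=> x y f /=; rewrite cp1m cpm1.
- by move=> x; rewrite cp1m.
- by move=> x; rewrite cp1m.
Qed.

Lemma fcomp1_iso (C D : category) (F : functor C D) :
  isomorphic (fcomp F (fid C)) F.
Proof.
constructor; exists (fun x => idc (F x) : hom (fcomp F (fid C) x) (F x))
  (fun x => idc (F x) : hom (F x) (fcomp F (fid C) x)).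
- by move=> x y f /=; rewrite cp1m cpm1.
- by move=> x; rewrite cp1m.
- by move=> x; rewrite cp1m.
Qed.

(** G F ≅ M Q L P ≅ M P ≅ id. It is applied with Vect as [X], free functors as [L] and [M], and
    functors of primitive elements as [P] and [Q]. *)
Lemma fcomp_factor_id (C D X : category) (F : functor C D) (G : functor D C)
    (P : functor C X) (L : functor X D) (Q : functor D X) (M : functor X C) :
  isomorphic F (fcomp L P) -> isomorphic G (fcomp M Q) ->
  isomorphic (fcomp Q L) (fid X) -> isomorphic (fcomp M P) (fid C) ->
  isomorphic (fcomp G F) (fid C).
Proof.
move=> FLP GMQ QL MP; apply: isomorphic_trans MP.
apply: (isomorphic_trans (isomorphic_compr F GMQ)).
apply: (isomorphic_trans (isomorphic_compl (fcomp M Q) FLP)).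
apply: (isomorphic_trans (fcompA_iso (fcomp M Q) L P)).
apply: isomorphic_compr.
apply: (isomorphic_trans (isomorphic_sym (fcompA_iso M Q L))).
exact: isomorphic_trans (isomorphic_compl M QL) (fcomp1_iso M).
Qed.

End NaturalIsomorphisms.

(** * Change of structure along the free functors *)

Section SchurWeyl.
Variable K : fieldType.

Section FreeFunctor.
Variable S : structure K.
Variable fr : forall V : vect K, cstr S (tensalg_vectp V).
Hypothesis fr_mor : forall (V W : vect K) (f : ghom V W),
  cmor S (fr V) (fr W) (tamap_hom f).

Definition free_functor : functor (VectCat K) (scat S).
Proof.
apply: (@Functor (VectCat K) (scat S) (fun V => SObj (fr V))
  (fun V W f => @SHom K S (SObj (fr V)) (SObj (fr W)) (tamap_hom f) (fr_mor f))).
  by move=> V; apply: shom_eq; exact: (fmap1 (TensAlg K) V).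
move=> U V W g f; apply: shom_eq; exact: (fmapM (TensAlg K) g f).
Defined.

End FreeFunctor.

(* A Schur-Weyl category in which [T(V)] is the structure freely built on [V]
   and structures can be transported along isomorphisms of [Vect^+]. *)
Record schur_weyl (S : structure K) (P : functor (scat S) (VectCat K)) :=
  SchurWeyl {
  sw_free : forall V : vect K, cstr S (tensalg_vectp V);
  sw_free_mor : forall (V W : vect K) (f : ghom V W),
    cmor S (sw_free V) (sw_free W) (tamap_hom f);
  sw_prim_free : isomorphic (fcomp P (free_functor sw_free_mor)) (fid (VectCat K));
  sw_iso : forall X : scat S, vphom (tensalg_vectp (P X)) (scar X);
  sw_iso_bij : forall X : scat S, bijective (sw_iso X);
  sw_iso_nat : forall (X Y : scat S) (f : shom X Y) t,
    sw_iso Y (tamap_hom (fmap P f : ghom _ _) t) = f (sw_iso X t);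
  sw_iso_mor : forall X : scat S, cmor S (sw_free (P X)) (sstr X) (sw_iso X);
  sw_mor_inv : forall (V W : vectp K) (f : vphom V W) (g : vphom W V) s t,
    cancel f g -> cancel g f -> cmor S s t f -> cmor S t s g;
  sw_transp : forall (V W : vectp K) (f : vphom V W) (g : vphom W V),
    cancel f g -> cancel g f ->
    forall s : cstr S V, {t : cstr S W | cmor S s t f} }.

(** Bijectivity is only a proposition, so the inverse is extracted by choice; as data it can enter
    natural isomorphisms and transported structures. *)
Lemma vphom_inverse (V W : vectp K) (f : vphom V W) : bijective f ->
  {g : vphom W V | cancel f g /\ cancel g f}.
Proof.
move=> fB; have /cid[g [fK gK]] : exists g, cancel f g /\ cancel g f.
  by case: fB => g ? ?; exists g.
have fL := gfun_linear f.
have gL : linear g.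
  by move=> a x y; apply: (can_inj fK); rewrite fL !gK.
have gg n x : g (gpr n x) = gpr n (g x).
  by apply: (can_inj fK); rewrite gfun_gpr !gK.
have g1 : g vone = vone by apply: (can_inj fK); rewrite gK vpfun1.
by exists (@VPHom K W V (@GHom K W V g gL gg) g1).
Qed.

Section Inverse.
Variables (S : structure K) (P : functor (scat S) (VectCat K)).
Variable w : schur_weyl P.

Definition sw_inv (X : scat S) : vphom (scar X) (tensalg_vectp (P X)) :=
  sval (vphom_inverse (sw_iso_bij w X)).

Lemma sw_isoK X : cancel (sw_iso w X) (sw_inv X).
Proof. exact: (proj1 (svalP (vphom_inverse (sw_iso_bij w X)))). Qed.

Lemma sw_invK X : cancel (sw_inv X) (sw_iso w X).
Proof. exact: (proj2 (svalP (vphom_inverse (sw_iso_bij w X)))). Qed.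

Definition sw_natiso : natiso (fcomp (TensAlg K) P) (forget S).
Proof.
apply: (@NatIso _ _ (fcomp (TensAlg K) P) (forget S)
  (fun X => sw_iso w X) (fun X => sw_inv X)).
- by move=> X Y f; apply: vphom_eq => t; exact: (sw_iso_nat w).
- by move=> X; apply: vphom_eq => t; exact: sw_isoK.
- by move=> X; apply: vphom_eq => t; exact: sw_invK.
Defined.

Lemma sw_free_prim :
  isomorphic (fcomp (free_functor (sw_free_mor w)) P) (fid (scat S)).
Proof.
pose L := free_functor (sw_free_mor w).
pose i (X : scat S) : shom (L (P X)) X :=
  @SHom K S (L (P X)) X (sw_iso w X) (sw_iso_mor w X).
have invP X : cmor S (sstr X) (sw_free w (P X)) (sw_inv X).
  apply: (sw_mor_inv w) (sw_iso_mor w X); [exact: sw_isoK|exact: sw_invK].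
pose j (X : scat S) : shom X (L (P X)) := @SHom K S X (L (P X)) (sw_inv X) (invP X).
constructor; exists i j.
- move=> X Y f; apply: shom_eq; apply: vphom_eq => t; exact: (sw_iso_nat w).
- by move=> X; apply: shom_eq; apply: vphom_eq => t; exact: sw_isoK.
- by move=> X; apply: shom_eq; apply: vphom_eq => t; exact: sw_invK.
Qed.

End Inverse.

Section Restructuring.
Variables (S T : structure K).
Variables (P : functor (scat S) (VectCat K)) (Q : functor (scat T) (VectCat K)).
Variables (w : schur_weyl P) (w' : schur_weyl Q).

(** The free structure on T(P(X)) is brought back to the carrier of [X] itself, so that the functor
    built from it commutes with the forgetful functors by identity maps. *)
Definition sw_str (X : scat S) : cstr T (scar X) :=
  sval (sw_transp w' (@sw_isoK _ _ w X) (@sw_invK _ _ w X) (sw_free w' (P X))).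

Lemma sw_str_iso X : cmor T (sw_free w' (P X)) (sw_str X) (sw_iso w X).
Proof.
exact: svalP (sw_transp w' (@sw_isoK _ _ w X) (@sw_invK _ _ w X) (sw_free w' (P X))).
Qed.

Lemma sw_str_inv X : cmor T (sw_str X) (sw_free w' (P X)) (sw_inv w X).
Proof.
by apply: (sw_mor_inv w') (sw_str_iso X); [exact: sw_isoK|exact: sw_invK].
Qed.

(** By naturality [f] is the composite of [sw_inv w X], the map of tensor algebras induced by
    [fmap P f], and [sw_iso w Y]. All three are morphisms for [T]. *)
Lemma sw_str_mor (X Y : scat S) (f : shom X Y) :
  cmor T (sw_str X) (sw_str Y) f.
Proof.
have h := cmor_comp (sw_str_iso Y)
  (cmor_comp (sw_free_mor w' (fmap P f : ghom _ _)) (sw_str_inv X)).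
suff -> : smap f = vpcomp (sw_iso w Y)
    (vpcomp (tamap_hom (fmap P f : ghom _ _)) (sw_inv w X)) by exact: h.
by apply: vphom_eq => x; rewrite /= [RHS](sw_iso_nat w) sw_invK.
Qed.

Definition sw_restructuring : restructuring S T :=
  @Restructuring K S T (fun V s => sw_str (SObj s))
    (fun V W s t f fP => @sw_str_mor (SObj s) (SObj t)
       (@SHom K S (SObj s) (SObj t) f fP)).

Lemma sw_refunctor_iso : isomorphic (refunctor sw_restructuring)
  (fcomp (free_functor (sw_free_mor w')) P).
Proof.
apply: isomorphic_sym; constructor.
pose F := refunctor sw_restructuring.
pose L := free_functor (sw_free_mor w').
have iP (X : scat S) : cmor T (sw_free w' (P X)) (sstr (F X)) (sw_iso w X).
  by case: X => V s; exact: (sw_str_iso (SObj s)).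
have jP (X : scat S) : cmor T (sstr (F X)) (sw_free w' (P X)) (sw_inv w X).
  by case: X => V s; exact: (sw_str_inv (SObj s)).
pose i (X : scat S) : shom (L (P X)) (F X) :=
  @SHom K T (L (P X)) (F X) (sw_iso w X) (iP X).
pose j (X : scat S) : shom (F X) (L (P X)) :=
  @SHom K T (F X) (L (P X)) (sw_inv w X) (jP X).
exists i j.
- move=> X Y f; apply: shom_eq; apply: vphom_eq => t; exact: (sw_iso_nat w).
- by move=> X; apply: shom_eq; apply: vphom_eq => t; exact: (sw_isoK w).
- by move=> X; apply: shom_eq; apply: vphom_eq => t; exact: (sw_invK w).
Qed.

Lemma forget_refunctor (r : restructuring S T) :
  isomorphic (fcomp (forget T) (refunctor r)) (forget S).
Proof.
constructor; exists (fun X : scat S => vpid (scar X))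
  (fun X : scat S => vpid (scar X)).
- by move=> X Y f; apply: vphom_eq.
- by move=> X; apply: vphom_eq.
- by move=> X; apply: vphom_eq.
Qed.

End Restructuring.

Lemma sw_quasi_inverse (S T : structure K) (P : functor (scat S) (VectCat K))
    (Q : functor (scat T) (VectCat K)) (w : schur_weyl P) (w' : schur_weyl Q) :
  quasi_inverse (refunctor (sw_restructuring w w'))
                (refunctor (sw_restructuring w' w)).
Proof.
split.
  apply: (fcomp_factor_id (sw_refunctor_iso w w') (sw_refunctor_iso w' w)).
    exact: sw_prim_free.
  exact: sw_free_prim.
apply: (fcomp_factor_id (sw_refunctor_iso w' w) (sw_refunctor_iso w w')).
  exact: sw_prim_free.
exact: sw_free_prim.
Qed.

Lemma sw_isomorphic_over (S T : structure K) (P : functor (scat S) (VectCat K))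
    (Q : functor (scat T) (VectCat K)) :
  schur_weyl P -> schur_weyl Q -> isomorphic_over S T.
Proof.
move=> w w'; have e := sw_quasi_inverse w w'; have e' := sw_quasi_inverse w' w.
split; last by exists (sw_restructuring w' w), (refunctor (sw_restructuring w w')).
  exists (refunctor (sw_restructuring w w')), (refunctor (sw_restructuring w' w)).
  by split=> //; exact: forget_refunctor.
by exists (sw_restructuring w w'), (refunctor (sw_restructuring w' w)).
Qed.

End SchurWeyl.

(** * The action of graded permutations *)

Section Action.
Variable K : fieldType.

Lemma word_zero (U : lmodType K) (w : seq U) : 0 \in w -> word w = 0.
Proof.
case/splitPr=> s t; have := word_multilin s (-1) 0 0 t.
by rewrite scaler0 addr0 scaleN1r addNr.
Qed.

Section OneSpace.
Variable V : vect K.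
Local Notation T := (tensalg_vectp V).

Lemma gperm_act_linear (s : gperm) : linear (gperm_act s : T -> T).
Proof.
case: s => k [sigma d].
exact: plift_linear (word_compat (gperm_act_multilin sigma d)).
Qed.

Lemma gperm_actE k (sigma : 'S_k) (d : {ffun 'I_k -> posnat}) (w : seq V) :
  gperm_act (existT _ k (sigma, d)) (word w) =
  if size w == k
  then word [seq gpr (val (d i)) (nth 0 w (sigma i)) | i <- enum 'I_k]
  else 0.
Proof. exact: plift_gen (word_compat (gperm_act_multilin sigma d)) _. Qed.

Lemma permalg_act_gen s (t : T) : permalg_act (pgen s) t = gperm_act s t.
Proof. exact: plift_gen. Qed.

Lemma permalg_act_linearl (t : T) :
  linear (fun a : permalg K => permalg_act a t : T).
Proof. exact: plift_linear. Qed.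

Lemma permalg_act_linearr a : linear (permalg_act a : T -> T).
Proof.
move=> c x y; move: a; apply: pres_ext => [||s].
- exact: permalg_act_linearl.
- by apply: lin_add; [apply: lin_scale|]; apply: permalg_act_linearl.
- by rewrite !permalg_act_gen gperm_act_linear.
Qed.

Lemma hword_degrees m (w : seq V) : hword m w -> exists c : nat -> nat,
  (forall i, (i < size w)%N -> homog (c i) (nth 0 w i)) /\
  m = (\sum_(i < size w) c i)%N.
Proof.
elim=> {m w} [|d v n w vd hw [c [ch ->]]]; first by exists id; rewrite big_ord0.
exists (fun i => if i is i'.+1 then c i' else d); split.
  by case=> [|i] //= /ch.
by rewrite big_ord_recl.
Qed.

(** A homogeneous word is either killed or has its letters permuted; reindexing along σ shows that
    the total degree does not change. *)
Lemma gperm_act_gpr s n (t : T) : gperm_act s (gpr n t) = gpr n (gperm_act s t : T).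
Proof.
have sL := @gperm_act_linear s.
rewrite -[gpr n t]/(tagr n t) -[RHS]/(tagr n (gperm_act s t)).
move: t; apply: hspan_ext => [||m w hw].
- exact: lin_compose sL (@tagr_linear _ _ n).
- exact: lin_compose (@tagr_linear _ _ n) sL.
have [c [ch mE]] := hword_degrees hw; rewrite {m}mE in hw *.
case: s sL => k [sigma d] sL; case: (size w =P k) => [wk|/eqP/negPf wk]; last first.
  rewrite gperm_actE wk (tagr_hword n hw) (lin0 (tagr_linear n)).
  by case: ifP => // _; [rewrite gperm_actE wk|exact: lin0 sL].
have wc (i : 'I_k) : homog (c i) (nth 0 w i) by apply: ch; rewrite wk.
have aE := @gperm_act_word _ V k sigma d w (fun i => c i) wk wc.
have aE' := aE; rewrite (tagr_hword n hw) aE; case: ifP aE => _ aE; last first.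
  rewrite (lin0 (tagr_linear n)).
  by case: ifP => // _; exact: lin0 sL.
have h l : hword (\sum_(i <- l) c (sigma i)) [seq nth 0 w (sigma i) | i <- l].
  elim: l => [|i l ih]; first by rewrite big_nil; constructor.
  by rewrite big_cons /=; constructor.
rewrite (tagr_hword n (h (enum 'I_k))).
have -> : (\sum_(i <- enum 'I_k) c (sigma i) = \sum_(i < size w) c i)%N.
  rewrite big_enum wk /= [RHS](reindex_inj (@perm_inj _ sigma)).
  by [].
by case: ifP => // _; exact: lin0 sL.
Qed.

Lemma permalg_act_gpr a n (t : T) :
  permalg_act a (gpr n t) = gpr n (permalg_act a t : T).
Proof.
move: a; apply: pres_ext => [||s]; first exact: permalg_act_linearl.
  by apply: lin_compose (@gpr_linear _ T n) _; exact: permalg_act_linearl.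
by rewrite !permalg_act_gen gperm_act_gpr.
Qed.

Lemma gperm_mul_neq k l (x : 'S_k * {ffun 'I_k -> posnat})
    (y : 'S_l * {ffun 'I_l -> posnat}) :
  k <> l -> gperm_mul K (existT _ k x) (existT _ l y) = 0.
Proof.
case: x => sigma d /eqP/negPf kl; rewrite /gperm_mul /= kl /=.
by case: (tagged_as _ _).
Qed.

Lemma gperm_mul_eq k (sigma tau : 'S_k) (d e : {ffun 'I_k -> posnat}) :
  gperm_mul K (existT _ k (sigma, d)) (existT _ k (tau, e)) =
  if d == [ffun i => e (sigma i)]
  then pgen (existT _ k ((sigma * tau)%g, d)) else 0.
Proof. by rewrite /gperm_mul tagged_asE /= eqxx. Qed.

(** After both actions, position i holds the letter of index τ(σ(i)), projected to degree e(σ(i))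
    and then to degree d(i). If d = e ∘ σ the second projection repeats the first; otherwise some
    letter becomes 0, and the word with it. *)
Lemma gperm_mul_act s u (t : T) :
  permalg_act (gperm_mul K s u) t = gperm_act s (gperm_act u t).
Proof.
have uL := gperm_act_linear u; have sL := gperm_act_linear s.
move: t; apply: tensalg_ext => [||w].
- exact: permalg_act_linearr.
- by move=> a x y; rewrite uL sL.
have L0 : permalg_act (0 : permalg K) (word w) = 0 :> T.
  exact: lin0 (permalg_act_linearl (word w)).
case: s sL => k [sigma d] sL; case: u uL => l [tau e] uL.
rewrite gperm_actE; case: (k =P l) => [kl|kl]; last first.
  rewrite gperm_mul_neq // L0; case: ifP => _; last by rewrite (lin0 sL).
  rewrite gperm_actE size_map size_enum_ord; case: eqP => // e'.
  by case: kl.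
case: l / kl tau e uL => tau e uL; rewrite gperm_mul_eq.
have actE : gperm_act (existT _ k (sigma, d))
    (word [seq gpr (val (e i)) (nth 0 w (tau i)) | i <- enum 'I_k] : T) =
    word [seq gpr (val (d i)) (gpr (val (e (sigma i))) (nth 0 w (tau (sigma i))))
         | i <- enum 'I_k].
  rewrite gperm_actE size_map size_enum_ord eqxx; congr word.
  apply: eq_map => i; congr gpr.
  by rewrite (nth_map i) ?size_enum_ord // nth_ord_enum.
case: eqP => [de|/eqP de].
  rewrite permalg_act_gen gperm_actE; case: ifP => _; last by rewrite (lin0 sL).
  rewrite {}actE; congr word; apply: eq_map => i.
  have -> : d i = e (sigma i) by rewrite de ffunE.
  by rewrite gprK eqxx permM.
rewrite L0; case: ifP => _; last by rewrite (lin0 sL).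
rewrite actE word_zero //.
have [i di] : exists i, d i != e (sigma i).
  apply/existsP; apply: contraR de; rewrite negb_exists => /forallP de.
  by apply/eqP/ffunP => i; rewrite ffunE; have := de i; rewrite negbK => /eqP.
apply/mapP; exists i; first by rewrite mem_enum.
by rewrite gprK (inj_eq val_inj) (negPf di).
Qed.

Lemma permalg_mul_act a b (t : T) :
  permalg_act (permalg_mul a b) t = permalg_act a (permalg_act b t).
Proof.
have plL (X : choiceType) (W : lmodType K) (f : X -> W) :
    linear (plift f : @pres K X (fun _ _ => False) -> W) by exact: plift_linear.
have aL := permalg_act_linearr; have aL' := permalg_act_linearl.
have mL b' : linear (fun a : permalg K => permalg_mul a b') by exact: plL.
move: a; apply: pres_ext => [||s].
- by move=> c x y; rewrite mL aL'.
- exact: aL'.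
rewrite permalg_act_gen.
have mE b' : permalg_mul (pgen s) b' = plift (fun u => gperm_mul K s u) b'.
  exact: plift_gen.
move: b; apply: pres_ext => [||u].
- by move=> c x y; rewrite !mE plL aL'.
- by move=> c x y; rewrite aL' gperm_act_linear.
by rewrite mE plift_gen // permalg_act_gen gperm_mul_act.
Qed.

End OneSpace.

Lemma permalg_act_nat (V W : vect K) (g : ghom V W) a
    (t : tensalg_vectp V) :
  permalg_act a (tamap_hom g t) = tamap_hom g (permalg_act a t).
Proof.
have aL (U : vect K) (t' : tensalg_vectp U) := permalg_act_linearl t'.
have gL := gfun_linear (tamap_hom g).
move: a; apply: pres_ext => [||s].
- exact: aL.
- by move=> c x y; rewrite aL gL.
rewrite !permalg_act_gen; have sL (U : vect K) := @gperm_act_linear U s.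
move: t; apply: tensalg_ext => [||w].
- by move=> c x y; rewrite gL sL.
- by move=> c x y; rewrite sL gL.
case: s {sL} => k [sigma d].
rewrite [tamap_hom g (word w)]tamap_word !gperm_actE size_map.
case: eqP => wk; last by rewrite (lin0 gL).
rewrite [RHS]tamap_word -map_comp; congr word; apply: eq_map => i /=.
by rewrite gfun_gpr (nth_map 0) // wk.
Qed.

End Action.

Lemma sw_action (K : fieldType) (S : structure K)
    (P : functor (scat S) (VectCat K)) :
  schur_weyl P -> has_natural_permalg_action P.
Proof.
move=> w; exists (sw_natiso w); split=> [X|X Y f a x].
  have iL := gfun_linear (sw_iso w X); have jL := gfun_linear (sw_inv w X).
  split.
  - by move=> x c a b; rewrite /transported_action /= permalg_act_linearl iL.
  - by move=> a c x y; rewrite /transported_action /= jL permalg_act_linearr iL.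
  - move=> a n x; rewrite /transported_action /= gfun_gpr.
    by rewrite (permalg_act_gpr a n) gfun_gpr.
  - by move=> a b x; rewrite /transported_action /= sw_isoK permalg_mul_act.
rewrite /transported_action /= -(sw_iso_nat w); congr (gfun _ _).
rewrite -permalg_act_nat; congr permalg_act.
by apply: (can_inj (@sw_isoK _ _ _ w Y)); rewrite (sw_iso_nat w) !sw_invK.
Qed.

(** * The three Schur-Weyl categories *)

(** θ uses ▷ only with primitive left factors, and [f] is asked to respect just these products; for
    shuffle morphisms this places the left factor in Ker ε. *)
Lemma theta_nat (K : fieldType) (B B' : vectp K) (C D : B -> tens B B)
    (C' D' : B' -> tens B' B') (act : B -> B -> B) (act' : B' -> B' -> B')
    (H : half_bialgebra C D act) (H' : half_bialgebra C' D' act')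
    (P : subgr B) (P' : subgr B') (P0 : forall x, sgmem P x -> gpr 0 x = 0)
    (P0' : forall x, sgmem P' x -> gpr 0 x = 0) (f : vphom B B')
    (g : ghom (sgvect P0) (sgvect P0')) :
  (forall v, sgval (g v) = f (sgval v)) ->
  (forall x y, sgmem P x -> f (act x y) = act' (f x) (f y)) ->
  forall t, theta H' P0' (tamap_hom g t) = f (theta H P0 t).
Proof.
move=> gf fact; have gL := gfun_linear (tamap_hom g); have fL := gfun_linear f.
have tL := gfun_linear (theta H P0); have tL' := gfun_linear (theta H' P0').
apply: T_ext => [|||v t ih]; [by lin|by lin| |].
  by rewrite free_map_one !theta_one vpfun1.
rewrite free_map_tc !theta_tc ih gf fact //.
exact: sgvalP v.
Qed.

Section Instances.
Variable K : fieldType.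

(** The subspace is built from a proof [CP], and the functors for shuffle and infinitesimal
    bialgebras supply different ones; hence an arbitrary [CP]. *)
Lemma deconc_prim (V : vect K) (CP : is_coproduct (@deconc K V)) x :
  sgmem (Prim_subgr CP) x <->
  kereps x /\ half (@deconc K V) x = x ⊗ vone.
Proof.
have -> : half (@deconc K V) x = cop_half (@deconc K V) x.
  by rewrite /cop_half deconc_half addrC addrA addNr add0r.
exact: cop_half_prim (deconc_coproduct V) x.
Qed.

Lemma infinitesimal_prim_free : isomorphic (fcomp (infinitesimal_prim K)
    (free_functor (S := infinitesimal_structure K)
       (@free_infinitesimal_mor K)))
  (fid (VectCat K)).
Proof.
constructor; unshelve eexists.
- by move=> V; exact: (unletter (deconc_coproduct V) (@deconc_one K V)
    (deconc_prim _)).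
- by move=> V; exact: (letter (deconc_coproduct V) (@deconc_one K V)
    (deconc_prim _)).
- by move=> V W f; apply: ghom_eq => x; exact: free_map_letter1.
- by move=> V; apply: ghom_eq => x; exact: letter1K.
- by move=> V; apply: ghom_eq => x; exact: letterK.
Qed.

Lemma infinitesimal_schur_weyl : schur_weyl (infinitesimal_prim K).
Proof.
apply: (@SchurWeyl K (infinitesimal_structure K) (infinitesimal_prim K)
  (@free_infinitesimal K) (@free_infinitesimal_mor K) infinitesimal_prim_free
  (fun X => theta (inf_half (sstr X)) (P := Prim_subgr (inf_coproduct (sstr X)))
     (Prim_gpr0 (inf_coproduct (sstr X))))).
- by move=> X; apply: theta_bij; exact: inf_prim.
- move=> X Y f; apply: theta_nat => // x y _; exact: (infm_mul (smapP f)).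
- by move=> X; exact: inf_theta_mor.
- by move=> V W f g s t fK gK; exact: infinitesimal_mor_inv.
- move=> V W f g fK gK s; exists (transp_infinitesimal fK gK s).
  exact: transp_infinitesimal_mor.
Qed.

Lemma shuffle_prim_free : isomorphic (fcomp (shuffle_prim K)
    (free_functor (S := shuffle_structure K) (@free_shuffle_mor K)))
  (fid (VectCat K)).
Proof.
constructor; unshelve eexists.
- by move=> V; exact: (unletter (deconc_coproduct V) (@deconc_one K V)
    (deconc_prim (bialg_coproduct (sh_bialg (free_shuffle V))))).
- by move=> V; exact: (letter (deconc_coproduct V) (@deconc_one K V)
    (deconc_prim (bialg_coproduct (sh_bialg (free_shuffle V))))).
- by move=> V W f; apply: ghom_eq => x; exact: free_map_letter1.
- by move=> V; apply: ghom_eq => x; exact: letter1K.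
- by move=> V; apply: ghom_eq => x; exact: letterK.
Qed.

(** Morphisms respect ≺ on Ker ε; the case [y = 1] is added because θ of the empty word is 1, and
    holds since x ≺ 1 = x on both sides. *)
Lemma shuffle_mor_prec (B B' : vectp K) (s : shuffle_bialgebra B)
    (s' : shuffle_bialgebra B') (f : vphom B B') x y :
  shuffle_mor s s' f -> kereps x ->
  f (sh_prec s x y) = sh_prec s' (f x) (f y).
Proof.
move=> fP x0; have fL := gfun_linear f; have pB := sh_prec_bilin s.
have pB' := sh_prec_bilin s'.
move: y; apply: eps_ext => [|||y y0]; [by lin|by lin| |exact: (shm_prec fP)].
by rewrite vpfun1 !sh_precx1 //; apply: kereps_vphom.
Qed.

Lemma shuffle_schur_weyl : schur_weyl (shuffle_prim K).
Proof.
apply: (@SchurWeyl K (shuffle_structure K) (shuffle_prim K)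
  (@free_shuffle K) (@free_shuffle_mor K) shuffle_prim_free
  (fun X => theta (sh_half (sstr X))
     (P := Prim_subgr (bialg_coproduct (sh_bialg (sstr X))))
     (Prim_gpr0 (bialg_coproduct (sh_bialg (sstr X)))))).
- by move=> X; apply: theta_bij; exact: sh_prim.
- move=> X Y f; apply: theta_nat => // x y Px.
  apply: shuffle_mor_prec (smapP f) _.
  by case: ((sh_prim _ _).1 Px).
- by move=> X; exact: sh_theta_mor.
- by move=> V W f g s t fK gK; exact: shuffle_mor_inv.
- move=> V W f g fK gK s; exists (transp_shuffle fK gK s).
  exact: transp_shuffle_mor.
Qed.

Lemma free_unshuffle_prim (V : vect K) x :
  sgmem (PrecPrim_subgr (free_unshuffle V)) x <->
  kereps x /\ half (@unsh K V) x = x ⊗ vone.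
Proof. by []. Qed.

Lemma unshuffle_prim_free : isomorphic (fcomp (unshuffle_prim K)
    (free_functor (S := unshuffle_structure K) (@free_unshuffle_mor K)))
  (fid (VectCat K)).
Proof.
constructor; unshelve eexists.
- by move=> V; exact: (unletter (unsh_coproduct V) (@unsh_one K V)
    (@free_unshuffle_prim V)).
- by move=> V; exact: (letter (unsh_coproduct V) (@unsh_one K V)
    (@free_unshuffle_prim V)).
- by move=> V W f; apply: ghom_eq => x; exact: free_map_letter1.
- by move=> V; apply: ghom_eq => x; exact: letter1K.
- by move=> V; apply: ghom_eq => x; exact: letterK.
Qed.

Lemma unshuffle_schur_weyl : schur_weyl (unshuffle_prim K).
Proof.
apply: (@SchurWeyl K (unshuffle_structure K) (unshuffle_prim K)
  (@free_unshuffle K) (@free_unshuffle_mor K) unshuffle_prim_free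
  (fun X => theta (un_half (sstr X)) (P := PrecPrim_subgr (sstr X))
     (@PrecPrim_gpr0 K _ (sstr X)))).
- by move=> X; apply: theta_bij; exact: un_prim.
- move=> X Y f; apply: theta_nat => // x y _; exact: (unm_mul (smapP f)).
- by move=> X; exact: un_theta_mor.
- by move=> V W f g s t fK gK; exact: unshuffle_mor_inv.
- move=> V W f g fK gK s; exists (transp_unshuffle fK gK s).
  exact: transp_unshuffle_mor.
Qed.

End Instances.

Theorem theorem15 (K : fieldType) :
  [/\ isomorphic_over (shuffle_structure K) (unshuffle_structure K),
      isomorphic_over (shuffle_structure K) (infinitesimal_structure K)
    & isomorphic_over (unshuffle_structure K) (infinitesimal_structure K)]
  /\
  [/\ has_natural_permalg_action (shuffle_prim K),
      has_natural_permalg_action (unshuffle_prim K)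
    & has_natural_permalg_action (infinitesimal_prim K)].
Proof.
have wS := shuffle_schur_weyl K; have wU := unshuffle_schur_weyl K.
have wI := infinitesimal_schur_weyl K.
split; first by split; [exact: sw_isomorphic_over wS wU
  |exact: sw_isomorphic_over wS wI|exact: sw_isomorphic_over wU wI].
by split; apply: sw_action.
Qed.
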